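(* Let $\mathcal H$ be an étale groupoid such that $\mathcal H_0$ is locally path-connected, and let $b\in\mathcal H_0$. Then there is an isomorphism of groups $\Phi:\pi_1(\mathcal H,b)\to\Pi_1(\mathcal H,b)$.
   Context: Topological groupoid: spaces $\mathcal H_0,\mathcal H_1$, continuous $\mathrm{dom},\mathrm{cod}$, units, composition, inverse, $\mathrm{dom}$ open; étale if $\mathrm{dom}$ is a local homeomorphism; $\mathcal H(x,y)$ = morphisms from $x$ to $y$. $\pi_1(\mathcal H,b)$: an $\mathcal H$-loop at $b$ is a sequence of paths $\sigma_0,\dots,\sigma_n$ in $\mathcal H_0$ and $h_i\in\mathcal H(\sigma_{i-1}(1),\sigma_i(0))$ with $\sigma_0(0)=\sigma_n(1)=b$; $\pi_1(\mathcal H,b)$ is the group under concatenation of such loops modulo the equivalence generated by removing a constant $\sigma_i$ ($0<i<n$) and composing $h_{i+1}\circ h_i$, removing an identity $h_i$ and concatenating $\sigma_{i-1},\sigma_i$, and deformations (homotopies $D_i$ from $\sigma_i$ to $\sigma'_i$ and paths $d_i$ in $\mathcal H_1$ from $h_i$ to $h'_i$ with $\mathrm{dom}\circ d_i=D_{i-1}(\cdot,1)$, $\mathrm{cod}\circ d_i=D_i(\cdot,0)$, $D_0(\cdot,0)\equiv D_n(\cdot,1)\equiv b$). $\Pi_1(\mathcal H,b)$: a principal $\mathcal H$-bundle over a space $X$ is a space $E$ with continuous $p:E\to\mathcal H_0$, $w:E\to X$ and a left $\mathcal H$-action w.r.t. $p$ preserving $w$, with $w$ an open surjection and $(h,e)\mapsto(h\cdot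 e,e)$ a homeomorphism $\mathcal H_1\times_{\mathcal H_0}E\to E\times_XE$. A marked principal $(\mathcal H,b)$-bundle over $([0,1],\{0,1\})$ is such a bundle over $[0,1]$ with a section $s$ of $w$ over $\{0,1\}$ with $p\circ s\equiv b$; $\Pi_1(\mathcal H,b)$ is the set of isomorphism classes of these modulo homotopy (being the pullbacks to $t=0,1$ of a marked bundle over $([0,1]\times[0,1],\{0,1\}\times[0,1])$), a group under concatenation (gluing the two bundles over $[0,1/2]$ and $[1/2,1]$ after reparametrization, using the sections at the gluing point). *)

(* Defs.v *)
From HB Require Import structures.
From mathcomp Require Import all_boot all_order all_algebra.
From mathcomp Require Import all_classical all_reals all_analysis.
From mathcomp Require Import Rstruct Rstruct_topology.
From Stdlib Require Import Relations.
Set Implicit Arguments. Unset Strict Implicit. Unset Printing Implicit Defensive.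
Import Order.TTheory GRing.Theory Num.Theory.
Local Open Scope classical_set_scope.
Local Open Scope ring_scope.

Notation R := Rdefinitions.R.

Definition I01 : set R := [set t | 0 <= t <= 1].
Definition I01sq : set (R * R) := [set q | I01 q.1 /\ I01 q.2].

Definition homeo_onto (A B : topologicalType) (f : A -> B) (S : set B) : Prop :=
  continuous f /\ (forall x, S (f x)) /\
  exists g : B -> A, (forall x, g (f x) = x) /\ (forall y, S y -> f (g y) = y) /\
                     {within S, continuous g}.

Record topGroupoid := TopGroupoid {
  G0 : topologicalType;
  G1 : topologicalType;
  gdom : G1 -> G0;
  gcod : G1 -> G0;
  gunit : G0 -> G1;
  gcomp : G1 -> G1 -> G1;
  ginv : G1 -> G1;
  gdom_unit : forall x, gdom (gunit x) = x;
  gcod_unit : forall x, gcod (gunit x) = x;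
  gdom_comp : forall g h, gdom g = gcod h -> gdom (gcomp g h) = gdom h;
  gcod_comp : forall g h, gdom g = gcod h -> gcod (gcomp g h) = gcod g;
  gcomp_assoc : forall f g h, gdom f = gcod g -> gdom g = gcod h ->
      gcomp f (gcomp g h) = gcomp (gcomp f g) h;
  gcomp_unitl : forall g, gcomp (gunit (gcod g)) g = g;
  gcomp_unitr : forall g, gcomp g (gunit (gdom g)) = g;
  gdom_inv : forall g, gdom (ginv g) = gcod g;
  gcod_inv : forall g, gcod (ginv g) = gdom g;
  gcomp_invl : forall g, gcomp (ginv g) g = gunit (gdom g);
  gcomp_invr : forall g, gcomp g (ginv g) = gunit (gcod g);
  gdom_cont : continuous gdom;
  gcod_cont : continuous gcod;
  gunit_cont : continuous gunit;
  ginv_cont : continuous ginv;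
  gcomp_cont : {within [set q : G1 * G1 | gdom q.1 = gcod q.2],
                continuous (fun q => gcomp q.1 q.2)};
  gdom_open : forall U : set G1, open U -> open (gdom @` U)
}.

Definition etale (G : topGroupoid) : Prop :=
  forall g : G1 G, exists U : set (G1 G),
    [/\ open U, U g, open (@gdom G @` U),
     (forall x y, U x -> U y -> @gdom G x = @gdom G y -> x = y) &
     exists sec : G0 G -> G1 G,
       (forall x, U x -> sec (@gdom G x) = x) /\
       {within @gdom G @` U, continuous sec}].

Definition path_connected_set (X : topologicalType) (V : set X) : Prop :=
  forall x y, V x -> V y -> exists gam : R -> X,
    {within I01, continuous gam} /\ gam 0 = x /\ gam 1 = y /\
    (forall t, I01 t -> V (gam t)).

Definition locally_path_connected (X : topologicalType) : Prop :=
  forall (x : X) (U : set X), nbhs x U ->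
    exists V : set X, [/\ open V, V x, V `<=` U & path_connected_set V].

(* An H-loop sigma_0,...,sigma_n ; h_1,...,h_n  (only indices 0..n of hl_sig and
   1..n of hl_h are meaningful). *)
Record hloop (G : topGroupoid) := HLoop {
  hl_n : nat;
  hl_sig : nat -> R -> G0 G;
  hl_h : nat -> G1 G
}.

Definition is_hloop (G : topGroupoid) (b : G0 G) (l : hloop G) : Prop :=
  (forall i, (i <= hl_n l)%N -> {within I01, continuous hl_sig l i}) /\
  hl_sig l 0 0 = b /\ hl_sig l (hl_n l) 1 = b /\
  (forall i, (1 <= i <= hl_n l)%N ->
     @gdom G (hl_h l i) = hl_sig l i.-1 1 /\ @gcod G (hl_h l i) = hl_sig l i 0).

Definition peq (X : Type) (s t : R -> X) : Prop := forall u, I01 u -> s u = t u.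

Definition pcat (X : Type) (s t : R -> X) : R -> X :=
  fun u => if u <= 1 / 2 then s (2 * u) else t (2 * u - 1).

Definition move_const (G : topGroupoid) (l l' : hloop G) : Prop :=
  exists i, (0 < i < hl_n l)%N /\
    (forall t, I01 t -> hl_sig l i t = hl_sig l i 0) /\
    hl_n l' = (hl_n l).-1 /\
    (forall j, (j < i)%N -> peq (hl_sig l' j) (hl_sig l j)) /\
    (forall j, (i <= j <= hl_n l')%N -> peq (hl_sig l' j) (hl_sig l j.+1)) /\
    (forall j, (1 <= j < i)%N -> hl_h l' j = hl_h l j) /\
    hl_h l' i = @gcomp G (hl_h l i.+1) (hl_h l i) /\
    (forall j, (i < j <= hl_n l')%N -> hl_h l' j = hl_h l j.+1).

Definition move_id (G : topGroupoid) (l l' : hloop G) : Prop :=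
  exists i, (1 <= i <= hl_n l)%N /\
    hl_sig l i.-1 1 = hl_sig l i 0 /\
    hl_h l i = @gunit G (hl_sig l i.-1 1) /\
    hl_n l' = (hl_n l).-1 /\
    (forall j, (j < i.-1)%N -> peq (hl_sig l' j) (hl_sig l j)) /\
    peq (hl_sig l' i.-1) (pcat (hl_sig l i.-1) (hl_sig l i)) /\
    (forall j, (i <= j <= hl_n l')%N -> peq (hl_sig l' j) (hl_sig l j.+1)) /\
    (forall j, (1 <= j < i)%N -> hl_h l' j = hl_h l j) /\
    (forall j, (i <= j <= hl_n l')%N -> hl_h l' j = hl_h l j.+1).

(* move 3: deformation.  D i (u, s): u = deformation parameter, s = path parameter *)
Definition deform (G : topGroupoid) (b : G0 G) (l l' : hloop G) : Prop :=
  hl_n l' = hl_n l /\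
  exists (D : nat -> R * R -> G0 G) (d : nat -> R -> G1 G),
    (forall i, (i <= hl_n l)%N ->
       {within I01sq, continuous D i} /\
       (forall s, I01 s -> D i (0, s) = hl_sig l i s /\ D i (1, s) = hl_sig l' i s)) /\
    (forall i, (1 <= i <= hl_n l)%N ->
       {within I01, continuous d i} /\ d i 0 = hl_h l i /\ d i 1 = hl_h l' i /\
       (forall u, I01 u -> @gdom G (d i u) = D i.-1 (u, 1) /\
                           @gcod G (d i u) = D i (u, 0))) /\
    (forall u, I01 u -> D 0%N (u, 0) = b /\ D (hl_n l) (u, 1) = b).

Definition loop_step (G : topGroupoid) (b : G0 G) (l l' : hloop G) : Prop :=
  is_hloop b l /\ is_hloop b l' /\ (move_const l l' \/ move_id l l' \/ deform b l l').

Definition loop_equiv (G : topGroupoid) (b : G0 G) : relation (hloop G) :=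
  clos_refl_sym_trans _ (loop_step b).

Definition hloop_cat (G : topGroupoid) (b : G0 G) (l l' : hloop G) : hloop G :=
  HLoop (hl_n l + hl_n l' + 1)
    (fun j => if (j <= hl_n l)%N then hl_sig l j else hl_sig l' (j - (hl_n l).+1))
    (fun j => if (j <= hl_n l)%N then hl_h l j
              else if j == (hl_n l).+1 then @gunit G b
              else hl_h l' (j - (hl_n l).+1)).

Definition principal_bundle (G : topGroupoid) (E T : topologicalType) (X : set T)
    (p : E -> G0 G) (w : E -> T) (act : G1 G -> E -> E) : Prop :=
  let A := [set q : G1 G * E | @gdom G q.1 = p q.2] in
  let B := [set q : E * E | w q.1 = w q.2] in
  let F := fun q : G1 G * E => (act q.1 q.2, q.2) in
  continuous p /\ continuous w /\
  (forall h e, @gdom G h = p e -> p (act h e) = @gcod G h /\ w (act h e) = w e) /\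
  (forall e, act (@gunit G (p e)) e = e) /\
  (forall g h e, @gdom G g = @gcod G h -> @gdom G h = p e ->
     act (@gcomp G g h) e = act g (act h e)) /\
  {within A, continuous (fun q => act q.1 q.2)} /\
  w @` setT = X /\
  (forall U : set E, open U -> exists V : set T, open V /\ w @` U = V `&` X) /\
  (forall q, A q -> B (F q)) /\ {within A, continuous F} /\
  exists Fi : E * E -> G1 G * E,
    (forall q, B q -> A (Fi q) /\ F (Fi q) = q) /\
    (forall q, A q -> Fi (F q) = q) /\ {within B, continuous Fi}.

(* marked principal (H,b)-bundle over ([0,1],{0,1}); s0, s1 = the section at 0, 1 *)
Record mbundle (G : topGroupoid) (b : G0 G) := MBundle {
  mb_E : topologicalType;
  mb_p : mb_E -> G0 G;
  mb_w : mb_E -> R;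
  mb_act : G1 G -> mb_E -> mb_E;
  mb_s0 : mb_E;
  mb_s1 : mb_E;
  mb_bundle : principal_bundle I01 mb_p mb_w mb_act;
  mb_s0w : mb_w mb_s0 = 0;
  mb_s1w : mb_w mb_s1 = 1;
  mb_s0p : mb_p mb_s0 = b;
  mb_s1p : mb_p mb_s1 = b
}.

(* B is isomorphic (as a marked bundle) to the pullback of the bundle
   (E,p,w,act) over [0,1]^2, with sections s0 s1, along x |-> (x,t) *)
Definition pullback_iso (G : topGroupoid) (b : G0 G) (B : mbundle b)
    (E : topologicalType) (p : E -> G0 G) (w : E -> R * R) (act : G1 G -> E -> E)
    (s0 s1 : R -> E) (t : R) : Prop :=
  exists phi : mb_E B -> E,
    homeo_onto phi [set e | (w e).2 = t] /\
    (forall e, w (phi e) = (@mb_w _ _ B e, t) /\ p (phi e) = @mb_p _ _ B e) /\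
    (forall h e, @gdom G h = @mb_p _ _ B e -> phi (@mb_act _ _ B h e) = act h (phi e)) /\
    phi (@mb_s0 _ _ B) = s0 t /\ phi (@mb_s1 _ _ B) = s1 t.

(* homotopy of marked bundles: a marked bundle over ([0,1]^2, {0,1}x[0,1])
   whose pullbacks at t = 0, 1 are B0, B1 *)
Definition mb_homotopic (G : topGroupoid) (b : G0 G) (B0 B1 : mbundle b) : Prop :=
  exists (E : topologicalType) (p : E -> G0 G) (w : E -> R * R)
         (act : G1 G -> E -> E) (s0 s1 : R -> E),
    principal_bundle I01sq p w act /\
    {within I01, continuous s0} /\ {within I01, continuous s1} /\
    (forall t, I01 t -> w (s0 t) = (0, t) /\ w (s1 t) = (1, t) /\
                        p (s0 t) = b /\ p (s1 t) = b) /\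
    pullback_iso B0 p w act s0 s1 0 /\ pullback_iso B1 p w act s0 s1 1.

Definition Pi_equiv (G : topGroupoid) (b : G0 G) : relation (mbundle b) :=
  clos_refl_sym_trans _ (@mb_homotopic G b).

(* C is (isomorphic to) the concatenation of B1 and B2: B1, B2 glued over
   [0,1/2] and [1/2,1] after reparametrization, along the sections at the
   gluing point *)
Definition mb_concat (G : topGroupoid) (b : G0 G) (B1 B2 C : mbundle b) : Prop :=
  exists (j1 : mb_E B1 -> mb_E C) (j2 : mb_E B2 -> mb_E C),
    homeo_onto j1 [set e | @mb_w _ _ C e <= 1 / 2] /\
    homeo_onto j2 [set e | 1 / 2 <= @mb_w _ _ C e] /\
    (forall e, @mb_w _ _ C (j1 e) = @mb_w _ _ B1 e / 2 /\ @mb_p _ _ C (j1 e) = @mb_p _ _ B1 e) /\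
    (forall e, @mb_w _ _ C (j2 e) = (1 + @mb_w _ _ B2 e) / 2 /\ @mb_p _ _ C (j2 e) = @mb_p _ _ B2 e) /\
    (forall h e, @gdom G h = @mb_p _ _ B1 e -> j1 (@mb_act _ _ B1 h e) = @mb_act _ _ C h (j1 e)) /\
    (forall h e, @gdom G h = @mb_p _ _ B2 e -> j2 (@mb_act _ _ B2 h e) = @mb_act _ _ C h (j2 e)) /\
    j1 (@mb_s1 _ _ B1) = j2 (@mb_s0 _ _ B2) /\
    @mb_s0 _ _ C = j1 (@mb_s0 _ _ B1) /\ @mb_s1 _ _ C = j2 (@mb_s1 _ _ B2).

(* Main.v *)
(* A principal bundle of an etale groupoid over X is etale over X: nearby points of
   a fibre differ by an arrow close to a unit, hence by a unit. So a bundle over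
   [0,1] has lifts (continuous sections) over the pieces of a subdivision, and
   such lifts, compared by the division map at the subdivision points, spell an
   H-loop: the bundle "reads" the loop. Conversely a loop is a cocycle for a finite
   closed cover of [0,1] and can be glued to a bundle reading it; Phi chooses such
   a bundle. Then
   - two readings of the same bundle are equivalent: refine the subdivisions, and
     replace a lift s by another one g.s by sliding the arrow g along the path;
   - a bundle over the square, cut by a grid into pieces with sections, turns the
     reading of its bottom edge into that of its top edge by deformations;
   - a deformation of loops is a cocycle over the square, so it glues to a homotopy
     of bundles, while the other two moves only change the reading of one bundle. *)
Require Import Defs.
From HB Require Import structures.
From mathcomp Require Import all_boot all_order all_algebra.
From mathcomp Require Import all_classical all_reals all_analysis.
From mathcomp Require Import Rstruct Rstruct_topology.
From mathcomp Require Import ring lra.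
From Stdlib Require Import Relations.
Set Implicit Arguments. Unset Strict Implicit. Unset Printing Implicit Defensive.
Import Order.TTheory GRing.Theory Num.Theory numFieldNormedType.Exports.
Local Open Scope classical_set_scope.
Local Open Scope ring_scope.

Local Notation dom := (@gdom _).
Local Notation cod := (@gcod _).
Local Notation "g \* h" := (gcomp g h) (at level 40, left associativity).
Local Notation inv := (@ginv _).
Local Notation one := (@gunit _).

(** Since reading is a relation, any choice of [Phi] will do, and a chain of homotopies through
    arbitrary bundles is harmless: every bundle met on the way reads some loop.

    The pieces of a subdivision are closed and overlap only along their common ends, where alone a
    loop prescribes arrows. Gluing along finite closed covers avoids extending these arrows to open
    sets, and continuity can still be tested piece by piece. The price is that a piece through a
    point need not be a neighbourhood of it, so the topology of the glued space has to look at all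
    pieces through a point.

    The other obstacle lies at the ends of a loop. It begins and ends with paths and only its
    interior constant paths may be removed, whereas arbitrary lifts of a bundle also produce arrows
    at the two marked points. Words with one arrow per path absorb this: their first arrow is
    discarded, equivalences of words are stated behind a nonempty prefix, and trivial letters at the
    two ends are dealt with separately. *)

Lemma withinP (X Y : topologicalType) (A : set X) (f : X -> Y) :
  {within A, continuous f} <->
  forall x, A x -> forall V, nbhs (f x) V -> \forall y \near x, A y -> V (f y).
Proof.
rewrite subspace_continuousP; split=> H x Ax V /(H x Ax) //.
Qed.

Lemma within_comp (X Y Z : topologicalType) (A : set X) (B : set Y)
    (f : X -> Y) (g : Y -> Z) :
  (forall x, A x -> B (f x)) -> {within A, continuous f} ->
  {within B, continuous g} -> {within A, continuous (fun x => g (f x))}.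
Proof.
move=> AB /withinP cf /withinP cg; apply/withinP => x Ax V Vg.
have := cf x Ax _ (cg _ (AB _ Ax) _ Vg).
by apply: filterS => y H Ay; apply: H => //; apply: AB.
Qed.

Lemma within_compT (X Y Z : topologicalType) (A : set X) (f : X -> Y) (g : Y -> Z) :
  {within A, continuous f} -> continuous g -> {within A, continuous (fun x => g (f x))}.
Proof.
move=> cf cg; apply: (within_comp (B := setT)) => //.
exact: continuous_subspaceT.
Qed.

Lemma within_pair (X Y Z : topologicalType) (A : set X) (f : X -> Y) (g : X -> Z) :
  {within A, continuous f} -> {within A, continuous g} ->
  {within A, continuous (fun x => (f x, g x))}.
Proof.
move=> /withinP cf /withinP cg; apply/withinP => x Ax V [[P Q] /= [nP nQ] PQ].
move: (cf x Ax _ nP) (cg x Ax _ nQ); apply: filterS2 => y HP HQ Ay.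
by apply: PQ; split=> /=; [exact: HP|exact: HQ].
Qed.

Lemma within_sub (X Y : topologicalType) (A B : set X) (f : X -> Y) :
  B `<=` A -> {within A, continuous f} -> {within B, continuous f}.
Proof. exact: continuous_subspaceW. Qed.

Lemma within_ext (X Y : topologicalType) (A : set X) (f g : X -> Y) :
  (forall x, A x -> f x = g x) -> {within A, continuous f} -> {within A, continuous g}.
Proof.
move=> fg /withinP cf; apply/withinP => x Ax V; rewrite -fg// => /(cf x Ax).
by apply: filterS => y H Ay; rewrite -fg//; exact: H.
Qed.

Lemma within_cst (X Y : topologicalType) (A : set X) (y : Y) :
  {within A, continuous (fun=> y)}.
Proof. by apply: continuous_subspaceT => x; exact: cvg_cst. Qed.

Lemma within_id (X : topologicalType) (A : set X) : {within A, continuous (fun x => x)}.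
Proof. by apply: continuous_subspaceT => x. Qed.

Lemma within_fst (X Y : topologicalType) (A : set (X * Y)) :
  {within A, continuous (fun q => q.1)}.
Proof. by apply: continuous_subspaceT => x; exact: cvg_fst. Qed.

Lemma within_snd (X Y : topologicalType) (A : set (X * Y)) :
  {within A, continuous (fun q => q.2)}.
Proof. by apply: continuous_subspaceT => x; exact: cvg_snd. Qed.

(** * Pasting along finite closed covers *)

Lemma closed_nearN (X : topologicalType) (A : set X) (x : X) :
  closed A -> ~ A x -> \forall y \near x, ~ A y.
Proof.
move=> cA nAx; have : open (~` A) by rewrite openC.
by rewrite openE => /(_ x nAx).
Qed.

(** Each closed piece missing [v y0] is avoided by a whole neighbourhood of [y0]; there are finitely
    many of them, so only the pieces through [v y0] matter. *)
Lemma cover_near (T Y : topologicalType) (I : finType) (C : I -> set T)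
    (v : Y -> T) (y0 : Y) (P : set Y) :
  (forall i, closed (C i)) -> {for y0, continuous v} ->
  (forall i, C i (v y0) -> \forall y \near y0, C i (v y) -> P y) ->
  \forall y \near y0, (exists i, C i (v y)) -> P y.
Proof.
move=> cC cv H.
have : \forall y \near y0, forall i, C i (v y) -> P y.
  apply: filter_forall => i; have [Ci|nCi] := pselect (C i (v y0)); first exact: H.
  have : \forall y \near y0, ~ C i (v y) := cv _ (closed_nearN (cC i) nCi).
  by apply: filterS => y nC /nC.
by apply: filterS => y K [i /K].
Qed.

(** The pasting lemma for a finite closed cover, pulled back along [v]. *)
Lemma within_cover (T Y Z : topologicalType) (I : finType) (C : I -> set T)
    (A : set Y) (v : Y -> T) (f : Y -> Z) :
  (forall i, closed (C i)) -> continuous v ->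
  (forall y, A y -> exists i, C i (v y)) ->
  (forall i, {within [set y | A y /\ C i (v y)], continuous f}) ->
  {within A, continuous f}.
Proof.
move=> cC cv AC cf; apply/withinP => y0 Ay0 V Vf.
have : \forall y \near y0, (exists i, C i (v y)) -> A y -> V (f y).
  apply: (cover_near (P := fun y => A y -> V (f y)) cC) => [|i Ci]; first exact: cv.
  move/withinP: (cf i) => /(_ y0 (conj Ay0 Ci) V Vf).
  by apply: filterS => y H Cy Ay; exact: H.
by apply: filterS => y H Ay; apply: H => //; exact: AC.
Qed.

(** * Cancellation rules and continuity for arrows *)

Section Groupoid.
Variable G : topGroupoid.

Lemma gcompK (g h : G1 G) : dom g = cod h -> inv g \* (g \* h) = h.
Proof.
move=> e; rewrite gcomp_assoc ?gdom_inv// gcomp_invl e; exact: gcomp_unitl.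
Qed.

Lemma gcompgK (g h : G1 G) : dom g = cod h -> (g \* h) \* inv h = g.
Proof.
move=> e; rewrite -gcomp_assoc ?gcod_inv// gcomp_invr -e; exact: gcomp_unitr.
Qed.

Lemma gcompgVK (g h : G1 G) : dom g = dom h -> (g \* inv h) \* h = g.
Proof.
move=> e; rewrite -gcomp_assoc ?gcod_inv ?gdom_inv// gcomp_invl -e; exact: gcomp_unitr.
Qed.

Lemma within_gcomp (X : topologicalType) (A : set X) (f g : X -> G1 G) :
  (forall x, A x -> dom (f x) = cod (g x)) ->
  {within A, continuous f} -> {within A, continuous g} ->
  {within A, continuous (fun x => f x \* g x)}.
Proof.
move=> fg cf cg.
apply: (@within_comp _ _ _ A _ (fun x => (f x, g x)) (fun q => q.1 \* q.2) _ _
  (@gcomp_cont G)) => //.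
exact: within_pair.
Qed.

Lemma within_ginv (X : topologicalType) (A : set X) (f : X -> G1 G) :
  {within A, continuous f} -> {within A, continuous (fun x => inv (f x))}.
Proof. by move=> cf; apply: within_compT cf (@ginv_cont G). Qed.

Lemma within_gcod (X : topologicalType) (A : set X) (f : X -> G1 G) :
  {within A, continuous f} -> {within A, continuous (fun x => cod (f x))}.
Proof. by move=> cf; apply: within_compT cf (@gcod_cont G). Qed.

Lemma within_gdom (X : topologicalType) (A : set X) (f : X -> G1 G) :
  {within A, continuous f} -> {within A, continuous (fun x => dom (f x))}.
Proof. by move=> cf; apply: within_compT cf (@gdom_cont G). Qed.

Lemma within_gunit (X : topologicalType) (A : set X) (f : X -> G0 G) :
  {within A, continuous f} -> {within A, continuous (fun x => one (f x))}.
Proof. by move=> cf; apply: within_compT cf (@gunit_cont G). Qed.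

End Groupoid.

(** * Continuity of real functions on subsets *)

Section RealFunctions.
Variables (T : topologicalType) (A : set T).
Implicit Types f g : T -> R.

Lemma within_addr f g : {within A, continuous f} -> {within A, continuous g} ->
  {within A, continuous (fun x => f x + g x)}.
Proof.
move=> cf cg; apply: (within_compT (g := fun q : R * R => q.1 + q.2) (within_pair cf cg)) => q.
apply: (@continuousD R R^o _ fst snd); [exact: cvg_fst|exact: cvg_snd].
Qed.

Lemma within_subr f g : {within A, continuous f} -> {within A, continuous g} ->
  {within A, continuous (fun x => f x - g x)}.
Proof.
move=> cf cg; apply: (within_compT (g := fun q : R * R => q.1 - q.2) (within_pair cf cg)) => q.
apply: (@continuousB R R^o _ fst snd); [exact: cvg_fst|exact: cvg_snd].
Qed.

Lemma within_mulr f g : {within A, continuous f} -> {within A, continuous g} ->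
  {within A, continuous (fun x => f x * g x)}.
Proof.
move=> cf cg; apply: (within_compT (g := fun q : R * R => q.1 * q.2) (within_pair cf cg)) => q.
apply: (@continuousM R _ fst snd); [exact: cvg_fst|exact: cvg_snd].
Qed.

Lemma within_invr f : (forall x, A x -> f x != 0) -> {within A, continuous f} ->
  {within A, continuous (fun x => (f x)^-1)}.
Proof.
move=> f0 cf; apply: (@within_comp _ _ _ A [set y : R | y != 0] f (fun y => y^-1)) => //.
apply/withinP => y y0 V nV.
have : \forall z \near y, V (z^-1) := (@continuousV R R id y y0 (fun _ h => h)) V nV.
by apply: filterS.
Qed.

End RealFunctions.

Lemma closed_le_fun (T : topologicalType) (f g : T -> R) :
  continuous f -> continuous g -> closed [set x | f x <= g x].
Proof.
move=> cf cg; have -> : [set x | f x <= g x] = (fun x => g x - f x) @^-1` [set y | 0 <= y].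
  by apply/seteqP; split=> x /=; rewrite subr_ge0.
have : continuous (fun x => g x - f x).
  by move=> x; exact: (@continuousB R R^o _ _ _ x (cg x) (cf x)).
by move/continuous_closedP; apply; exact: closed_ge.
Qed.

Lemma I01_0 : I01 (0 : R). Proof. by rewrite /I01 /= lexx ler01. Qed.
Lemma I01_1 : I01 (1 : R). Proof. by rewrite /I01 /= lexx ler01. Qed.
#[local] Hint Resolve I01_0 I01_1 : core.

Lemma I01_compact : compact I01.
Proof.
have -> : I01 = [set` `[0, 1]] by apply/seteqP; split=> x /=; rewrite in_itv.
exact: segment_compact.
Qed.

Lemma I01_closed : closed I01.
Proof.
have -> : I01 = [set t : R | 0 <= t] `&` [set t : R | t <= 1].
  by apply/seteqP; split=> x /=; [move=> /andP[]|move=> [? ?]; apply/andP].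
by apply: closedI; [exact: closed_ge|exact: closed_le].
Qed.

(** * Division in a principal bundle *)

Section Bundle.
Variables (G : topGroupoid) (E T : topologicalType) (X : set T).
Variables (p : E -> G0 G) (w : E -> T) (act : G1 G -> E -> E).
Hypothesis pb : principal_bundle X p w act.

Lemma pb_pcont : continuous p. Proof. by case: pb. Qed.
Lemma pb_wcont : continuous w. Proof. by case: pb => _ []. Qed.
Lemma p_act h e : dom h = p e -> p (act h e) = cod h.
Proof. by case: pb => _ [_ [H _]] /H[]. Qed.
Lemma w_act h e : dom h = p e -> w (act h e) = w e.
Proof. by case: pb => _ [_ [H _]] /H[]. Qed.
Lemma act1 e : act (one (p e)) e = e.
Proof. by case: pb => _ [_ [_ [H _]]]. Qed.
Lemma actM g h e : dom g = cod h -> dom h = p e -> act (g \* h) e = act g (act h e).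
Proof. by case: pb => _ [_ [_ [_ [H _]]]]; exact: H. Qed.
Lemma pb_X e : X (w e).
Proof. by case: pb => _ [_ [_ [_ [_ [_ [<- _]]]]]]; exists e. Qed.
Lemma pb_surj x : X x -> exists e, w e = x.
Proof. by case: pb => _ [_ [_ [_ [_ [_ [<- _]]]]]] [e _ <-]; exists e. Qed.
Lemma pb_open (U : set E) : open U -> exists V, open V /\ w @` U = V `&` X.
Proof. by case: pb => _ [_ [_ [_ [_ [_ [_ [H _]]]]]]]; exact: H. Qed.

Lemma within_act (Y : topologicalType) (A : set Y) (h : Y -> G1 G) (e : Y -> E) :
  (forall y, A y -> dom (h y) = p (e y)) ->
  {within A, continuous h} -> {within A, continuous e} ->
  {within A, continuous (fun y => act (h y) (e y))}.
Proof.
case: pb => _ [_ [_ [_ [_ [ca _]]]]] he ch ce.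
apply: (@within_comp _ _ _ A _ (fun y => (h y, e y)) (fun q => act q.1 q.2) _ _ ca) => //.
exact: within_pair.
Qed.

(** The arrow component of the inverse of [(h, e) |-> (h e, e)]: bijectivity makes the action simply
    transitive on fibres, and the homeomorphism makes division continuous. *)
Lemma pb_div : exists dv : E -> E -> G1 G,
  [/\ forall e e', w e' = w e -> dom (dv e' e) = p e,
      forall e e', w e' = w e -> act (dv e' e) e = e',
      forall h e, dom h = p e -> dv (act h e) e = h &
      {within [set q : E * E | w q.1 = w q.2], continuous (fun q => dv q.1 q.2)}].
Proof.
case: pb => _ [_ [_ [_ [_ [_ [_ [_ [_ [_ [Fi [FiB [FiA Fic]]]]]]]]]]]].
exists (fun e' e => (Fi (e', e)).1); split.
- move=> e e' ww; have [eA /(congr1 snd) /= e2] := FiB (e', e) ww.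
  by rewrite [LHS]eA e2.
- move=> e e' ww; have [_ eF] := FiB (e', e) ww.
  have /= eF2 := congr1 snd eF.
  by have /= := congr1 fst eF; rewrite eF2.
- by move=> h e he; rewrite (FiA (h, e)).
- apply: (within_ext (f := fun q => (Fi q).1)); first by case.
  by apply: within_compT Fic _ => q; exact: cvg_fst.
Qed.

Definition dv := projT1 (cid pb_div).

Lemma dv_dom e e' : w e' = w e -> dom (dv e' e) = p e.
Proof. by rewrite /dv; case: cid => d /= [H1 H2 H3 H4]; exact: H1. Qed.
Lemma dv_act e e' : w e' = w e -> act (dv e' e) e = e'.
Proof. by rewrite /dv; case: cid => d /= [H1 H2 H3 H4]; exact: H2. Qed.
Lemma act_dv h e : dom h = p e -> dv (act h e) e = h.
Proof. by rewrite /dv; case: cid => d /= [H1 H2 H3 H4]; exact: H3. Qed.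
Lemma dv_cont : {within [set q : E * E | w q.1 = w q.2], continuous (fun q => dv q.1 q.2)}.
Proof. by rewrite /dv; case: cid => d /= [H1 H2 H3 H4]; exact: H4. Qed.
Lemma dv_cod e e' : w e' = w e -> cod (dv e' e) = p e'.
Proof. by move=> ww; rewrite -[in RHS](dv_act ww) p_act// dv_dom. Qed.
Lemma dv_eq h e e' : dom h = p e -> act h e = e' -> dv e' e = h.
Proof. by move=> he <-; exact: act_dv. Qed.
Lemma dv_id e : dv e e = one (p e).
Proof. by apply: dv_eq; rewrite ?gdom_unit ?act1. Qed.
Lemma dv_comp e1 e2 e3 : w e1 = w e2 -> w e2 = w e3 -> dv e3 e2 \* dv e2 e1 = dv e3 e1.
Proof.
move=> w12 w23; symmetry.
have dd : dom (dv e3 e2) = cod (dv e2 e1) by rewrite dv_dom// dv_cod.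
apply: dv_eq; first by rewrite gdom_comp// dv_dom.
by rewrite actM ?dv_dom ?dv_cod// !dv_act.
Qed.
Lemma dv_actl h e e' : w e' = w e -> dom h = p e' -> dv (act h e') e = h \* dv e' e.
Proof.
move=> ww he; have dd : dom h = cod (dv e' e) by rewrite dv_cod.
apply: dv_eq; first by rewrite gdom_comp// dv_dom.
by rewrite actM ?dv_dom// dv_act.
Qed.
Lemma within_dv (Y : topologicalType) (A : set Y) (f g : Y -> E) :
  (forall y, A y -> w (f y) = w (g y)) ->
  {within A, continuous f} -> {within A, continuous g} ->
  {within A, continuous (fun y => dv (f y) (g y))}.
Proof.
move=> fg cf cg.
apply: (@within_comp _ _ _ A _ (fun y => (f y, g y)) (fun q => dv q.1 q.2) _ _ dv_cont) => //.
exact: within_pair.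
Qed.

Lemma within_p (Y : topologicalType) (A : set Y) (f : Y -> E) :
  {within A, continuous f} -> {within A, continuous (fun y => p (f y))}.
Proof. by move=> cf; exact: within_compT cf pb_pcont. Qed.

End Bundle.

(** * Gluing a principal bundle from frames over closed pieces *)

Record glue_data (G : topGroupoid) (T : topologicalType) := GlueData {
  gl_X : set T;
  gl_I : finType;
  gl_C : gl_I -> set T;
  gl_f : T -> G0 G;
  gl_g : gl_I -> T -> G1 G;
  gl_closed : forall i, closed (gl_C i);
  gl_cover : forall x, gl_X x <-> exists i, gl_C i x;
  gl_dom : forall i x, gl_C i x -> @gdom G (gl_g i x) = gl_f x;
  gl_trans : forall i j, {within gl_C i `&` gl_C j,
    continuous (fun x => @gcomp G (gl_g j x) (@ginv G (gl_g i x)))}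
}.

(* The base map [gl_f] need not be continuous: as a set the glued bundle is the
   pullback of [gl_f], and its topology is imposed by the charts. *)
Definition glued (G : topGroupoid) (T : topologicalType) (D : glue_data G T) :=
  {q : T * G1 G | gl_X D q.1 /\ @gdom G q.2 = gl_f D q.1}.

Section Glue.
Variables (G : topGroupoid) (T : topologicalType) (D : glue_data G T).
Notation X := (gl_X D).
Notation C := (@gl_C _ _ D).
Notation g := (@gl_g _ _ D).
Notation E := (glued D).

Definition gl_w (e : E) : T := (sval e).1.
Definition gl_p (e : E) : G0 G := cod (sval e).2.
(** The frames [g i] may be discontinuous; only the quotients [g j \* inv (g i)] are continuous, and
    these satisfy the cocycle condition automatically. The chart records the arrow that carries the
    point [(x, g i x)] to [e], and its source [cod (g i x)] varies continuously on [C i]. *)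
Definition gl_chart i (e : E) : T * G1 G := (gl_w e, (sval e).2 \* inv (g i (gl_w e))).
(** All charts through [e] are tested because the pieces are closed: a single one describes only the
    part of a neighbourhood that lies over its piece. *)
Definition gl_nbhs (e : E) : set_system E := [set U | forall i, C i (gl_w e) ->
  \forall z \near gl_chart i e, forall e', C i (gl_w e') -> gl_chart i e' = z -> U e'].

Lemma gl_wX e : X (gl_w e). Proof. by case: (svalP e). Qed.
Lemma gl_wC e : exists i, C i (gl_w e).
Proof. by apply/(@gl_cover _ _ D)/gl_wX. Qed.
Lemma gl_dom2 e : dom (sval e).2 = gl_f D (gl_w e).
Proof. by case: (svalP e). Qed.
Lemma glued_inj (e e' : E) : sval e = sval e' -> e = e'.
Proof.
by case: e e' => [q1 h1] [q2 h2] /= ee; subst q2; congr exist; exact: Prop_irrelevance.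
Qed.

Lemma gl_domg i e : C i (gl_w e) -> dom (sval e).2 = cod (inv (g i (gl_w e))).
Proof. by move=> Ci; rewrite gcod_inv gl_dom2 gl_dom. Qed.

Lemma gl_chart_dom i e : C i (gl_w e) -> dom (gl_chart i e).2 = cod (g i (gl_w e)).
Proof. by move=> Ci; rewrite /= gdom_comp ?gdom_inv//; exact: gl_domg. Qed.
Lemma gl_chart_cod i e : C i (gl_w e) -> cod (gl_chart i e).2 = gl_p e.
Proof. by move=> Ci; rewrite /= gcod_comp//; exact: gl_domg. Qed.

Lemma gl_chart_trans i j e : C i (gl_w e) -> C j (gl_w e) ->
  gl_chart j e = ((gl_chart i e).1,
    (gl_chart i e).2 \* (g i (gl_chart i e).1 \* inv (g j (gl_chart i e).1))).
Proof.
move=> Ci Cj; rewrite /gl_chart /=; congr pair.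
have gi := gl_dom Ci; have gj := gl_dom Cj; have di := gl_domg Ci.
rewrite gcomp_assoc ?gcod_inv ?gdom_comp ?gdom_inv ?gi ?gj// -?gl_dom2//.
by rewrite gcompgVK// gl_dom2 gi.
Qed.

(** The change of charts is right multiplication by [g i \* inv (g j)], continuous over the overlap
    by [gl_trans]. *)
Lemma gl_trans_near i j e W : C i (gl_w e) -> C j (gl_w e) -> nbhs (gl_chart j e) W ->
  \forall z \near gl_chart i e, forall e', C i (gl_w e') -> C j (gl_w e') ->
    gl_chart i e' = z -> W (gl_chart j e').
Proof.
move=> Ci Cj; rewrite (gl_chart_trans Ci Cj) => nW.
pose A := [set z : T * G1 G | (C j `&` C i) z.1 /\ dom z.2 = cod (g i z.1)].
have : {within A, continuous (fun z : T * G1 G => (z.1, z.2 \* (g i z.1 \* inv (g j z.1))))}.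
  apply: within_pair; first exact: within_fst.
  apply: within_gcomp; last 2 first.
  - exact: within_snd.
  - apply: (@within_comp _ _ _ A (C j `&` C i) (fun z => z.1)
      (fun x => g i x \* inv (g j x))) => [z []//||]; first exact: within_fst.
    exact: gl_trans.
  move=> z [[Cjz Ciz] ->]; rewrite gcod_comp// gcod_inv; exact: etrans (gl_dom Ciz) (esym (gl_dom Cjz)).
have Ae : A (gl_chart i e) by split; rewrite ?gl_chart_dom.
move/withinP => /(_ _ Ae W nW); apply: filterS => z Hz e' Ci' Cj' zE.
rewrite (gl_chart_trans Ci' Cj') zE; apply: Hz.
by rewrite /A /= -zE; split; rewrite ?gl_chart_dom.
Qed.

Lemma gl_nbhs_filter e : ProperFilter (gl_nbhs e).
Proof.
split.
  move=> H; have [i Ci] := gl_wC e.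
  by have /nbhs_singleton/(_ e Ci erefl) := H i Ci.
split.
- by move=> i Ci; near=> z.
- move=> A B HA HB i Ci; move: (HA i Ci) (HB i Ci); apply: filterS2 => z Az Bz e' Ce' ze'.
  by split; [exact: Az|exact: Bz].
- move=> A B AB HA i Ci; move: (HA i Ci); apply: filterS => z Az e' Ce' ze'.
  by apply: AB; exact: Az.
Unshelve. all: by end_near. Qed.

Lemma gl_nbhs_singleton e A : gl_nbhs e A -> A e.
Proof. by move=> H; have [i Ci] := gl_wC e; have /nbhs_singleton/(_ e Ci erefl) := H i Ci. Qed.

(** Near [e], a chart [j] through [e] is reached by the change of charts, applied to the interior of
    its neighbourhood; a chart [j] not through [e] imposes nothing, since the closed set [C j] is
    avoided nearby. *)
Lemma gl_nbhs_nbhs e A : gl_nbhs e A -> gl_nbhs e (gl_nbhs^~ A).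
Proof.
move=> H i Ci.
pose Q j (z : T * G1 G) := C j z.1 ->
  forall e', C i (gl_w e') -> gl_chart i e' = z ->
  \forall z' \near gl_chart j e', forall e'', C j (gl_w e'') -> gl_chart j e'' = z' -> A e''.
have : \forall z \near gl_chart i e, forall j, Q j z.
  apply: (@filter_forall _ (gl_I D) Q (nbhs (gl_chart i e)) _) => j; have [Cj|nCj] := pselect (C j (gl_w e)).
    have := gl_trans_near Ci Cj (nbhs_interior (H j Cj)).
    apply: filterS => z Hz Cjz e' Ci' zE; apply: Hz => //.
    by rewrite -zE in Cjz.
  have : \forall z \near gl_chart i e, ~ C j z.1.
    exact: (cvg_fst (closed_nearN (@gl_closed _ _ D j) nCj)).
  by apply: filterS => z nC /nC.
apply: filterS => z Hz e' Ci' zE j Cj.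
by apply: (Hz j) => //; rewrite -zE.
Qed.

End Glue.

HB.instance Definition _ (G : topGroupoid) (T : topologicalType) (D : glue_data G T) :=
  gen_eqMixin (glued D).
HB.instance Definition _ (G : topGroupoid) (T : topologicalType) (D : glue_data G T) :=
  gen_choiceMixin (glued D).
HB.instance Definition _ (G : topGroupoid) (T : topologicalType) (D : glue_data G T) :=
  hasNbhs.Build (glued D) (@gl_nbhs G T D).
HB.instance Definition _ (G : topGroupoid) (T : topologicalType) (D : glue_data G T) :=
  Nbhs_isNbhsTopological.Build (glued D) (@gl_nbhs_filter G T D)
    (@gl_nbhs_singleton G T D) (@gl_nbhs_nbhs G T D).

Lemma gcomp_divM (G : topGroupoid) (a b c : G1 G) :
  @gdom G a = @gdom G b -> @gdom G b = @gdom G c ->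
  @gcomp G (@gcomp G a (@ginv G b)) (@gcomp G b (@ginv G c)) = @gcomp G a (@ginv G c).
Proof.
move=> ab bc; rewrite gcomp_assoc ?gcod_inv// ?gcompgVK//.
by rewrite gdom_comp ?gcod_inv// gdom_inv.
Qed.

Lemma within_setT (X Y : topologicalType) (f : X -> Y) :
  {within setT, continuous f} -> continuous f.
Proof. by move=> /withinP cf x V /(cf x I); apply: filterS => y; exact. Qed.

Section GlueBundle.
Variables (G : topGroupoid) (T : topologicalType) (D : glue_data G T).
Notation X := (gl_X D).
Notation C := (@gl_C _ _ D).
Notation g := (@gl_g _ _ D).
Notation E := (glued D).
Notation chart := (@gl_chart _ _ D).

Definition gl_mk x h (H : X x /\ dom h = gl_f D x) : E := exist _ (x, h) H.

Lemma gl_nbhsI (e : E) (U : set E) : gl_nbhs e U -> nbhs e U.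
Proof. by []. Qed.

Lemma gl_w_cont : continuous (@gl_w _ _ D).
Proof.
move=> e V nV; apply: gl_nbhsI => i Ci.
have : \forall z \near chart i e, V z.1 by exact: (cvg_fst nV).
by apply: filterS => z Vz e' _ ze; rewrite -ze in Vz.
Qed.

Lemma within_chart i : {within [set e | C i (gl_w e)], continuous (chart i)}.
Proof.
apply/withinP => e Ci W nW; apply: gl_nbhsI => j Cj.
have := gl_trans_near Cj Ci nW.
by apply: filterS => z Hz e' Cj' zE Ci'; exact: Hz.
Qed.

Lemma within_glued (Y : topologicalType) (A : set Y) (f : Y -> E) i :
  (forall y, A y -> C i (gl_w (f y))) ->
  {within A, continuous (fun y => chart i (f y))} -> {within A, continuous f}.
Proof.
move=> Ai /withinP cf; apply/withinP => y Ay V nV.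
have := cf y Ay _ (nV i (Ai _ Ay)).
by apply: filterS => y' H Ay'; apply: (H Ay') => //; exact: Ai.
Qed.

Lemma within_glued_cover (Y Z : topologicalType) (A : set Y) (f : Y -> Z) (v : Y -> E) :
  continuous v ->
  (forall i, {within [set y | A y /\ C i (gl_w (v y))], continuous f}) ->
  {within A, continuous f}.
Proof.
move=> cv; apply: (within_cover (v := fun y => gl_w (v y)) (@gl_closed _ _ D)).
  by move=> y; apply: continuous_comp; [exact: cv|exact: gl_w_cont].
by move=> y _; exact: gl_wC.
Qed.

Lemma within_chart2 (Y : topologicalType) (A : set Y) (v : Y -> E) i :
  (forall y, A y -> C i (gl_w (v y))) -> continuous v ->
  {within A, continuous (fun y => (chart i (v y)).2)}.
Proof.
move=> AC cv; apply: (@within_compT _ _ _ A (fun y => chart i (v y)) snd) => [|q]; last exact: cvg_snd.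
apply: (@within_comp _ _ _ A _ v (chart i) _ _ (@within_chart i)) => //.
exact: continuous_subspaceT.
Qed.

Lemma gl_p_cont : continuous (@gl_p _ _ D).
Proof.
apply: within_setT; apply: (@within_glued_cover _ _ _ _ id) => [x //|i].
apply: (within_ext (f := fun e : E => cod (chart i e).2)) => [e [_ Ci]|].
  exact: gl_chart_cod.
by apply: within_gcod; apply: (@within_chart2 _ _ id) => [e []|x].
Qed.

Lemma gl_act_subproof h (e : E) : dom h = gl_p e ->
  X (gl_w e) /\ dom (h \* (sval e).2) = gl_f D (gl_w e).
Proof. by move=> he; split; [exact: gl_wX|rewrite gdom_comp// gl_dom2]. Qed.

Definition gl_act (h : G1 G) (e : E) : E :=
  if pselect (dom h = gl_p e) is left he then gl_mk (gl_act_subproof he) else e.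

Lemma gl_actE h e : dom h = gl_p e -> sval (gl_act h e) = (gl_w e, h \* (sval e).2).
Proof. by rewrite /gl_act; case: pselect. Qed.

Lemma gl_w_act h e : dom h = gl_p e -> gl_w (gl_act h e) = gl_w e.
Proof. by move=> he; rewrite {1}/gl_w gl_actE. Qed.

Lemma gl_p_act h e : dom h = gl_p e -> gl_p (gl_act h e) = cod h.
Proof. by move=> he; rewrite {1}/gl_p gl_actE//= gcod_comp. Qed.

Lemma gl_chart_act i h e : C i (gl_w e) -> dom h = gl_p e ->
  chart i (gl_act h e) = (gl_w e, h \* (chart i e).2).
Proof.
move=> Ci he; rewrite /gl_chart gl_w_act// gl_actE//=; congr pair.
by rewrite gcomp_assoc//; exact: gl_domg.
Qed.

(** Over a point [y] of [C i] the chart values are exactly the arrows with source [cod (g i y)]. As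
    [dom] is open and this source moves continuously with [y], an open set of arrows around the
    chart value of [e] contains one for every nearby [y] in [C i]. *)
Lemma gl_w_open (U : set E) : open U -> exists V, open V /\ (@gl_w _ _ D) @` U = V `&` X.
Proof.
move=> oU; exists ([set x | X x -> ((@gl_w _ _ D) @` U) x]^°); split; first exact: open_interior.
apply/seteqP; split => x; last first.
  by case=> /interior_subset; exact.
move=> [e Ue <-]; split; last exact: gl_wX.
rewrite /interior /=.
have : \forall x \near gl_w e, (exists i, C i (id x)) -> ((@gl_w _ _ D) @` U) x; last first.
  by apply: filterS => y H /(@gl_cover _ _ D)/H.
apply: cover_near => [i|//|i Ci]; first exact: gl_closed.
have nU : nbhs e U by apply: open_nbhs_nbhs.
have [[P Q] /= [nP nQ] PQ] := nU i Ci.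
have nQ' : nbhs (cod (g i (gl_w e))) (dom @` (Q^°)).
  rewrite -(gl_chart_dom Ci); apply: open_nbhs_nbhs; split.
    by apply: gdom_open; exact: open_interior.
  by exists (chart i e).2.
(* The diagonal transition [g i \* inv (g i)] has source [cod (g i)], which is therefore continuous
   on [C i]. *)
have := @gl_trans _ _ D i i; rewrite setIid.
move=> /(@within_gdom G T _ _)/withinP/(_ _ Ci (dom @` Q^°)).
rewrite gdom_comp ?gcod_inv// gdom_inv => /(_ nQ') H.
near=> y => Ciy.
have [k Qk] : (dom @` Q^°) (dom (g i y \* inv (g i y))) by apply: (near H).
rewrite gdom_comp ?gcod_inv// gdom_inv => kE.
have Xk : X y /\ dom (k \* g i y) = gl_f D y.
  by split; [apply/(@gl_cover _ _ D); exists i|rewrite /= gdom_comp// gl_dom].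
exists (gl_mk Xk) => //; apply: (PQ (y, k)) => //=.
  by split => /=; [apply: (near nP)|exact: interior_subset].
by rewrite /gl_chart /gl_w /= gcompgK.
Unshelve. all: by end_near. Qed.

Lemma glued_bundle : principal_bundle X (@gl_p _ _ D) (@gl_w _ _ D) gl_act.
Proof.
have act_cont : {within [set q : G1 G * E | dom q.1 = gl_p q.2],
    continuous (fun q => gl_act q.1 q.2)}.
  apply: (@within_glued_cover _ _ _ _ snd) => [q|i]; first exact: cvg_snd.
  apply: (@within_glued _ _ _ i) => [q [/= he Ci]|]; first by rewrite gl_w_act.
  apply: (within_ext (f := fun q : G1 G * E => (gl_w q.2, q.1 \* (chart i q.2).2))).
    by move=> q [/= he Ci]; rewrite gl_chart_act.
  apply: within_pair.
    by apply: within_compT gl_w_cont; exact: within_snd.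
  apply: within_gcomp => [q [/= he Ci]||]; first by rewrite gl_chart_cod.
    exact: within_fst.
  by apply: within_chart2 => [q []//|q]; exact: cvg_snd.
split; first exact: gl_p_cont.
split; first exact: gl_w_cont.
split; first by move=> h e he; rewrite gl_p_act ?gl_w_act.
split.
  move=> e; apply: glued_inj; rewrite gl_actE ?gdom_unit//.
  by rewrite gcomp_unitl -surjective_pairing.
split.
  move=> a h e ah he; apply: glued_inj; rewrite gl_actE ?gdom_comp//.
  rewrite gl_actE ?gl_p_act// gl_w_act// gl_actE//=; congr pair.
  by rewrite gcomp_assoc.
split; first exact: act_cont.
split.
  apply/seteqP; split=> x; first by case=> e _ <-; exact: gl_wX.
  move=> Xx; have [i Ci] := (@gl_cover _ _ D x).1 Xx.
  have Xg : X x /\ dom (g i x) = gl_f D x by split; rewrite ?gl_dom.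
  by exists (gl_mk Xg).
split; first exact: gl_w_open.
split; first by move=> [h e] /= he; rewrite gl_w_act.
split; first by apply: within_pair => //; exact: within_snd.
(* Division is [h' \* inv h] for points [(x, h')] and [(x, h)]; it can be computed in a chart, where
   the common factor [inv (g i x)] cancels. *)
exists (fun q => ((sval q.1).2 \* inv (sval q.2).2, q.2)); split; last split.
- move=> [e' e] /= we.
  have dd : dom (sval e').2 = dom (sval e).2 by rewrite !gl_dom2 we.
  have he : dom ((sval e').2 \* inv (sval e).2) = gl_p e.
    by rewrite gdom_comp ?gcod_inv// gdom_inv.
  split=> //; congr pair; apply: glued_inj; rewrite gl_actE// gcompgVK// -we.
  by rewrite -surjective_pairing.
- by move=> [h e] /= he; rewrite gl_actE//= gcompgK.
- apply: within_pair; last exact: within_snd.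
  apply: (@within_glued_cover _ _ _ _ snd) => [q|i]; first exact: cvg_snd.
  apply: (within_ext (f := fun q : E * E => (chart i q.1).2 \* inv (chart i q.2).2)).
    move=> [e' e] [/= we Ci].
    have dd : dom (sval e').2 = dom (sval e).2 by rewrite !gl_dom2 we.
    have di := gl_domg Ci.
    have dg : dom (sval e).2 = dom (g i (gl_w e)) by rewrite di gcod_inv.
    rewrite we -(gcomp_divM dd dg) gcompgK// gdom_comp ?gcod_inv//.
    by rewrite gdom_inv gcod_comp.
  apply: within_gcomp => [q [we Ci]||].
  - have we' : gl_w q.1 = gl_w q.2 := we.
    by rewrite gcod_inv !gl_chart_dom ?we'.
  - by apply: within_chart2 => [[e' e] [/= ->]//|q]; exact: cvg_fst.
  - by apply: within_ginv; apply: within_chart2 => [q []//|q]; exact: cvg_snd.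
Qed.

(** The frame itself is the section: in chart [i] the point [(x, g i x)] is the unit at
    [cod (g i x)], hence continuous in [x] even where [g i] is not. The point [x0] supplies a value
    outside [C i]. *)
Lemma glue_sections (x0 : T) : X x0 -> exists S : gl_I D -> T -> E,
  (forall i, {within C i, continuous (S i)}) /\
  (forall i x, C i x -> gl_w (S i x) = x /\ gl_p (S i x) = cod (g i x)) /\
  (forall i j x, C i x -> C j x -> gl_act (g j x \* inv (g i x)) (S i x) = S j x).
Proof.
move=> Xx0.
have [i0 Ci0] := (@gl_cover _ _ D x0).1 Xx0.
have mk i x : C i x -> X x /\ dom (g i x) = gl_f D x.
  by move=> Cx; split; [apply/(@gl_cover _ _ D); exists i|rewrite gl_dom].
pose S i x : E := if pselect (C i x) is left Cx then gl_mk (mk i x Cx)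
                  else gl_mk (mk i0 x0 Ci0).
have SE i x : C i x -> sval (S i x) = (x, g i x) by rewrite /S; case: pselect.
have wS i x : C i x -> gl_w (S i x) = x by move=> Cx; rewrite /gl_w SE.
have pS i x : C i x -> gl_p (S i x) = cod (g i x) by move=> Cx; rewrite /gl_p SE.
exists S; split; last split.
- move=> i; apply: (@within_glued _ _ _ i) => [x Cx|]; first by rewrite wS.
  apply: (within_ext (f := fun x => (x, g i x \* inv (g i x)))).
    by move=> x Cx; rewrite /gl_chart wS// SE.
  apply: within_pair; first exact: within_id.
  by have := @gl_trans _ _ D i i; rewrite setIid.
- by move=> i x Cx; rewrite wS ?pS.
- move=> i j x Ci Cj; have dd : dom (g j x) = dom (g i x) by rewrite !gl_dom.
  apply: glued_inj; rewrite gl_actE.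
    by rewrite wS// !SE//= gcompgVK.
  by rewrite gdom_comp ?gcod_inv// gdom_inv pS.
Qed.

End GlueBundle.

(** * Gluing along a chain of closed cells *)

Lemma gcomp_invunit (G : topGroupoid) (a : G1 G) :
  @gcomp G a (@ginv G (@gunit G (@gdom G a))) = a.
Proof. by rewrite -[X in @gcomp G X _]gcomp_unitr gcompgK// gcod_unit. Qed.

Section Chain.
Variables (G : topGroupoid) (T : topologicalType) (X : set T) (s : T -> R) (n : nat).
Variables (t : nat -> T -> R) (f : nat -> T -> G0 G) (d : nat -> T -> G1 G).
(** The thresholds [t i] depend on the point: they are constant when a loop is glued over the
    interval, and over the square they move with the deformation parameter. *)
Definition cell i := [set x | X x /\ t i x <= s x <= t i.+1 x].
Hypothesis Xcl : closed X.
Hypothesis scont : continuous s.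
Hypothesis tcont : forall i, continuous (t i).
Hypothesis t_lo : forall x, X x -> t 0 x <= s x.
Hypothesis t_hi : forall x, X x -> s x <= t n.+1 x.
Hypothesis t_lt : forall i x, (i <= n)%N -> X x -> t i x < t i.+1 x.
Hypothesis fcont : forall i, (i <= n)%N -> {within cell i, continuous (f i)}.
Hypothesis dcont : forall i, (i < n)%N ->
  {within [set x | X x /\ s x = t i.+1 x], continuous (d i.+1)}.
Hypothesis ddom : forall i x, (i < n)%N -> X x -> s x = t i.+1 x -> dom (d i.+1 x) = f i x.
Hypothesis dcod : forall i x, (i < n)%N -> X x -> s x = t i.+1 x -> cod (d i.+1 x) = f i.+1 x.

Lemma cell_closed i : closed (cell i).
Proof.
have -> : cell i = X `&` ([set x | t i x <= s x] `&` [set x | s x <= t i.+1 x]).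
  apply/seteqP; split=> x /=; first by case=> Xx /andP[a b].
  by case=> Xx [a b]; split=> //; apply/andP.
by apply: closedI => //; apply: closedI; apply: closed_le_fun.
Qed.

Lemma chain_lt i j x : (i < j <= n.+1)%N -> X x -> t i x < t j x.
Proof.
move=> /andP[ij jn] Xx; elim: j ij jn => // j IH; rewrite ltnS leq_eqVlt => /orP[/eqP->|ij] jn.
  exact: t_lt.
by apply: lt_trans (IH ij (ltnW jn)) _; exact: t_lt.
Qed.

Lemma cell_cover x : X x -> exists2 i, (i <= n)%N & cell i x.
Proof.
move=> Xx; have ex : exists i, s x <= t i.+1 x by exists n; exact: t_hi.
have lem := ex_minnP ex; case: lem => i le_i min_i; exists i; first by apply: min_i; exact: t_hi.
split=> //; rewrite le_i andbT; case: i le_i min_i => [|i] _ min_i; first exact: t_lo.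
rewrite leNgt; apply/negP => /ltW /min_i; by rewrite ltnn.
Qed.

Lemma cell_meet i j x : (i < j <= n)%N -> cell i x -> cell j x -> j = i.+1 /\ s x = t j x.
Proof.
move=> /andP[ij jn] [Xx /andP[_ a]] [_ /andP[b _]].
have [e|ne] := eqVneq j i.+1; first by subst j; split=> //; apply/eqP; rewrite eq_le a b.
have : t i.+1 x < t j x.
  by apply: chain_lt => //; rewrite ltn_neqAle eq_sym ne ij /= ltnW// ltnS.
by move=> /(le_lt_trans a)/lt_le_trans/(_ b); rewrite ltxx.
Qed.

Lemma cell_start i x : (i <= n)%N -> cell i x -> s x = t i.+1 x -> s x != t i x.
Proof.
by move=> ni [Xx _] ->; rewrite gt_eqF//; exact: t_lt.
Qed.

(* On [cell i] the source of [frame i] does not depend on [i], so no cocycle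
   condition has to be checked. *)
Definition frame i x := if (0 < i)%N && (s x == t i x) then d i x else one (f i x).

Lemma frame_cod i x : (i <= n)%N -> cell i x -> cod (frame i x) = f i x.
Proof.
move=> ni [Xx _]; rewrite /frame; case: ifPn => [|_]; last exact: gcod_unit.
by case: i ni => // i ni /= /eqP sx; exact: dcod.
Qed.

Lemma frame_succ i x : (i < n)%N -> cell i x -> s x = t i.+1 x ->
  frame i.+1 x = d i.+1 x /\ frame i x = one (f i x).
Proof.
move=> ni Cx sx; rewrite /frame {1}sx eqxx /=; split=> //.
by rewrite (negPf (cell_start (ltnW ni) Cx sx)) andbF.
Qed.

Lemma frame_dom i j x : (i <= n)%N -> (j <= n)%N -> cell i x -> cell j x ->
  dom (frame i x) = dom (frame j x).
Proof.
wlog ij : i j / (i <= j)%N => [H|ni nj Ci Cj].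
  by move: (leq_total i j) => /orP[/H|/H h *]; [exact|symmetry; exact: h].
move: ij; rewrite leq_eqVlt => /orP[/eqP-> //|ij].
have [je sx] := cell_meet (introT andP (conj ij nj)) Ci Cj; subst j.
have [-> ->] := frame_succ nj Ci sx.
by rewrite gdom_unit ddom//; case: Ci.
Qed.

(** Cells that are not consecutive are disjoint, so nothing is to be shown there; between
    consecutive cells the transition is [d] or its inverse, and on a single cell it is the unit
    along the continuous [f i]. *)
Lemma frame_trans i j : (i <= n)%N -> (j <= n)%N ->
  {within cell i `&` cell j, continuous (fun x => frame j x \* inv (frame i x))}.
Proof.
have succ k : (k < n)%N -> {within cell k `&` cell k.+1,
    continuous (fun x => frame k.+1 x \* inv (frame k x))}.
  move=> kn; have kk : (k < k.+1 <= n)%N by rewrite ltnSn.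
  apply: (within_ext (f := d k.+1)) => [x [C1 C2]|].
    have [_ sx] := cell_meet kk C1 C2; have [-> ->] := frame_succ kn C1 sx.
    by rewrite -(ddom kn _ sx) ?gcomp_invunit//; case: C1.
  apply: (within_sub _ (dcont kn)) => x [C1 C2].
  by have [_ sx] := cell_meet kk C1 C2; split=> //; case: C1.
move=> ni nj; have [ij|ji|<-] := ltngtP i j.
- have [e|ne] := eqVneq j i.+1; first by subst j; exact: succ.
  apply/withinP => x [C1 C2].
  by have [e _] := cell_meet (introT andP (conj ij nj)) C1 C2; rewrite e eqxx in ne.
- have [e|ne] := eqVneq i j.+1; last first.
    apply/withinP => x [C1 C2].
    by have [e _] := cell_meet (introT andP (conj ji ni)) C2 C1; rewrite e eqxx in ne.
  subst i; rewrite setIC.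
  apply: (within_ext (f := fun x => inv (frame j.+1 x \* inv (frame j x)))); last first.
    by apply: within_ginv; exact: succ.
  move=> x [C1 C2]; have dd := frame_dom ni nj C2 C1.
  set a := frame j.+1 x in dd *; set b := frame j x in dd *.
  have ab : dom (a \* inv b) = cod b by rewrite gdom_comp ?gcod_inv// gdom_inv.
  have ca : cod (a \* inv b) = cod a by rewrite gcod_comp ?gcod_inv.
  by rewrite -(gcompK (g := a \* inv b) (h := b \* inv a)) ?gcod_comp ?gcod_inv//
    gcomp_divM// gcomp_invr -{1}ca -gdom_inv gcomp_unitr.
- apply: (within_ext (f := fun x => one (f i x))).
    by move=> x [C1 _]; rewrite gcomp_invr frame_cod.
  by rewrite setIid; apply: within_gunit; exact: fcont.
Qed.

Lemma chain_bundle x0 : X x0 ->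
  exists (E : topologicalType) (p : E -> G0 G) (w : E -> T) (act : G1 G -> E -> E)
    (S : nat -> T -> E), principal_bundle X p w act /\
    (forall i, (i <= n)%N -> {within cell i, continuous (S i)}) /\
    (forall i x, (i <= n)%N -> cell i x -> w (S i x) = x /\ p (S i x) = f i x) /\
    (forall i x, (i < n)%N -> X x -> s x = t i.+1 x -> act (d i.+1 x) (S i x) = S i.+1 x).
Proof.
move=> Xx0.
(* An arbitrary cell through [x]; by [frame_dom] the base point obtained from it does not depend on
   the choice. *)
pose idx x : 'I_n.+1 := if pselect (exists i : 'I_n.+1, cell i x) is left H
                        then projT1 (cid H) else ord0.
have idxP (i : 'I_n.+1) x : cell i x -> cell (idx x) x.
  move=> Cx; rewrite /idx; case: pselect => [H|[]]; last by exists i.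
  by case: (cid H).
have cov x : X x <-> exists i : 'I_n.+1, cell i x.
  split=> [/cell_cover[i ni Ci]|[i []//]].
  by exists (Ordinal (n:=n.+1) (m:=i) ni).
have gdomE (i : 'I_n.+1) x : cell i x -> dom (frame i x) = dom (frame (idx x) x).
  by move=> Ci; apply: frame_dom (idxP _ _ Ci) => //; rewrite -ltnS.
have tr (i j : 'I_n.+1) : {within cell i `&` cell j,
    continuous (fun x => frame j x \* inv (frame i x))}.
  by apply: frame_trans; rewrite -ltnS.
pose D := @GlueData G T X 'I_n.+1 (fun i => cell i) (fun x => dom (frame (idx x) x))
  (fun i => frame i) (fun i => @cell_closed i) cov gdomE tr.
have [S [Sc [Sw Sa]]] := @glue_sections G T D x0 Xx0.
exists (glued D), (@gl_p _ _ D), (@gl_w _ _ D), (@gl_act _ _ D), (fun i => S (inord i)).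
split; first exact: (glued_bundle D).
have inE i : (i <= n)%N -> nat_of_ord (inord i : 'I_n.+1) = i by move=> ni; rewrite inordK.
split; first by move=> i ni; have := Sc (inord i); rewrite /= inE.
split.
  move=> i x ni Cx; have := Sw (inord i) x; rewrite /= inE// => /(_ Cx)[-> ->].
  by rewrite frame_cod.
move=> i x ni Xx sx.
have Ci : cell i x by split=> //; rewrite sx lexx andbT ltW// t_lt// ltnW.
have Cj : cell i.+1 x by split=> //; rewrite sx lexx /= ltW// t_lt.
have := Sa (inord i) (inord i.+1) x; rewrite /= !inE//; last exact: ltnW.
move=> /(_ Ci Cj); have [-> ->] := frame_succ ni Ci sx.
by rewrite -(ddom ni Xx sx) gcomp_invunit.
Qed.

End Chain.

(** * Bundle isomorphisms and local sections *)

Section BundleMap.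
Variables (G : topGroupoid) (E T E' T' : topologicalType) (X : set T) (X' : set T').
Variables (p : E -> G0 G) (w : E -> T) (act : G1 G -> E -> E).
Variables (p' : E' -> G0 G) (w' : E' -> T') (act' : G1 G -> E' -> E').
Hypothesis pb : principal_bundle X p w act.
Hypothesis pb' : principal_bundle X' p' w' act'.
Variables (I : finType) (C : I -> set T) (c : T -> T').
Variables (S : I -> T -> E) (S' : I -> T -> E').
Hypothesis Ccl : forall i, closed (C i).
Hypothesis Sc : forall i, {within C i, continuous (S i)}.
Hypothesis Sc' : forall i, {within C i, continuous (S' i)}.
Hypothesis Sw : forall i x, C i x -> w (S i x) = x.
Hypothesis Sw' : forall i x, C i x -> w' (S' i x) = c x.
Hypothesis Sp : forall i x, C i x -> p (S i x) = p' (S' i x).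
Hypothesis SS' : forall i j x, C i x -> C j x -> exists k,
  [/\ @gdom G k = p (S i x), act k (S i x) = S j x & act' k (S' i x) = S' j x].

(** Equivariance forces [k S_i |-> k S'_i]. Two indices give the same value because, by [SS'], one
    and the same arrow relates the sections on both sides. The point [e0] is the value off the
    cells. *)
Lemma bundle_map (e0 : E') : exists phi : E -> E',
  {within [set e | exists i, C i (w e)], continuous phi} /\
  (forall e i, C i (w e) -> phi e = act' (dv pb e (S i (w e))) (S' i (w e))).
Proof.
pose phi e := if pselect (exists i, C i (w e)) is left H then
  let i := projT1 (cid H) in act' (dv pb e (S i (w e))) (S' i (w e)) else e0.
have phiE e i : C i (w e) -> phi e = act' (dv pb e (S i (w e))) (S' i (w e)).
  move=> Ci; rewrite /phi; case: pselect => [H|[]]; last by exists i.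
  case: (cid H) => j Cj /=.
  have [k [kd kS kS']] := SS' Ci Cj.
  have wj : w e = w (S j (w e)) by rewrite Sw.
  have wi : w (S j (w e)) = w (S i (w e)) by rewrite !Sw.
  have kE : k = dv pb (S j (w e)) (S i (w e)) by rewrite (dv_eq pb kd kS).
  rewrite -kS' -(actM pb').
  - by rewrite kE dv_comp// -wi.
  - by rewrite dv_dom// kE dv_cod.
  - by rewrite kd Sp.
exists phi; split=> //.
apply: (within_cover (v := w) Ccl (pb_wcont pb)) => // i.
apply: (within_ext (f := fun e => act' (dv pb e (S i (w e))) (S' i (w e)))).
  by move=> e [_ Ci]; rewrite (phiE _ _ Ci).
have cw : {within [set y | (exists j, C j (w y)) /\ C i (w y)], continuous w}.
  by apply: continuous_subspaceT; exact: pb_wcont pb.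
apply: (within_act pb') => [e [_ Ci]||].
- by rewrite dv_dom ?Sw// Sp.
- apply: within_dv => [e [_ Ci]||]; first by rewrite Sw.
    exact: within_id.
  by apply: (within_comp (B := C i)) => // e [].
- by apply: (within_comp (B := C i)) => // e [].
Qed.

Variable phi : E -> E'.
Hypothesis phiE : forall e i, C i (w e) -> phi e = act' (dv pb e (S i (w e))) (S' i (w e)).

Lemma bundle_map_base e i : C i (w e) -> w' (phi e) = c (w e) /\ p' (phi e) = p e.
Proof.
move=> Ci; rewrite (phiE Ci).
have wi : w e = w (S i (w e)) by rewrite Sw.
have dd : @gdom G (dv pb e (S i (w e))) = p' (S' i (w e)) by rewrite dv_dom// Sp.
by rewrite (w_act pb') ?Sw' // (p_act pb')// dv_cod.
Qed.

Lemma bundle_map_act h e i : C i (w e) -> @gdom G h = p e ->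
  phi (act h e) = act' h (phi e).
Proof.
move=> Ci he; have wh := w_act pb he.
have wi : w e = w (S i (w e)) by rewrite Sw.
have Ci' : C i (w (act h e)) by rewrite wh.
rewrite (phiE Ci) (phiE Ci') wh dv_actl// (actM pb')//.
  by rewrite he dv_cod.
by rewrite dv_dom// Sp.
Qed.

Lemma bundle_map_sec i x : C i x -> phi (S i x) = S' i x.
Proof.
move=> Ci; have Ci' : C i (w (S i x)) by rewrite Sw.
by rewrite (phiE Ci') Sw// dv_id Sp// (act1 pb').
Qed.

End BundleMap.

Section BundleIso.
Variables (G : topGroupoid) (E T E' T' : topologicalType) (X : set T) (X' : set T').
Variables (p : E -> G0 G) (w : E -> T) (act : G1 G -> E -> E).
Variables (p' : E' -> G0 G) (w' : E' -> T') (act' : G1 G -> E' -> E').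
Hypothesis pb : principal_bundle X p w act.
Hypothesis pb' : principal_bundle X' p' w' act'.
Variables (I : finType) (C : I -> set T) (C' : I -> set T') (c : T -> T') (r : T' -> T).
Variables (S : I -> T -> E) (S' : I -> T' -> E').
Hypothesis Ccl : forall i, closed (C i).
Hypothesis Ccl' : forall i, closed (C' i).
Hypothesis CX : forall x, X x -> exists i, C i x.
Hypothesis c_cont : continuous c.
Hypothesis r_cont : continuous r.
Hypothesis CC' : forall i x, C i x -> C' i (c x) /\ r (c x) = x.
Hypothesis C'C : forall i y, C' i y -> C i (r y) /\ c (r y) = y.
Hypothesis Sc : forall i, {within C i, continuous (S i)}.
Hypothesis Sc' : forall i, {within C' i, continuous (S' i)}.
Hypothesis Sw : forall i x, C i x -> w (S i x) = x.
Hypothesis Sw' : forall i y, C' i y -> w' (S' i y) = y.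
Hypothesis Sp : forall i x, C i x -> p (S i x) = p' (S' i (c x)).
Hypothesis SS' : forall i j x, C i x -> C j x -> exists k,
  [/\ @gdom G k = p (S i x), act k (S i x) = S j x & act' k (S' i (c x)) = S' j (c x)].

(** The equivariant maps built from the same sections in the two directions are mutually inverse.
    The base [X] is only embedded by [c] as a closed part of the other base, so [phi] is a
    homeomorphism onto the preimage of that part. *)
Lemma bundle_iso (e0 : E) : exists phi : E -> E',
  [/\ homeo_onto phi [set e | exists i, C' i (w' e)],
      forall e, w' (phi e) = c (w e) /\ p' (phi e) = p e,
      forall h e, @gdom G h = p e -> phi (act h e) = act' h (phi e) &
      forall i x, C i x -> phi (S i x) = S' i (c x)].
Proof.
have [i0 Ci0] := CX (pb_X pb e0).
have cSc' i : {within C i, continuous (fun x => S' i (c x))}.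
  apply: (@within_comp _ _ _ (C i) (C' i) c (S' i)) => [x /CC'[]//||//].
  exact: continuous_subspaceT.
have cSw' i x : C i x -> w' (S' i (c x)) = c x by move=> /CC'[/Sw'].
have [phi [phic phiE]] := bundle_map pb pb' Ccl Sc cSc' Sw Sp SS' (S' i0 (c (w e0))).
have rSc i : {within C' i, continuous (fun y => S i (r y))}.
  apply: (@within_comp _ _ _ (C' i) (C i) r (S i)) => [x /C'C[]//||//].
  exact: continuous_subspaceT.
have rSw i y : C' i y -> w (S i (r y)) = r y by move=> /C'C[/Sw].
have rSp i y : C' i y -> p' (S' i y) = p (S i (r y)).
  by move=> /C'C[/Sp -> ->].
have rSS i j y : C' i y -> C' j y -> exists k,
    [/\ @gdom G k = p' (S' i y), act' k (S' i y) = S' j y & act k (S i (r y)) = S j (r y)].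
  move=> Ci Cj; have [Ci' cr] := C'C Ci; have [Cj' _] := C'C Cj.
  have [k [k1 k2 k3]] := SS' Ci' Cj'.
  by exists k; rewrite cr in k3; split; rewrite ?rSp.
have [psi [psic psiE]] := bundle_map pb' pb Ccl' Sc' rSc Sw' rSp rSS e0.
have wphi e : w' (phi e) = c (w e) /\ p' (phi e) = p e.
  have [i Ci] := CX (pb_X pb e).
  exact: (bundle_map_base pb' Sw cSw' Sp phiE Ci).
exists phi; split=> //.
- split; last split.
  + apply: within_setT; apply: within_sub phic => e _.
    by have [i Ci] := CX (pb_X pb e); exists i.
  + move=> e; have [i Ci] := CX (pb_X pb e); exists i.
    by have [-> _] := wphi e; case: (CC' Ci).
  exists psi; split; last split => //.
    move=> e; have [i Ci] := CX (pb_X pb e).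
    have [C'i rc] := CC' Ci; have [we pe] := wphi e.
    have wi : w e = w (S i (w e)) by rewrite Sw.
    rewrite (psiE _ i); last by rewrite we.
    rewrite we rc (phiE _ _ Ci) act_dv; last by rewrite dv_dom// Sp.
    by rewrite dv_act.
  move=> e [i C'i]; have [Ci cr] := C'C C'i.
  have wi : w' e = w' (S' i (w' e)) by rewrite Sw'.
  have [wpsi _] := bundle_map_base pb Sw' rSw rSp psiE C'i.
  have Cpsi : C i (w (psi e)) by rewrite wpsi.
  rewrite (phiE _ _ Cpsi) wpsi cr (psiE _ _ C'i) act_dv; last by rewrite dv_dom// rSp.
  by rewrite dv_act.
- move=> h e he; have [i Ci] := CX (pb_X pb e).
  exact: (bundle_map_act pb' Sw Sp phiE Ci he).
- by move=> i x Ci; exact: (bundle_map_sec pb' Sw Sp phiE Ci).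
Qed.

End BundleIso.

Section Etale.
Variables (G : topGroupoid) (E T : topologicalType) (X : set T).
Variables (p : E -> G0 G) (w : E -> T) (act : G1 G -> E -> E).
Hypothesis Get : etale G.
Hypothesis pb : principal_bundle X p w act.

(* Two points of a fibre that are close to [e] differ by an arrow close to the unit
   at [p e] with the same source as a unit, hence by a unit. *)
Lemma etale_local_inj e : exists U : set E, [/\ open U, U e &
  forall e1 e2, U e1 -> U e2 -> w e1 = w e2 -> e1 = e2].
Proof.
have [U [oU Ue _ injU _]] := Get (@gunit G (p e)).
have := @dv_cont _ _ _ _ _ _ _ pb; move=> /withinP/(_ (e, e) erefl U); rewrite /= dv_id.
case; first exact: open_nbhs_nbhs.
move=> [P Q] /= [nP nQ] PQ.
exists ((P `&` Q)^°); split; first exact: open_interior.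
  by apply: filterI.
move=> e1 e2 /interior_subset[P1 Q1] /interior_subset[P2 Q2] w12.
have U12 : U (dv pb e1 e2) by apply: (PQ (e1, e2)).
have U22 : U (@gunit G (p e2)).
  by rewrite -(dv_id pb); apply: (PQ (e2, e2)).
have := injU _ _ U12 U22; rewrite dv_dom// gdom_unit => /(_ erefl) d12.
by rewrite -(dv_act pb w12) d12 (act1 pb).
Qed.

(** The section inverts [w] on an open set where [w] is injective; its continuity at a point is the
    openness of [w] on smaller open sets. *)
Lemma etale_section e : exists (V : set T) (s : T -> E),
  [/\ open V, V (w e), s (w e) = e, {within V `&` X, continuous s} &
      forall x, V x -> X x -> w (s x) = x].
Proof.
have [U [oU Ue injU]] := etale_local_inj e.
have [V [oV VX]] := pb_open pb oU.
pose s x := if pselect (exists2 e', U e' & w e' = x) is left H then s2val (cid2 H) else e.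
have sP x : V x -> X x -> U (s x) /\ w (s x) = x.
  move=> Vx Xx; rewrite /s; case: pselect => [H|]; first by case: (cid2 H).
  by have : (w @` U) x by rewrite VX.
have VXe : (V `&` X) (w e) by rewrite -VX; exists e.
exists V, s; split=> //.
- by case: VXe.
- by have [Us ws] := sP _ VXe.1 VXe.2; exact: injU.
- apply/withinP => x [Vx Xx] N nN; have [Us ws] := sP x Vx Xx.
  have oU' : open (N^° `&` U) by apply: openI => //; exact: open_interior.
  have [V' [oV' VX']] := pb_open pb oU'.
  have V'x : (V' `&` X) x.
    by rewrite -VX'; exists (s x) => //; split.
  have nV' : nbhs x V' by apply: open_nbhs_nbhs; split=> //; case: V'x.
  apply: filterS nV' => y V'y [Vy Xy].
  have [e' [Ne' Ue'] we'] : (w @` (N^° `&` U)) y by rewrite VX'.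
  have [Usy wsy] := sP y Vy Xy.
  by rewrite (injU (s y) e') ?we'//; exact: interior_subset.
- by move=> x Vx Xx; have [] := sP x Vx Xx.
Qed.

End Etale.

(** * Lebesgue numbers for the square and the interval *)

Lemma I01sq_compact : compact I01sq.
Proof.
have -> : I01sq = I01 `*` I01 by apply/seteqP; split=> -[x y].
by apply: compact_setX; exact: I01_compact.
Qed.

(** Compactness enters as a near-covering property: each point has a radius that also serves its
    neighbours, so one radius [1 / (m + 1)] serves the whole square. *)
Lemma lebesgue_grid2 (Q : set (R * R) -> Prop) :
  (forall q, I01sq q -> exists V, [/\ open V, V q & Q V]) ->
  exists N : nat, (0 < N)%N /\ forall i j, (i < N)%N -> (j < N)%N ->
    exists V, Q V /\ forall y : R * R, i%:R / N%:R <= y.1 <= i.+1%:R / N%:R ->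
      j%:R / N%:R <= y.2 <= j.+1%:R / N%:R -> V y.
Proof.
move=> H.
have := I01sq_compact; rewrite compact_near_coveringP.
pose P (m : nat) (q : R * R) := exists V, Q V /\
  forall y : R * R, `|q.1 - y.1| < m.+1%:R^-1 -> `|q.2 - y.2| < m.+1%:R^-1 -> V y.
move=> /(_ nat \oo P _); case.
  move=> q /H[V [oV Vq QV]].
  have [e e0 Ve] : exists2 e : R, 0 < e & forall y : R * R,
      `|q.1 - y.1| < e -> `|q.2 - y.2| < e -> V y.
    have /nbhs_ballP[e /= e0 He] : nbhs q V by exact: open_nbhs_nbhs.
    by exists e => // y y1 y2; apply: He; split.
  have e2 : 0 < e / 2 by lra.
  exists (ball q (e / 2), [set m : nat | m.+1%:R^-1 < e / 2]) => /=.
    split; first exact: nbhsx_ballx.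
    exact: (near_infty_natSinv_lt (PosNum e2)).
  move=> [q' m] /= [[b1 b2] me]; exists V; split=> // y y1 y2.
  by apply: Ve; rewrite (splitr e);
    [apply: (le_lt_trans (ler_distD q'.1 _ _))|apply: (le_lt_trans (ler_distD q'.2 _ _))];
    apply: ltrD => //; apply: lt_trans me.
(* The mesh is [1 / (m + 2)]: a closed cell then lies in the open box of radius [1 / (m + 1)] around
   its lower left corner. *)
move=> m _ /(_ m (leqnn m)) Hm; exists m.+2; split=> // i j im jm.
have N0 : 0 < m.+2%:R :> R by rewrite ltr0n.
have bnd k : (k < m.+2)%N -> I01 (k%:R / m.+2%:R).
  move=> km; rewrite /I01 /= divr_ge0 ?ler0n//= ler_pdivrMr// mul1r ler_nat.
  exact: ltnW.
have [V [QV VP]] := Hm (i%:R / m.+2%:R, j%:R / m.+2%:R) (conj (bnd i im) (bnd j jm)).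
have close k (y : R) : k%:R / m.+2%:R <= y <= k.+1%:R / m.+2%:R ->
    `|k%:R / m.+2%:R - y| < m.+1%:R^-1.
  move=> /andP[y1 y2]; rewrite distrC ger0_norm ?subr_ge0//.
  apply: (@le_lt_trans _ _ (m.+2%:R^-1)).
    rewrite lerBlDr; apply: le_trans y2 _.
    by rewrite -natr1 mulrDl mul1r addrC.
  by rewrite ltf_pV2 ?posrE ?ltr0n// ltr_nat.
by exists V; split=> // y y1 y2; apply: VP; exact: close.
Qed.

Lemma lebesgue_grid1 (Q : set R -> Prop) :
  (forall x, I01 x -> exists V, [/\ open V, V x & Q V]) ->
  exists N : nat, (0 < N)%N /\ forall i, (i < N)%N ->
    exists V, Q V /\ forall y : R, i%:R / N%:R <= y <= i.+1%:R / N%:R -> V y.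
Proof.
move=> H.
have HQ (q : R * R) : I01sq q -> exists W, [/\ open W, W q &
    exists2 V, Q V & W = (fun y : R * R => y.1) @^-1` V].
  move=> [/H[V [oV Vq QV]] _]; exists ((fun y : R * R => y.1) @^-1` V); split=> //; last by exists V.
  by apply: open_comp => // x _; exact: cvg_fst.
have [N [N0 HN]] := lebesgue_grid2 HQ.
exists N; split=> // i iN; have [W [[V QV ->] HW]] := HN i 0%N iN N0.
exists V; split=> // y yi; apply: (HW (y, 0)) => //=.
by rewrite mul0r lexx divr_ge0.
Qed.

(** * Words *)

Lemma pcat_cont (X : topologicalType) (a c : R -> X) :
  {within I01, continuous a} -> {within I01, continuous c} -> a 1 = c 0 ->
  {within I01, continuous (pcat a c)}.
Proof.
move=> ca cc ac.
have -> : I01 = [set u : R | 0 <= u <= 1 / 2] `|` [set u : R | 1 / 2 <= u <= 1].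
  apply/seteqP; split=> u; rewrite /I01 /=.
    by move=> /andP[u0 u1]; case: (leP u (1 / 2)) => h; [left|right]; lra.
  by case=> /andP[h1 h2]; lra.
have cl (x y : R) : closed [set u : R | x <= u <= y].
  have -> : [set u : R | x <= u <= y] = [set u : R | x <= u] `&` [set u : R | u <= y].
    by apply/seteqP; split=> u /=; [move=> /andP[]|move=> [? ?]; apply/andP].
  by apply: closedI; [exact: closed_ge|exact: closed_le].
apply: withinU_continuous; [exact: cl|exact: cl| |].
  apply: (@within_ext R X _ (fun u => a (2 * u)) (pcat a c)).
    by move=> u /= /andP[_ u1]; rewrite /pcat u1.
  apply: (@within_comp R R X _ I01 (fun u => 2 * u) a) => //.
    by move=> u; rewrite /I01 /=; lra.
  by apply: within_mulr; [exact: within_cst|exact: within_id].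
apply: (@within_ext R X _ (fun u => c (2 * u - 1)) (pcat a c)).
  move=> u /= /andP[u1 _]; rewrite /pcat; case: ifP => // u2.
  have -> : u = 1 / 2 by lra.
  rewrite (_ : 2 * (1 / 2) = 1 :> R); last by lra.
  by rewrite ac subrr.
apply: (@within_comp R R X _ I01 (fun u => 2 * u - 1) c) => //.
  by move=> u; rewrite /I01 /=; lra.
apply: within_subr; last exact: within_cst.
by apply: within_mulr; [exact: within_cst|exact: within_id].
Qed.

Fixpoint Allp (A : Type) (P : A -> Prop) (s : seq A) : Prop :=
  if s is a :: s' then P a /\ Allp P s' else True.

Lemma Allp_nth (A : Type) (P : A -> Prop) a0 s i : (i < size s)%N -> Allp P s -> P (nth a0 s i).
Proof. by elim: s i => // a s IH [|i] /= si [Pa Ps] //; exact: IH. Qed.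

Lemma Allp_cat (A : Type) (P : A -> Prop) s s' : Allp P s -> Allp P s' -> Allp P (s ++ s').
Proof. by elim: s => //= a s IH [Pa Ps] Ps'; split=> //; exact: IH. Qed.

Section Words.
Variables (G : topGroupoid) (b : G0 G).

(* A word is a list of arrows, each followed by a path starting at its target. *)
Definition letter := (G1 G * (R -> G0 G))%type.
Implicit Types (s pre post : seq letter) (x y z : G0 G) (h k : G1 G).

Definition l0 : letter := (one b, fun=> b).

Fixpoint chain x s y : Prop :=
  if s is a :: s' then
    [/\ dom a.1 = x, cod a.1 = a.2 0, {within I01, continuous a.2} & chain (a.2 1) s' y]
  else x = y.

Lemma chain_cat x y z s s' : chain x s y -> chain y s' z -> chain x (s ++ s') z.
Proof. by elim: s x => [x -> //|a s IH x /= [ax c0 ca cs]] cs'; split=> //; exact: IH. Qed.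

Lemma chain_catE x z s s' : chain x (s ++ s') z -> exists2 y, chain x s y & chain y s' z.
Proof.
elim: s x => [x /= c|a s IH x /= [ax c0 ca /IH[y cy cz]]]; first by exists x.
by exists y.
Qed.

Lemma chain_nth x s y i : chain x s y -> (i < size s)%N ->
  [/\ dom (nth l0 s i).1 = (if i is j.+1 then (nth l0 s j).2 1 else x),
      cod (nth l0 s i).1 = (nth l0 s i).2 0 & {within I01, continuous (nth l0 s i).2}].
Proof.
elim: s x i => [x i _ /=|a s IH x [|i] /= [ax c0 ca cs] //]; first by rewrite ltn0.
by move=> si; have [d1 c1 cc] := IH _ i cs si; split=> //; case: i si d1 {c1 cc}.
Qed.

Lemma chain_last x s y a : chain x (a :: s) y -> (last a s).2 1 = y.
Proof. by elim: s a x => [a x /= []//|c s IH a x /= [_ _ _ /IH]]. Qed.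

Fixpoint peqw s s' : Prop :=
  match s, s' with
  | [::], [::] => True
  | a :: s, a' :: s' => [/\ a.1 = a'.1, peq a.2 a'.2 & peqw s s']
  | _, _ => False
  end.

Lemma peqw_refl s : peqw s s.
Proof. by elim: s => //= a s IH; split=> // u. Qed.

Lemma peqw_sym s s' : peqw s s' -> peqw s' s.
Proof.
elim: s s' => [|a s IH] [|a' s'] //= [aa pa ps]; split=> //; last exact: IH.
by move=> u Iu; rewrite pa.
Qed.

Lemma peqw_size s s' : peqw s s' -> size s = size s'.
Proof. by elim: s s' => [|a s IH] [|a' s'] //= [_ _ /IH ->]. Qed.

Lemma peqw_nth s s' i : peqw s s' ->
  (nth l0 s i).1 = (nth l0 s' i).1 /\ peq (nth l0 s i).2 (nth l0 s' i).2.
Proof.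
elim: s s' i => [|a s IH] [|a' s'] // [|i] //= [aa pa ps] //; exact: IH.
Qed.

Lemma peqw_cat s1 s1' s2 s2' : peqw s1 s1' -> peqw s2 s2' -> peqw (s1 ++ s2) (s1' ++ s2').
Proof. by elim: s1 s1' => [|a s IH] [|a' s'] //= [aa pa ps] ps2; split=> //; exact: IH. Qed.

Lemma chain_peqw x s s' y : peqw s s' -> chain x s y -> chain x s' y.
Proof.
elim: s s' x => [|a s IH] [|a' s'] //= x [aa pa ps] [ax c0 ca cs].
split; [by rewrite -aa|by rewrite -aa -pa|exact: within_ext ca|].
by rewrite -pa//; exact: IH.
Qed.

(** A word of [m] letters spells [m] paths but only [m - 1] arrows: the arrow of its first letter
    lands at the meaningless index 0. *)
Definition mkl s : hloop G :=
  HLoop (size s).-1 (fun i => (nth l0 s i).2) (fun i => (nth l0 s i).1).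

Definition based s : Prop := if s is a :: _ then a.2 0 = b else False.

Lemma mkl_hloop s : based s -> chain b s b -> is_hloop b (mkl s).
Proof.
case: s => // a s a0 cs; split; [|split; [|split]] => //=.
- by move=> i ni; have [] := chain_nth (i := i) cs ni.
- by rewrite nth_last -(chain_last cs).
- move=> [//|i] /= ni; have [d1 c1 _] := chain_nth (i := i.+1) cs ni.
  by split.
Qed.

(** Only interior constant paths can be removed: [0 < size A] keeps [a] from being the first path,
    and the letter [c] keeps it from being the last. *)
Lemma mkl_const A a c B : (0 < size A)%N -> (forall u, I01 u -> a.2 u = a.2 0) ->
  move_const (mkl (A ++ a :: c :: B)) (mkl (A ++ (c.1 \* a.1, c.2) :: B)).
Proof.
move=> A0 ac; exists (size A); rewrite /= !size_cat /= !addnS /=.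
split; first by rewrite A0 ltnS leq_addr.
rewrite !nth_cat ltnn subnn /=; split=> //; split=> //.
split; first by move=> j jA u _; rewrite !nth_cat jA.
split.
  move=> j /andP[jA _] u _; rewrite !nth_cat ltnNge jA /= ltnNge (leqW jA) /= subSn//=.
  by case: (j - size A)%N.
split; first by move=> j /andP[_ jA]; rewrite !nth_cat jA.
split; first by rewrite ltnNge leqnSn /= subSn// subnn.
move=> j /andP[jA _]; rewrite !nth_cat ltnNge (ltnW jA) /= ltnNge (leqW (ltnW jA)) /=.
rewrite subSn ?(ltnW jA)//=; have : (0 < j - size A)%N by rewrite subn_gt0.
by case: (j - size A)%N.
Qed.

Lemma mkl_id A a c B : c.1 = one (a.2 1) -> a.2 1 = c.2 0 ->
  move_id (mkl (A ++ a :: c :: B)) (mkl (A ++ (a.1, pcat a.2 c.2) :: B)).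
Proof.
move=> c1 ac; exists (size A).+1; rewrite /= !size_cat /= !addnS /=.
have nA : nth l0 (A ++ [:: a, c & B]) (size A) = a by rewrite nth_cat ltnn subnn.
have nA1 : nth l0 (A ++ [:: a, c & B]) (size A).+1 = c.
  by rewrite nth_cat ltnNge leqnSn /= subSn// subnn.
rewrite !nA !nA1; split; first by rewrite ltnS leq_addr.
split=> //; split=> //; split=> //.
split; first by move=> j jA u _; rewrite !nth_cat jA.
split; first by rewrite nth_cat ltnn subnn.
have tl j : (size A < j)%N ->
    nth l0 (A ++ (a.1, pcat a.2 c.2) :: B) j = nth l0 (A ++ [:: a, c & B]) j.+1.
  move=> jA; rewrite !nth_cat ltnNge (ltnW jA) /= ltnNge (leqW (ltnW jA)) /=.
  rewrite subSn ?(ltnW jA)//=; have : (0 < j - size A)%N by rewrite subn_gt0.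
  by case: (j - size A)%N.
split; first by move=> j /andP[jA _] u _; rewrite tl.
split; last by move=> j /andP[jA _]; rewrite tl.
move=> j /andP[_]; rewrite ltnS leq_eqVlt => /orP[/eqP->|jA]; last by rewrite !nth_cat jA.
by rewrite nA nth_cat ltnn subnn.
Qed.

(* A letter depending on a deformation parameter, the first coordinate of its path. *)
Definition dletter := ((R -> G1 G) * (R * R -> G0 G))%type.
Definition slice (u : R) (dl : seq dletter) : seq letter :=
  [seq (d.1 u, fun v => d.2 (u, v)) | d <- dl].
Definition dcont (d : dletter) : Prop :=
  {within I01, continuous d.1} /\ {within I01sq, continuous d.2}.
Definition dconst (a : letter) : dletter := (fun=> a.1, fun q => a.2 q.2).

Lemma slice_dconst u s : slice u (map dconst s) = s.
Proof. by rewrite /slice -map_comp; elim: s => //= -[h a] s ->. Qed.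

Lemma dcont_dconst x s y : chain x s y -> Allp dcont (map dconst s).
Proof.
elim: s x => //= a s IH x [_ _ ca cs]; split; last exact: IH cs.
split; first exact: within_cst.
by apply: (@within_comp (R * R)%type R (G0 G) _ I01 snd a.2) => // [q []//|]; exact: within_snd.
Qed.

Definition d0 : dletter := (fun=> one b, fun=> b).

Lemma nth_slice u dl i : (i < size dl)%N ->
  nth l0 (slice u dl) i = ((nth d0 dl i).1 u, fun v => (nth d0 dl i).2 (u, v)).
Proof. by move=> si; rewrite (nth_map d0). Qed.

(** That every slice is a [chain] contains the source and target conditions of a deformation and its
    end at [b]. The start at [b] is asked separately because the first arrow is discarded. *)
Lemma mkl_deform dl s s' : (0 < size dl)%N -> Allp dcont dl ->
  (forall u, I01 u -> chain b (slice u dl) b /\ (nth d0 dl 0).2 (u, 0) = b) ->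
  peqw s (slice 0 dl) -> peqw s' (slice 1 dl) ->
  loop_equiv b (mkl s) (mkl s').
Proof.
move=> dl0 cdl H s0 s1.
have sz : size s = size dl by rewrite (peqw_size s0) size_map.
have sz' : size s' = size dl by rewrite (peqw_size s1) size_map.
have bs u r : I01 u -> peqw r (slice u dl) -> is_hloop b (mkl r).
  move=> Iu ru; have [cu bu] := H _ Iu; apply: mkl_hloop.
    case: r dl dl0 cdl H cu bu ru {s0 s1 sz sz'} => [|a r] [|d dl] //= _ _ _ _ bu [_ pa _].
    by rewrite pa.
  exact: chain_peqw (peqw_sym ru) cu.
apply: rst_step; split; first exact: bs s0.
split; first exact: bs s1.
right; right; split; first by rewrite /= sz sz'.
have le i : (i <= (size s).-1)%N -> (i < size dl)%N by rewrite sz; case: (dl) dl0.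
exists (fun i => (nth d0 dl i).2), (fun i => (nth d0 dl i).1) => /=.
split; last split.
- move=> i /le ni; split; first by have [] := Allp_nth d0 ni cdl.
  move=> v Iv; have [_ ->//] := peqw_nth i s0; have [_ ->//] := peqw_nth i s1.
  by rewrite !nth_slice.
- move=> [//|i] /= /le ni; split; first by have [] := Allp_nth d0 ni cdl.
  have [-> _] := peqw_nth i.+1 s0; have [-> _] := peqw_nth i.+1 s1.
  rewrite !nth_slice//=; split=> //; split=> // u Iu.
  have [cu _] := H u Iu; have si : (i.+1 < size (slice u dl))%N by rewrite size_map.
  by have [] := chain_nth cu si; rewrite !nth_slice// ltnW.
- move=> u Iu; have [cu bu] := H u Iu; split=> //.
  case: dl dl0 cdl H s0 s1 sz sz' bs le cu bu => [//|d dl] _ _ _ _ _ sz _ _ _ cu _.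
  have := chain_last cu; rewrite sz /= (last_nth l0).
  by case: dl {sz cu} => [//|d' dl] /=; rewrite -/(slice u dl) size_map /=
    -[nth _ (_ :: slice u dl) _]/(nth l0 (slice u (d' :: dl)) (size dl)) nth_slice.
Qed.

(* Equivalence of words in every context; the context is required to start with
   the unit at [b] so that arrows of the word never become the initial arrow of
   the loop. *)
Definition weq x y s s' : Prop := [/\ chain x s y, chain x s' y &
  forall pre post, (0 < size pre)%N -> based pre -> chain b pre x -> chain y post b ->
    loop_equiv b (mkl (pre ++ s ++ post)) (mkl (pre ++ s' ++ post))].

Lemma weq_refl x y s : chain x s y -> weq x y s s.
Proof. by move=> c; split=> // *; exact: rst_refl. Qed.

Lemma weq_sym x y s s' : weq x y s s' -> weq x y s' s.
Proof. by case=> c c' H; split=> // *; apply: rst_sym; exact: H. Qed.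

Lemma weq_trans x y s2 s1 s3 : weq x y s1 s2 -> weq x y s2 s3 -> weq x y s1 s3.
Proof.
move=> [c1 c2 H] [_ c3 H']; split=> // pre post *.
by apply: (rst_trans _ _ _ (mkl (pre ++ s2 ++ post))); [exact: H|exact: H'].
Qed.

Lemma weq_context z x y v pre post s s' : chain z pre x -> chain y post v ->
  weq x y s s' -> weq z v (pre ++ s ++ post) (pre ++ s' ++ post).
Proof.
move=> cpre cpost [c c' H]; split.
- by apply: chain_cat cpre _; apply: chain_cat c _.
- by apply: chain_cat cpre _; apply: chain_cat c' _.
- move=> pre' post' n0 bp cp cq; rewrite -!catA !catA -!(catA (pre' ++ pre)) -!catA.
  rewrite [pre' ++ pre ++ s ++ _]catA [pre' ++ pre ++ s' ++ _]catA.
  apply: H.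
  + by rewrite size_cat addn_gt0 n0.
  + by case: pre' bp {n0 cp}.
  + exact: chain_cat cp _.
  + exact: chain_cat cpost _.
Qed.

Lemma based_cat s s' : based s -> based (s ++ s'). Proof. by case: s. Qed.

Lemma weq_step x y s s' : chain x s y -> chain x s' y ->
  (forall pre post, (0 < size pre)%N -> based pre ->
    move_const (mkl (pre ++ s ++ post)) (mkl (pre ++ s' ++ post)) \/
    move_id (mkl (pre ++ s ++ post)) (mkl (pre ++ s' ++ post))) ->
  weq x y s s'.
Proof.
move=> c c' H; split=> // pre post n0 bp cp cq; apply: rst_step.
split; first by apply: mkl_hloop; [exact: based_cat|apply: chain_cat cp _; apply: chain_cat cq].
split; first by apply: mkl_hloop; [exact: based_cat|apply: chain_cat cp _; apply: chain_cat cq].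
by have [] := H pre post n0 bp; auto.
Qed.

Lemma weq_const x y h k (a c : R -> G0 G) : chain x [:: (h, a); (k, c)] y ->
  (forall u, I01 u -> a u = a 0) ->
  weq x y [:: (h, a); (k, c)] [:: (k \* h, c)].
Proof.
move=> ch ac; have [/= hx h0 ca [kx k0 cc cy]] := ch.
have kh : dom k = cod h by rewrite kx h0 ac.
apply: weq_step => //=; first by rewrite gdom_comp// gcod_comp.
by move=> pre post n0 bp; left; exact: mkl_const.
Qed.

Lemma weq_id x y h (a c : R -> G0 G) : chain x [:: (h, a); (one (a 1), c)] y ->
  weq x y [:: (h, a); (one (a 1), c)] [:: (h, pcat a c)].
Proof.
move=> ch; have [/= hx h0 ca [kx k0 cc cy]] := ch.
have ac : a 1 = c 0 by rewrite -k0 gcod_unit.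
have p1 : pcat a c 1 = c 1.
  by rewrite /pcat ifN; [congr c; lra|rewrite -ltNge; lra].
have p0 : pcat a c 0 = a 0.
  by rewrite /pcat ifT; [rewrite mulr0|lra].
apply: weq_step => //=.
  by split=> //; [rewrite p0|exact: pcat_cont|rewrite p1].
by move=> pre post n0 bp; right; exact: mkl_id.
Qed.

Lemma weq_deform x y dl s s' : Allp dcont dl ->
  (forall u, I01 u -> chain x (slice u dl) y) ->
  peqw s (slice 0 dl) -> peqw s' (slice 1 dl) -> weq x y s s'.
Proof.
move=> cdl H s0 s1; split.
- by apply: chain_peqw (peqw_sym s0) _; exact: H.
- by apply: chain_peqw (peqw_sym s1) _; exact: H.
move=> pre post n0 bp cp cq.
apply: (@mkl_deform (map dconst pre ++ dl ++ map dconst post)).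
- by rewrite size_cat size_map addn_gt0 n0.
- apply: Allp_cat; first exact: dcont_dconst cp.
  by apply: Allp_cat => //; exact: dcont_dconst cq.
- move=> u Iu; rewrite /slice !map_cat -!/(slice _ _) !slice_dconst; split.
    by apply: chain_cat cp _; apply: chain_cat (H u Iu) cq.
  by case: (pre) n0 bp.
- rewrite /slice !map_cat -!/(slice _ _) !slice_dconst.
  by apply: peqw_cat; [exact: peqw_refl|apply: peqw_cat => //; exact: peqw_refl].
- rewrite /slice !map_cat -!/(slice _ _) !slice_dconst.
  by apply: peqw_cat; [exact: peqw_refl|apply: peqw_cat => //; exact: peqw_refl].
Qed.

Lemma weq_peqw x y s s' : chain x s y -> peqw s s' -> weq x y s s'.
Proof.
move=> cs ss'; apply: (@weq_deform _ _ (map dconst s)); rewrite ?slice_dconst //.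
- exact: dcont_dconst cs.
- by move=> u _; rewrite slice_dconst.
- exact: peqw_refl.
- exact: peqw_sym.
Qed.

End Words.

(** * Segments of paths and elementary equivalences of words *)

Definition seg (A : Type) (a : R -> A) (r t : R) : R -> A := fun u => a (r + u * (t - r)).
Definition itv (r t : R) : set R := [set v | r <= v <= t].

Lemma seg0 (A : Type) (a : R -> A) r t : seg a r t 0 = a r.
Proof. by rewrite /seg mul0r addr0. Qed.

Lemma seg1 (A : Type) (a : R -> A) r t : seg a r t 1 = a t.
Proof. by rewrite /seg mul1r addrC subrK. Qed.

Lemma seg_itv (r t u : R) : r <= t -> I01 u -> itv r t (r + u * (t - r)).
Proof. by rewrite /I01 /itv /= => rt /andP[u0 u1]; nra. Qed.

Lemma affine_cont (r t : R) (A : set R) : {within A, continuous (fun u : R => r + u * (t - r))}.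
Proof.
apply: within_addr; first exact: within_cst.
by apply: within_mulr; [exact: within_id|exact: within_cst].
Qed.

Lemma seg_cont (X : topologicalType) (a : R -> X) (r t : R) : r <= t ->
  {within itv r t, continuous a} -> {within I01, continuous (seg a r t)}.
Proof.
move=> rt ca.
apply: (@within_comp R R X I01 (itv r t) (fun u => r + u * (t - r)) a) => //.
  by move=> u; exact: seg_itv.
exact: affine_cont.
Qed.

Section WordMoves.
Variables (G : topGroupoid) (b : G0 G).
Notation weq := (weq b).

(** The straight-line homotopy from the identity to [rho] stays in the convex interval and fixes its
    ends. It is kept apart from [weq_reparam] because it is also needed for the first path of a
    loop, which no [weq] reaches. *)
Lemma reparam_deform x y (h : G1 G) (a a' : R -> G0 G) (rho : R -> R) :
  chain x [:: (h, a)] y -> {within I01, continuous rho} ->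
  (forall u, I01 u -> I01 (rho u)) -> rho 0 = 0 -> rho 1 = 1 ->
  peq a' (fun u => a (rho u)) ->
  exists d : dletter G, [/\ dcont d,
    forall u, I01 u -> chain x (slice u [:: d]) y /\ d.2 (u, 0) = a 0,
    peqw [:: (h, a)] (slice 0 [:: d]) & peqw [:: (h, a')] (slice 1 [:: d])].
Proof.
move=> [/= hx h0 ca ay] crho Irho rho0 rho1 aa.
exists (fun=> h, fun q => a ((1 - q.1) * q.2 + q.1 * rho q.2)); split.
- split=> /=; first exact: within_cst.
  apply: (@within_comp (R * R)%type R (G0 G) I01sq I01
    (fun q => (1 - q.1) * q.2 + q.1 * rho q.2) a) => //.
    move=> q [q1 /[dup] q2 /Irho]; move: q1 q2; rewrite /I01 /=.
    by move=> /andP[? ?] /andP[? ?] /andP[? ?]; nra.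
  apply: within_addr; apply: within_mulr.
  + by apply: within_subr; [exact: within_cst|exact: within_fst].
  + exact: within_snd.
  + exact: within_fst.
  + apply: (@within_comp (R * R)%type R R I01sq I01 snd rho) => //; first by move=> q [].
    exact: within_snd.
- move=> u Iu /=; rewrite rho0 !mulr0 addr0; split=> //; split=> //.
  + apply: (@within_comp R R (G0 G) I01 I01 (fun v => (1 - u) * v + u * rho v) a) => //.
      move=> v /[dup] v2 /Irho; move: Iu v2; rewrite /I01 /=.
      by move=> /andP[? ?] /andP[? ?] /andP[? ?]; nra.
    apply: within_addr; apply: within_mulr => //; try exact: within_cst.
    exact: within_id.
  + by rewrite rho1 !mulr1 subrK.
- by split=> // u Iu /=; rewrite subr0 mul1r mul0r addr0.
- by split=> // u Iu /=; rewrite subrr mul0r mul1r add0r aa.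
Qed.

Lemma weq_reparam x y (h : G1 G) (a a' : R -> G0 G) (rho : R -> R) :
  chain x [:: (h, a)] y -> {within I01, continuous rho} ->
  (forall u, I01 u -> I01 (rho u)) -> rho 0 = 0 -> rho 1 = 1 ->
  peq a' (fun u => a (rho u)) -> weq x y [:: (h, a)] [:: (h, a')].
Proof.
move=> ch crho Irho rho0 rho1 aa.
have [d [cd sd d0 d1]] := reparam_deform ch crho Irho rho0 rho1 aa.
by apply: (@weq_deform _ b x y [:: d]) => // u /sd[].
Qed.

Lemma weq_split x y (h : G1 G) (a : R -> G0 G) (r m t : R) :
  r < m -> m < t -> {within itv r t, continuous a} -> dom h = x -> cod h = a r -> a t = y ->
  weq x y [:: (h, seg a r t)] [:: (h, seg a r m); (one (a m), seg a m t)].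
Proof.
move=> rm mt ca hx h0 ay.
have ch2 : chain x [:: (h, seg a r m); (one (seg a r m 1), seg a m t)] y.
  split=> //=; rewrite ?seg0 ?seg1 //.
    by apply: seg_cont (ltW rm) (within_sub _ ca) => v; rewrite /itv /=; lra.
  rewrite gdom_unit gcod_unit; split=> //.
  by apply: seg_cont (ltW mt) (within_sub _ ca) => v; rewrite /itv /=; lra.
have tr : t - r != 0 by apply/eqP; lra.
(* The long segment passes [a m] at time [k], while [pcat] changes paths at [1 / 2]; the piecewise
   linear change of time below sends [1 / 2] to [k]. *)
pose k := (m - r) / (t - r).
have k01 : 0 <= k <= 1.
  by apply/andP; split; [apply: divr_ge0; lra|rewrite ler_pdivrMr; lra].
rewrite -(seg1 a r m).
apply: (weq_trans _ (weq_sym (weq_id b ch2))).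
apply: (@weq_reparam _ _ _ _ _ (pcat (fun u => u * k) (fun u => k + u * (1 - k)))).
- by split=> //=; rewrite ?seg0 ?seg1 //; apply: seg_cont => //; apply/ltW/(lt_trans rm mt).
- apply: pcat_cont; last by lra.
    by apply: within_mulr; [exact: within_id|exact: within_cst].
  exact: affine_cont.
- move: k01 => /andP[? ?] u; rewrite /I01 /= /pcat => /andP[? ?].
  by case: (leP u (1 / 2)) => ?; nra.
- by rewrite /pcat ifT /= ?mulr0 ?mul0r//; lra.
- rewrite /pcat ifN /=; last by rewrite -ltNge; lra.
  by rewrite (_ : 2 * 1 - 1 = 1 :> R); [rewrite mul1r addrC subrK|lra].
- move=> u Iu; rewrite /pcat /seg; case: ifP => _; congr a; rewrite /k; by field.
Qed.

(* Sliding the arrow [g v] along the path, from its beginning to its end. *)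
Lemma weq_gauge x y (h : G1 G) (a a' : R -> G0 G) (g : R -> G1 G) :
  chain x [:: (h, a)] (a 1) -> {within I01, continuous g} ->
  (forall u, I01 u -> dom (g u) = a u) -> (forall u, I01 u -> cod (g u) = a' u) ->
  a' 1 = y ->
  weq x y [:: (h, a); (g 1, fun=> a' 1)] [:: (g 0 \* h, a')].
Proof.
move=> [/= hx h0 ca _] cg dg cog ay.
have ca' : {within I01, continuous a'} by apply: within_ext (within_gcod cg).
apply: (weq_trans (s2 := [:: (h, fun=> a 0); (g 0, a')])); last first.
  apply: weq_const => //; split=> //=; first exact: within_cst.
  by split=> //=; rewrite ?dg ?cog.
apply: weq_sym.
(* At parameter [u] the word follows [a] up to time [u], crosses by [g u], and follows [a'] from
   time [u] on. *)
apply: (@weq_deform _ b x y [:: (fun=> h, fun q => a (q.1 * q.2));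
                              (g, fun q => a' (q.1 + (1 - q.1) * q.2))]).
- split; last split=> //; split=> //=; first exact: within_cst.
    apply: (@within_comp (R * R)%type R (G0 G) I01sq I01 (fun q => q.1 * q.2) a) => //.
      by move=> q [/andP[? ?] /andP[? ?]]; rewrite /I01 /=; nra.
    by apply: within_mulr; [exact: within_fst|exact: within_snd].
  apply: (@within_comp (R * R)%type R (G0 G) I01sq I01 (fun q => q.1 + (1 - q.1) * q.2) a') => //.
    by move=> q [/andP[? ?] /andP[? ?]]; rewrite /I01 /=; nra.
  apply: within_addr; first exact: within_fst.
  apply: within_mulr; last exact: within_snd.
  by apply: within_subr; [exact: within_cst|exact: within_fst].
- move=> u /[dup] Iu /andP[u0 u1]; split=> //=; first by rewrite mulr0.
    apply: (@within_comp R R (G0 G) I01 I01 (fun v => u * v) a) => //.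
      by move=> v /andP[? ?]; rewrite /I01 /=; nra.
    by apply: within_mulr; [exact: within_cst|exact: within_id].
  rewrite mulr1; split=> //; first exact: dg.
  + by rewrite mulr0 addr0; exact: cog.
  + apply: (@within_comp R R (G0 G) I01 I01 (fun v => u + (1 - u) * v) a') => //.
      by move=> v /andP[? ?]; rewrite /I01 /=; nra.
    apply: within_addr; first exact: within_cst.
    by apply: within_mulr; [exact: within_cst|exact: within_id].
  + by rewrite -ay; congr a'; lra.
- split=> [//|u _ /=|]; first by rewrite mul0r.
  by split=> // u _ /=; rewrite subr0 mul1r add0r.
- split=> [//|u _ /=|]; first by rewrite mul1r.
  by split=> // u _ /=; rewrite subrr mul0r addr0.
Qed.

(** * Lifts of a path and the words they spell *)

Section Reading.
Variables (E T : topologicalType) (X : set T).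
Variables (p : E -> G0 G) (w : E -> T) (act : G1 G -> E -> E).
Hypothesis pb : principal_bundle X p w act.
Variables (c : R -> T) (e1 : E).
Hypothesis we1 : w e1 = c 1.
Notation dv := (dv pb).

(* A list of lifts of [c] over consecutive intervals, each given with the right
   end of its interval. *)
Implicit Types r : seq ((R -> E) * R).

Definition lifts (s : R -> E) (u v : R) := {within itv u v, continuous s} /\
  (forall x, itv u v x -> w (s x) = c x).

Fixpoint rvalid (u : R) r : Prop :=
  if r is (s, v) :: r' then [/\ u < v, lifts s u v & rvalid v r'] else u = 1.

(** The first arrow compares the first lift with the given point [e], and a last letter with a
    constant path compares the last lift with [e1]. Thus the lifts themselves need not pass through
    these points. *)
Fixpoint rword (u : R) (e : E) r : seq (letter G) :=
  if r is (s, v) :: r' then (dv (s u) e, seg (fun x => p (s x)) u v) :: rword v (s v) r'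
  else [:: (dv e1 e, fun=> p e1)].

Lemma itv_l (u v : R) : u <= v -> itv u v u. Proof. by rewrite /itv /=; lra. Qed.
Lemma itv_r (u v : R) : u <= v -> itv u v v. Proof. by rewrite /itv /=; lra. Qed.

Lemma lifts_p s u v : u < v -> lifts s u v ->
  {within I01, continuous (seg (fun x => p (s x)) u v)}.
Proof. by move=> uv [cs _]; apply: seg_cont (ltW uv) _; exact: (within_p pb). Qed.

Lemma rword_chain u e r : rvalid u r -> w e = c u -> chain (p e) (rword u e r) (p e1).
Proof.
elim: r u e => [u e /= -> we|[s v] r IH u e /= [uv ls rv] we].
  have ee : w e1 = w e by rewrite we1.
  by split=> //; [exact: dv_dom|exact: dv_cod|exact: within_cst].
have wu : w (s u) = w e by rewrite ls.2 ?we//; apply: itv_l; exact: ltW.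
split; [exact: dv_dom|by rewrite seg0; exact: dv_cod|exact: lifts_p|].
by rewrite seg1; apply: IH => //; apply: ls.2; apply: itv_r; exact: ltW.
Qed.

Lemma rvalid_le u r : rvalid u r -> u <= 1.
Proof.
by elim: r u => [u /= -> //|[s v] r IH u /= [uv _ /IH]]; apply: le_trans; exact: ltW.
Qed.

(** The starting point [e] enters only the first arrow of the word, so this is all that a change of
    the preceding lift can affect. *)
Lemma rword_head u r : rvalid u r -> exists (x : E) (a : R -> G0 G) (rest : seq (letter G)),
  [/\ w x = c u, a 0 = p x, {within I01, continuous a}, chain (a 1) rest (p e1) &
      forall e, rword u e r = (dv x e, a) :: rest].
Proof.
case: r => [/= u1|[s v] r /= [uv ls rv]].
  by exists e1, (fun=> p e1), [::]; split=> //; [rewrite we1 u1|exact: within_cst].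
exists (s u), (seg (fun x => p (s x)) u v), (rword v (s v) r); split=> //.
- by apply: ls.2; apply: itv_l; exact: ltW.
- by rewrite seg0.
- exact: lifts_p.
- rewrite seg1; apply: rword_chain => //.
  by apply: ls.2; apply: itv_r; exact: ltW.
Qed.

(** The lifts differ by the arrows [g = dv s' s]. The arrow after this piece factors through [g] at
    time 1; inserting a constant path splits this factor off, and sliding it back along the path
    multiplies the first arrow by [g 0], which turns [dv (s u) e] into [dv (s' u) e]. *)
Lemma rword_gauge u v e s s' r : u < v -> lifts s u v -> lifts s' u v -> rvalid v r ->
  w e = c u ->
  weq (p e) (p e1) (rword u e ((s, v) :: r)) (rword u e ((s', v) :: r)).
Proof.
move=> uv ls ls' rv we.
have [x [a [rest [wx a0 ca crest rE]]]] := rword_head rv.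
rewrite /= !rE.
have Iu := itv_l (ltW uv); have Iv := itv_r (ltW uv).
have wsu : w (s u) = c u by exact: ls.2.
have wsu' : w (s' u) = c u by exact: ls'.2.
have wsv : w (s v) = c v by exact: ls.2.
have wsv' : w (s' v) = c v by exact: ls'.2.
pose g := seg (fun y => dv (s' y) (s y)) u v.
have cg : {within I01, continuous g}.
  apply: seg_cont (ltW uv) _; apply: (@within_dv _ _ _ _ _ _ _ pb R (itv u v) s' s); [|exact: ls'.1|exact: ls.1].
  by move=> y Iy; rewrite ls.2// ls'.2.
have ww y : itv u v y -> w (s' y) = w (s y) by move=> Iy; rewrite ls.2// ls'.2.
set P := (dv (s u) e, seg (fun y => p (s y)) u v).
have cP : chain (p e) [:: P] (p (s v)).
  split=> /=; [by rewrite dv_dom// wsu we|by rewrite seg0 dv_cod// wsu we|exact: lifts_p|].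
  by rewrite seg1.
have P0 : chain (p e) [:: P] (P.2 1) by rewrite /= in cP *; case: cP.
have g0 : g 0 = dv (s' u) (s u) by rewrite /g seg0.
have g1 : g 1 = dv (s' v) (s v) by rewrite /g seg1.
have gP : weq (p e) (p (s' v)) [:: P; (g 1, fun=> p (s' v))]
                       [:: (dv (s' u) e, seg (fun y => p (s' y)) u v)].
  have -> : dv (s' u) e = g 0 \* dv (s u) e by rewrite g0 dv_comp// ?wsu'// wsu.
  rewrite -{1 2}(seg1 (fun y => p (s' y)) u v).
  apply: weq_gauge => //.
  - by move=> y Iy; rewrite /g /seg dv_dom//; apply: ww; apply: seg_itv => //; exact: ltW.
  - by move=> y Iy; rewrite /g /seg dv_cod//; apply: ww; apply: seg_itv => //; exact: ltW.
apply: (weq_trans (s2 := [:: P, (g 1, fun=> p (s' v)), (dv x (s' v), a) & rest])).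
  apply: weq_sym.
  have -> : dv x (s v) = dv x (s' v) \* g 1 by rewrite g1 dv_comp// ?wsv'.
  apply: (@weq_context _ b (p e) (p (s v)) (a 1) (p e1) [:: P] rest
     [:: (g 1, fun=> p (s' v)); (dv x (s' v), a)] [:: (dv x (s' v) \* g 1, a)]) => //.
  apply: weq_const => //; split=> //=.
  + by rewrite g1 dv_dom// ww.
  + by rewrite g1 dv_cod// ww.
  + exact: within_cst.
  by split=> //; rewrite ?a0 ?dv_dom ?dv_cod// wx wsv'.
apply: (@weq_context _ b (p e) (p e) (p (s' v)) (p e1) [::] ((dv x (s' v), a) :: rest)
  [:: P; (g 1, fun=> p (s' v))] [:: (dv (s' u) e, seg (fun y => p (s' y)) u v)]) => //.
by split=> //=; rewrite ?a0 ?dv_dom ?dv_cod// wx wsv'.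
Qed.

Lemma lifts_sub s u v u' v' : u <= u' -> v' <= v -> lifts s u v -> lifts s u' v'.
Proof.
move=> uu vv [cs ws]; have sub : itv u' v' `<=` itv u v by move=> y; rewrite /itv /=; lra.
by split=> [|y /sub/ws//]; exact: within_sub cs.
Qed.

Lemma rword_split u m v e s r : u < m -> m < v -> lifts s u v -> rvalid v r -> w e = c u ->
  weq (p e) (p e1) (rword u e ((s, v) :: r)) (rword u e ((s, m) :: (s, v) :: r)).
Proof.
move=> um mv ls rv we; rewrite /= dv_id.
have uv := lt_trans um mv.
apply: (@weq_context _ b (p e) (p e) (p (s v)) (p e1) [::] (rword v (s v) r)
  [:: (dv (s u) e, seg (fun y => p (s y)) u v)]
  [:: (dv (s u) e, seg (fun y => p (s y)) u m);
      (one (p (s m)), seg (fun y => p (s y)) m v)]) => //.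
  by apply: rword_chain => //; apply: ls.2; apply: itv_r; exact: ltW.
have wu : w (s u) = w e by rewrite ls.2 ?we//; apply: itv_l; exact: ltW.
apply: (@weq_split _ _ _ (fun y => p (s y)) u m v um mv) => //; [exact: (within_p pb ls.1)|exact: dv_dom|exact: dv_cod].
Qed.

Lemma weq_cons (x y : G0 G) (a : letter G) s s' : chain x [:: a] (a.2 1) ->
  weq (a.2 1) y s s' -> weq x y (a :: s) (a :: s').
Proof.
move=> ca H; have := @weq_context _ b x (a.2 1) y y [:: a] [::] s s' ca erefl H.
by rewrite !cats0.
Qed.

Lemma rword_cons u v e s r r' : u < v -> lifts s u v -> w e = c u ->
  weq (p (s v)) (p e1) (rword v (s v) r) (rword v (s v) r') ->
  weq (p e) (p e1) (rword u e ((s, v) :: r)) (rword u e ((s, v) :: r')).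
Proof.
move=> uv ls we H; apply: weq_cons => /=; last by rewrite seg1.
have wu : w (s u) = w e by rewrite ls.2 ?we//; apply: itv_l; exact: ltW.
by split=> //; [exact: dv_dom|rewrite seg0; exact: dv_cod|exact: lifts_p].
Qed.

(** Common refinement by induction on the total number of pieces: the longer first piece is cut
    where the shorter one ends, one lift is replaced by the other there, and the remaining lists
    have fewer pieces in total. *)
Lemma rword_uniq u e r r' : rvalid u r -> rvalid u r' -> w e = c u ->
  weq (p e) (p e1) (rword u e r) (rword u e r').
Proof.
have [n] := ubnP (size r + size r').
elim: n u e r r' => // n IH u e r r'; case: r => [|[s v] r]; case: r' => [|[s' v'] r'].
- by move=> _ ru _ we; apply: weq_refl; exact: rword_chain.
- by move=> _ /= -> [v1 _ /rvalid_le /(lt_le_trans v1)]; rewrite ltxx.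
- by move=> _ /= [v1 _ /rvalid_le /(lt_le_trans v1)] => + u1; rewrite u1 ltxx.
move=> sz [uv ls rv] [uv' ls' rv'] we.
have [vv|vv|vv] := ltgtP v v'.
- have lsv : lifts s' u v by apply: lifts_sub ls' => //; exact: ltW.
  have lsv' : lifts s' v v' by apply: lifts_sub ls' => //; exact: ltW.
  apply: (weq_trans (rword_gauge uv ls lsv rv we)).
  apply: (weq_trans _ (weq_sym (rword_split uv vv ls' rv' we))).
  apply: rword_cons => //; apply: IH => //.
  by apply: lsv.2; apply: itv_r; exact: ltW.
- have lsv : lifts s u v' by apply: lifts_sub ls => //; exact: ltW.
  have lsv' : lifts s v' v by apply: lifts_sub ls => //; exact: ltW.
  apply: (weq_trans (rword_split uv' vv ls rv we)).
  have rv2 : rvalid v' ((s, v) :: r) by [].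
  apply: (weq_trans (rword_gauge uv' lsv ls' rv2 we)).
  apply: rword_cons => //; apply: IH => //.
  + by move: sz; rewrite /= !addSn !addnS ltnS.
  + by apply: ls'.2; apply: itv_r; exact: ltW.
- subst v'; apply: (weq_trans (rword_gauge uv ls ls' rv we)).
  apply: rword_cons => //; apply: IH => //.
  + by move: sz; rewrite /= !addSn !addnS ltnS; exact: ltnW.
  + by apply: ls'.2; apply: itv_r; exact: ltW.
Qed.

End Reading.
End WordMoves.

(** * Readings over the square *)

(** Agreement on the meaningful indices and on [I01] gives a deformation constant in its
    parameter. *)
Lemma hloop_ext (G : topGroupoid) (b : G0 G) (l l' : hloop G) : is_hloop b l ->
  hl_n l' = hl_n l -> (forall i, (i <= hl_n l)%N -> peq (hl_sig l' i) (hl_sig l i)) ->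
  (forall i, (0 < i <= hl_n l)%N -> hl_h l' i = hl_h l i) ->
  is_hloop b l' /\ loop_equiv b l l'.
Proof.
move=> Hl; have [cl [lb [le lh]]] := Hl => nn sig hh.
have Hl' : is_hloop b l'.
  split; first by move=> i; rewrite nn => ni; apply: within_ext (cl i ni) => u Iu; rewrite sig.
  split; first by rewrite sig.
  split; first by rewrite nn sig.
  move=> i; rewrite nn => ni; rewrite hh//; have [d1 c1] := lh i ni.
  have /andP[i0 ni'] := ni.
  by rewrite !sig//; apply: leq_trans ni'; exact: leq_pred.
split=> //; apply: rst_step; split=> //; split=> //; right; right; split=> //.
exists (fun i q => hl_sig l i q.2), (fun i _ => hl_h l i); split; last split => //=.
- move=> i ni; split; last by move=> v Iv; rewrite sig.
  apply: (@within_comp (R * R)%type R (G0 G) I01sq I01 snd (hl_sig l i)) => //.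
  + by move=> q [].
  + exact: within_snd.
  + exact: cl.
- by move=> i ni; split; [exact: within_cst|rewrite hh//; split=> //; split=> // u _; apply: lh].
Qed.

Section Ends.
Variables (G : topGroupoid) (b : G0 G).
Notation weq := (weq b).

Lemma weq_loop s s' : weq b b s s' -> loop_equiv b (mkl b (l0 b :: s)) (mkl b (l0 b :: s')).
Proof.
by move=> [_ _ /(_ [:: l0 b] [::])]; rewrite /= !cats0; apply=> //; split=> //=;
  rewrite ?gdom_unit ?gcod_unit//; exact: within_cst.
Qed.

(** The last path of a loop may not be removed even if it is constant. It is concatenated with its
    predecessor across the unit arrow, and the resulting pause is undone by reparametrization. *)
Lemma weq_rcons_l0 x s a : chain x (rcons s a) b -> weq x b (rcons s a ++ [:: l0 b]) (rcons s a).
Proof.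
case: a => h a; rewrite -cats1 => /chain_catE[y cs ca]; have [/= ay c0 cca a1] := ca.
have ch2 : chain y [:: (h, a); (one (a 1), fun=> b)] b.
  split=> //=; rewrite gdom_unit gcod_unit; split=> //; exact: within_cst.
rewrite -catA; have := @weq_context _ b x y b b s [::]
  [:: (h, a); (one (a 1), fun=> b)] [:: (h, a)] cs erefl.
rewrite !cats0 /l0 (_ : one b = one (a 1)); last by rewrite a1.
apply.
apply: (weq_trans (weq_id b ch2)); apply: weq_sym.
apply: (@weq_reparam _ _ _ _ _ _ _ (pcat id (fun=> 1))) => //.
- by apply: pcat_cont => //; [exact: within_id|exact: within_cst].
- by move=> u; rewrite /pcat /I01 /= => /andP[? ?]; case: (leP u (1 / 2)) => ?; lra.
- by rewrite /pcat ifT ?mulr0//; lra.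
- by rewrite /pcat ifN// -ltNge; lra.
- by move=> u Iu; rewrite /pcat; case: ifP; rewrite // a1.
Qed.

(** The counterpart at the beginning of a loop. There is no room for a prefix, so the deformation is
    made on the loop itself; [a.1] must be a unit because it becomes a genuine arrow behind [l0]. *)
Lemma loop_cons_l0 a s : a.1 = one b -> chain b (a :: s) b ->
  loop_equiv b (mkl b (l0 b :: a :: s)) (mkl b (a :: s)).
Proof.
move=> a1 ca; have [ab c0 cca cs] := ca.
have a0 : a.2 0 = b by rewrite -c0 a1 gcod_unit.
have bl : is_hloop b (mkl b (l0 b :: a :: s)).
  by apply: mkl_hloop => //=; split=> //; rewrite ?gdom_unit ?gcod_unit//; exact: within_cst.
have chp : chain b [:: (one b, a.2)] (a.2 1).
  by split=> //=; rewrite ?gdom_unit ?gcod_unit ?a0.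
have [|||||d [cd sd d0 d1]] := @reparam_deform G b (a.2 1) (one b) a.2 (pcat (fun=> b) a.2)
    (pcat (fun=> 0) id) chp.
- by apply: pcat_cont => //; [exact: within_cst|exact: within_id].
- by move=> u; rewrite /pcat /I01 /= => /andP[? ?]; case: (leP u (1 / 2)) => ?; lra.
- by rewrite /pcat ifT//; lra.
- by rewrite /pcat ifN; [lra|rewrite -ltNge; lra].
- by move=> u Iu; rewrite /pcat; case: ifP; rewrite // a0.
have sl u : slice u (d :: map (@dconst G) s) = slice u [:: d] ++ s.
  by rewrite -{2}(slice_dconst u s).
have eq2 : loop_equiv b (mkl b (a :: s)) (mkl b ((one b, pcat (fun=> b) a.2) :: s)).
  apply: (@mkl_deform _ b (d :: map (@dconst G) s)) => //.
  - by split=> //; exact: dcont_dconst cs.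
  - by move=> u Iu; have [cu du] := sd u Iu; rewrite sl; split; [exact: chain_cat cu cs|rewrite /= du].
  - rewrite sl; have := peqw_cat d0 (peqw_refl s).
    by case: (a) a1 => h a' /= ->.
  - by rewrite sl; exact: (peqw_cat d1 (peqw_refl s)).
apply: (rst_trans _ _ _ (mkl b ((one b, pcat (fun=> b) a.2) :: s))); last exact: rst_sym.
have ch3 : chain b ((one b, pcat (fun=> b) a.2) :: s) b.
  split=> //=.
  - by rewrite gdom_unit.
  - by rewrite gcod_unit /pcat ifT//; lra.
  - by apply: pcat_cont => //; exact: within_cst.
  - by rewrite /pcat ifN; [rewrite (_ : 2 * 1 - 1 = 1 :> R)//; lra|rewrite -ltNge; lra].
apply: rst_step; split=> //; split.
  by apply: mkl_hloop => //=; rewrite /pcat ifT//; lra.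
by right; left; apply: (@mkl_id _ b [::] (l0 b) a s) => /=.
Qed.

End Ends.

Section SquareWords.
Variables (G : topGroupoid) (b : G0 G) (E : topologicalType).
Variables (p : E -> G0 G) (w : E -> R * R) (act : G1 G -> E -> E).
Hypothesis Get : etale G.
Hypothesis pb : principal_bundle I01sq p w act.
Variables (s0 s1 : R -> E).
Hypothesis cs0 : {within I01, continuous s0}.
Hypothesis cs1 : {within I01, continuous s1}.
Hypothesis sb : forall t, I01 t -> w (s0 t) = (0, t) /\ w (s1 t) = (1, t) /\ p (s0 t) = b /\ p (s1 t) = b.

Notation hor t := (fun x : R => (x, t)).
Definition rect (u v : R) (J : set R) : set (R * R) := [set q | itv u v q.1 /\ J q.2].
Implicit Types (rho : seq ((R * R -> E) * R)) (J : set R) (tau : R -> R).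

Fixpoint rhovalid J (u : R) rho : Prop :=
  if rho is (s, v) :: rho' then
    [/\ u < v, {within rect u v J, continuous s}, forall q, rect u v J q -> w (s q) = q &
        rhovalid J v rho']
  else u = 1.

Definition level (t : R) rho : seq ((R -> E) * R) :=
  [seq (fun x => s.1 (x, t), s.2) | s <- rho].

Lemma level_valid J u rho t : rhovalid J u rho -> J t -> rvalid w (hor t) u (level t rho).
Proof.
move=> + Jt; elim: rho u => //= -[s v] rho IH u [uv cs ws /IH rv]; split=> //; split.
  apply: (@within_comp R (R * R)%type E (itv u v) (rect u v J) (hor t) s) => //.
  by apply: within_pair; [exact: within_id|exact: within_cst].
by move=> x Ix; exact: ws.
Qed.

(** The word read at height [tau y], with [y] as deformation parameter. In a strip of the grid the
    sections are fixed, so the letters vary continuously and their number stays the same. *)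
Fixpoint rdelta tau (u : R) (e : R -> E) rho : seq (dletter G) :=
  if rho is (s, v) :: rho' then
    (fun y => dv pb (s (u, tau y)) (e y), fun q => p (s (u + q.2 * (v - u), tau q.1)))
      :: rdelta tau v (fun y => s (v, tau y)) rho'
  else [:: (fun y => dv pb (s1 (tau y)) (e y), fun q => p (s1 (tau q.1)))].

Lemma slice_rdelta tau u e rho y :
  slice y (rdelta tau u e rho) = rword pb (s1 (tau y)) u (e y) (level (tau y) rho).
Proof. by elim: rho u e => //= -[s v] rho IH u e /=; rewrite IH. Qed.

Lemma rdelta_cont J tau u e rho : rhovalid J u rho -> J `<=` I01 ->
  {within I01, continuous tau} -> (forall y, I01 y -> J (tau y)) ->
  {within I01, continuous e} -> (forall y, I01 y -> w (e y) = (u, tau y)) ->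
  Allp (@dcont G) (rdelta tau u e rho).
Proof.
move=> + JI ct tJ; elim: rho u e => [|[s v] rho IH] u e /=.
  move=> u1 ce we; split=> //; split=> /=.
    apply: (@within_dv _ _ _ _ _ _ _ pb R I01 (fun y => s1 (tau y)) e) => //.
      by move=> y Iy; rewrite we// u1; have [_ [->]] := sb (JI _ (tJ _ Iy)).
    by apply: (@within_comp R R E I01 I01 tau s1) => // y /tJ/JI.
  apply: (@within_p _ _ _ _ _ _ _ pb (R * R)%type I01sq (fun q => s1 (tau q.1))).
  apply: (@within_comp (R * R)%type R E I01sq I01 (fun q => tau q.1) s1) => //.
    by move=> q [/tJ/JI].
  apply: (@within_comp (R * R)%type R R I01sq I01 fst tau) => //; first by move=> q [].
  exact: within_fst.
move=> [uv cs ws rv] ce we.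
have cl x : itv u v x -> {within I01, continuous (fun y => s (x, tau y))}.
  move=> Ix; apply: (@within_comp R (R * R)%type E I01 (rect u v J) (fun y => (x, tau y)) s) => //.
    by move=> y /tJ.
  by apply: within_pair => //; exact: within_cst.
have Iu := itv_l (ltW uv); have Iv := itv_r (ltW uv).
split; last first.
  apply: IH => //; first exact: cl.
  by move=> y /tJ Jy; apply: ws.
split=> /=.
  apply: (@within_dv _ _ _ _ _ _ _ pb R I01 (fun y => s (u, tau y)) e) => //; last exact: cl.
  by move=> y Iy; rewrite we// ws//; split=> //=; exact: tJ.
apply: (@within_p _ _ _ _ _ _ _ pb (R * R)%type I01sq
  (fun q => s (u + q.2 * (v - u), tau q.1))).
apply: (@within_comp (R * R)%type (R * R)%type E I01sq (rect u v J)
  (fun q => (u + q.2 * (v - u), tau q.1)) s) => //.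
  by move=> q [/tJ Jq Iq]; split=> //=; apply: seg_itv => //; exact: ltW.
apply: within_pair.
  apply: within_addr; first exact: within_cst.
  by apply: within_mulr; [exact: within_snd|exact: within_cst].
apply: (@within_comp (R * R)%type R R I01sq I01 fst tau) => //; first by move=> q [].
exact: within_fst.
Qed.

Lemma level_weq J rho t t' : rhovalid J 0 rho -> J `<=` I01 ->
  (forall y, I01 y -> J (t + y * (t' - t))) ->
  weq b b b (rword pb (s1 t) 0 (s0 t) (level t rho)) (rword pb (s1 t') 0 (s0 t') (level t' rho)).
Proof.
move=> rv JI tJ; pose tau y := t + y * (t' - t).
have ctau : {within I01, continuous tau} by exact: affine_cont.
have Itau y : I01 y -> I01 (tau y) by move=> /tJ/JI.
have t0 : tau 0 = t by rewrite /tau mul0r addr0.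
have t1 : tau 1 = t' by rewrite /tau mul1r addrC subrK.
apply: (@weq_deform _ b b b (rdelta tau 0 (fun y => s0 (tau y)) rho)).
- apply: (rdelta_cont rv) => //.
    by apply: (@within_comp R R E I01 I01 tau s0).
  by move=> y /Itau/sb[].
- move=> y Iy; rewrite slice_rdelta.
  have [w0 [w1 [p0 p1]]] := sb (Itau _ Iy).
  have := @rword_chain _ _ _ _ _ _ _ pb (hor (tau y)) (s1 (tau y)) w1 0 (s0 (tau y))
    (level (tau y) rho).
  by rewrite p0 p1; apply=> //; apply: level_valid rv _; exact: tJ.
- by rewrite slice_rdelta t0; exact: peqw_refl.
- by rewrite slice_rdelta t1; exact: peqw_refl.
Qed.

(** Raising the height within a strip of the grid is a deformation. On the line shared by two
    strips, both families of sections lift the same horizontal path, and [rword_uniq] passes from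
    one to the other, as it does from [r0] and to [r1]. *)
Lemma square_words r0 r1 : rvalid w (hor 0) 0 r0 -> rvalid w (hor 1) 0 r1 ->
  weq b b b (rword pb (s1 0) 0 (s0 0) r0) (rword pb (s1 1) 0 (s0 1) r1).
Proof.
move=> rv0 rv1.
pose Q (V : set (R * R)) := exists s : R * R -> E, {within V `&` I01sq, continuous s} /\
  forall q, V q -> I01sq q -> w (s q) = q.
have HQ q : I01sq q -> exists V, [/\ open V, V q & Q V].
  move=> /(pb_surj pb)[e we]; have [V [s [oV Ve _ cs ws]]] := etale_section Get pb e.
  by exists V; split=> //; [rewrite -we|exists s].
have [N [N0 HN]] := lebesgue_grid2 HQ.
have NR : 0 < N%:R :> R by rewrite ltr0n.
pose J j : set R := [set y | j%:R / N%:R <= y <= j.+1%:R / N%:R].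
have frac k : (k <= N)%N -> I01 (k%:R / N%:R).
  by move=> kN; rewrite /I01 /= divr_ge0//= ler_pdivrMr// mul1r ler_nat.
have [sq sqP] : exists sq : nat * nat -> R * R -> E, forall ij, (ij.1 < N)%N -> (ij.2 < N)%N ->
    {within rect (ij.1%:R / N%:R) (ij.1.+1%:R / N%:R) (J ij.2), continuous (sq ij)} /\
    forall q, rect (ij.1%:R / N%:R) (ij.1.+1%:R / N%:R) (J ij.2) q -> w (sq ij q) = q.
  suff /choice[sq sqP] : forall ij : nat * nat, exists s : R * R -> E,
      (ij.1 < N)%N -> (ij.2 < N)%N ->
      {within rect (ij.1%:R / N%:R) (ij.1.+1%:R / N%:R) (J ij.2), continuous s} /\
      forall q, rect (ij.1%:R / N%:R) (ij.1.+1%:R / N%:R) (J ij.2) q -> w (s q) = q.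
    by exists sq.
  move=> [i j] /=; have [iN|] := boolP (i < N)%N; last by exists (fun=> s0 0).
  have [jN|] := boolP (j < N)%N; last by exists (fun=> s0 0).
  have [V [[s [cs ws]] HV]] := HN i j iN jN; exists s => _ _.
  have sub : rect (i%:R / N%:R) (i.+1%:R / N%:R) (J j) `<=` V `&` I01sq.
    move=> q [q1 q2]; split; first exact: HV.
    have := frac _ (ltnW iN); have := frac _ iN; have := frac _ (ltnW jN); have := frac _ jN.
    move: q1 q2; rewrite /I01sq /itv /I01 /J /=.
    by move=> /andP[? ?] /andP[? ?] /andP[? ?] /andP[? ?] /andP[? ?] /andP[? ?]; split; lra.
  split; first exact: within_sub cs.
  by move=> q /sub[]; exact: ws.
pose rho j : seq ((R * R -> E) * R) := [seq (sq (i, j), i.+1%:R / N%:R) | i <- iota 0 N].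
have rho_valid j : (j < N)%N -> rhovalid (J j) 0 (rho j).
  move=> jN; suff H m k : (k + m)%N = N ->
      rhovalid (J j) (k%:R / N%:R) [seq (sq (i, j), i.+1%:R / N%:R) | i <- iota k m].
    by have := H N 0%N (add0n N); rewrite mul0r.
  elim: m k => [|m IH] k /=.
    by rewrite addn0 => ->; rewrite divff// gt_eqF.
  move=> km; have kN : (k < N)%N by rewrite -km -addSnnS leq_addr.
  have [cs ws] := sqP (k, j) kN jN.
  split=> //; first by rewrite ltr_pM2r ?invr_gt0// ltr_nat.
  by apply: IH; rewrite addSnnS.
have JI j : (j < N)%N -> J j `<=` I01.
  move=> jN y; have := frac _ (ltnW jN); have := frac _ jN.
  by rewrite /J /I01 /= => /andP[? ?] /andP[? ?] /andP[? ?]; lra.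
have jlt j : j%:R / N%:R <= j.+1%:R / N%:R :> R by rewrite ler_pM2r ?invr_gt0// ler_nat.
have uniq t r r' : I01 t -> rvalid w (hor t) 0 r -> rvalid w (hor t) 0 r' ->
    weq b b b (rword pb (s1 t) 0 (s0 t) r) (rword pb (s1 t) 0 (s0 t) r').
  move=> It rv rv'; have [w0 [w1 [p0 p1]]] := sb It.
  have := @rword_uniq _ b _ _ _ _ _ _ pb (hor t) (s1 t) w1 0 (s0 t) r r' rv rv' w0.
  by rewrite p0 p1.
have lv0 j : (j < N)%N -> rvalid w (hor (j%:R / N%:R)) 0 (level (j%:R / N%:R) (rho j)).
  by move=> jN; apply: level_valid (rho_valid j jN) _; rewrite /J /= lexx jlt.
have lv1 j : (j < N)%N -> rvalid w (hor (j.+1%:R / N%:R)) 0 (level (j.+1%:R / N%:R) (rho j)).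
  by move=> jN; apply: level_valid (rho_valid j jN) _; rewrite /J /= lexx jlt.
have main j : (j < N)%N -> weq b b b (rword pb (s1 0) 0 (s0 0) r0)
    (rword pb (s1 (j.+1%:R / N%:R)) 0 (s0 (j.+1%:R / N%:R)) (level (j.+1%:R / N%:R) (rho j))).
  elim: j => [|j IH] jN.
    apply: (weq_trans (s2 := rword pb (s1 0) 0 (s0 0) (level 0 (rho 0%N)))).
      apply: uniq => //; have := lv0 0%N jN; by rewrite mul0r.
    apply: (level_weq (rho_valid 0%N jN) (JI _ jN)) => y Iy.
    have := seg_itv (jlt 0%N) Iy; by rewrite /J /itv /= mul0r.
  apply: (weq_trans (IH (ltnW jN))).
  apply: (weq_trans (uniq _ _ _ _ (lv1 _ (ltnW jN)) (lv0 _ jN))); first exact: frac _ (ltnW jN).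
  by apply: (level_weq (rho_valid _ jN) (JI _ jN)) => y Iy; exact: seg_itv.
have NN : N%:R / N%:R = 1 :> R by rewrite divff// gt_eqF.
have Np : (N.-1 < N)%N by rewrite prednK.
have := main N.-1 Np; have := lv1 N.-1 Np; rewrite prednK// NN => rv.
by move=> /weq_trans; apply; apply: uniq.
Qed.

End SquareWords.

(** * Loops read by a bundle *)

Section RwordMap.
Variables (G : topGroupoid) (E T E' T' : topologicalType) (X : set T) (X' : set T').
Variables (p : E -> G0 G) (w : E -> T) (act : G1 G -> E -> E).
Variables (p' : E' -> G0 G) (w' : E' -> T') (act' : G1 G -> E' -> E').
Hypothesis pb : principal_bundle X p w act.
Hypothesis pb' : principal_bundle X' p' w' act'.
Variables (phi : E -> E') (k : T -> T').
Hypothesis phi_cont : continuous phi.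
Hypothesis phi_w : forall e, w' (phi e) = k (w e).
Hypothesis phi_p : forall e, p' (phi e) = p e.
Hypothesis phi_act : forall h e, @gdom G h = p e -> phi (act h e) = act' h (phi e).

Lemma dv_map e e' : w e' = w e -> dv pb' (phi e') (phi e) = dv pb e' e.
Proof. by move=> we; apply: dv_eq; rewrite ?phi_p ?dv_dom// -phi_act ?dv_dom// dv_act. Qed.

Definition rmap (r : seq ((R -> E) * R)) : seq ((R -> E') * R) :=
  [seq (fun x => phi (s.1 x), s.2) | s <- r].

Lemma rvalid_map (c : R -> T) u r :
  rvalid w c u r -> rvalid w' (fun x => k (c x)) u (rmap r).
Proof.
elim: r u => //= -[s v] r IH u [uv [cs ws] /IH rv]; split=> //; split.
  exact: within_compT cs phi_cont.
by move=> x /ws wx; rewrite phi_w wx.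
Qed.

Lemma rword_map (c : R -> T) e1 u e r : w e1 = c 1 -> rvalid w c u r -> w e = c u ->
  rword pb' (phi e1) u (phi e) (rmap r) = rword pb e1 u e r.
Proof.
move=> we1; elim: r u e => [|[s v] r IH] u e /=.
  by move=> u1 we; rewrite dv_map ?we1 ?we ?u1// phi_p.
move=> [uv [cs ws] rv] we; rewrite dv_map; last by rewrite ws ?we//; exact/itv_l/ltW.
congr cons; first by congr pair; apply: funext => x; rewrite /seg phi_p.
by apply: IH => //; apply: ws; exact/itv_r/ltW.
Qed.

End RwordMap.

Section Reads.
Variables (G : topGroupoid) (b : G0 G).

(** The strict form of a reading: the extreme lifts pass through the marked points, so no arrows
    arise there. The pieces are numbered from 0 to [hl_n l], hence [t] runs up to index
    [(hl_n l).+1]. *)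
Definition reads (B : mbundle b) (l : hloop G) (t : nat -> R) (S : nat -> R -> mb_E B) : Prop :=
  [/\ t 0%N = 0, t (hl_n l).+1 = 1, (forall i, (i <= hl_n l)%N -> t i < t i.+1),
      (forall i, (i <= hl_n l)%N ->
        [/\ {within itv (t i) (t i.+1), continuous (S i)},
            forall x, itv (t i) (t i.+1) x -> @mb_w _ _ B (S i x) = x &
            peq (hl_sig l i) (seg (fun x => @mb_p _ _ B (S i x)) (t i) (t i.+1))]) &
      [/\ S 0%N 0 = @mb_s0 _ _ B, S (hl_n l) 1 = @mb_s1 _ _ B &
          forall i, (i < hl_n l)%N ->
            @mb_act _ _ B (hl_h l i.+1) (S i (t i.+1)) = S i.+1 (t i.+1)]].

(** With the extreme lifts at the marked points, the word of the lifts is the loop preceded by a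
    unit arrow and followed by a trivial letter; the letter [l0] in front and the one behind are
    both absorbed. *)
Lemma reads_word (B : mbundle b) l t S : is_hloop b l -> @reads B l t S ->
  exists r, rvalid (@mb_w _ _ B) id 0 r /\
    loop_equiv b l (mkl b (l0 b :: rword (@mb_bundle _ _ B) (@mb_s1 _ _ B) 0 (@mb_s0 _ _ B) r)).
Proof.
move=> Hl [t0 t1 tlt lift [S0 S1 Sh]]; set pb := @mb_bundle _ _ B.
have [cl [lb [le lh]]] := Hl.
set n := hl_n l in t1 tlt lift S1 Sh cl le lh.
pose W k m := [seq (hl_h l i, hl_sig l i) | i <- iota k m].
pose r k m : seq ((R -> mb_E B) * R) := [seq (S i, t i.+1) | i <- iota k m].
have pS i : (i <= n)%N -> @mb_p _ _ B (S i (t i.+1)) = hl_sig l i 1.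
  by move=> ni; have [_ _ ->//] := lift i ni; rewrite seg1.
have wr i : (i <= n)%N -> @mb_w _ _ B (S i (t i.+1)) = t i.+1.
  by move=> ni; have [_ -> //] := lift i ni; exact/itv_r/ltW/tlt.
have wl i : (i <= n)%N -> @mb_w _ _ B (S i (t i)) = t i.
  by move=> ni; have [_ -> //] := lift i ni; exact/itv_l/ltW/tlt.
have valid m k : (k + m)%N = n.+1 -> rvalid (@mb_w _ _ B) id (t k) (r k m).
  elim: m k => [|m IH] k /=; first by rewrite addn0 => ->.
  move=> km; have kn : (k <= n)%N by rewrite -ltnS -km -addSnnS leq_addr.
  by have [c1 w1 _] := lift k kn; split=> //; [exact: tlt|apply: IH; rewrite addSnnS].
have words m k : (k.+1 + m)%N = n.+1 ->
    peqw (rword pb (@mb_s1 _ _ B) (t k.+1) (S k (t k.+1)) (r k.+1 m)) (W k.+1 m ++ [:: l0 b]).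
  elim: m k => [|m IH] k.
    rewrite addn0 => -[->] /=; rewrite t1 S1 dv_id; split=> //; first by rewrite mb_s1p.
    by move=> u _ /=; exact: mb_s1p.
  move=> km; have kn : (k < n)%N by rewrite -ltnS -km -addSnnS leq_addr.
  have [_ _ sk] := lift k.+1 kn; have [hd _] := lh k.+1 kn.
  split=> /=; last by apply: IH; rewrite addSnnS.
    by apply: dv_eq; [rewrite hd pS// ltnW|exact: Sh].
  by move=> u Iu; rewrite sk.
exists (r 0%N n.+1); split; first by rewrite -t0; apply: valid.
(* The value of [hl_h l] at 0 is meaningless; the unit at [b] takes its place to make a genuine
   chain. *)
set a := (@gunit G b, hl_sig l 0).
have pw : peqw (rword pb (@mb_s1 _ _ B) 0 (@mb_s0 _ _ B) (r 0%N n.+1))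
    ((a :: W 1%N n) ++ [:: l0 b]).
  have [_ _ s0] := lift 0%N (leq0n n).
  rewrite /=; split; last exact: words.
    by rewrite S0 dv_id mb_s0p.
  by move=> u Iu; rewrite s0 ?t0.
have chw : chain b (rword pb (@mb_s1 _ _ B) 0 (@mb_s0 _ _ B) (r 0%N n.+1)) b.
  have := @rword_chain _ _ _ _ _ _ _ pb id (@mb_s1 _ _ B) (mb_s1w B) 0 (@mb_s0 _ _ B) (r 0%N n.+1).
  by rewrite mb_s0p mb_s1p; apply; [rewrite -[X in rvalid _ _ X]t0; exact: valid|exact: mb_s0w].
have cha := chain_peqw pw chw.
have chb : chain b (a :: W 1%N n) b.
  have [y c1 [/= yb _ _ _]] := chain_catE cha.
  by rewrite gdom_unit in yb; subst y.
have nthW i : (i < n)%N -> nth (l0 b) (W 1%N n) i = (hl_h l i.+1, hl_sig l i.+1).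
  by move=> ni; rewrite (nth_map 0%N) ?size_iota// nth_iota.
have [] := @hloop_ext G b l (mkl b (a :: W 1%N n)) Hl.
- by rewrite /= size_map size_iota.
- by move=> [|i] /= ni u Iu //; rewrite nthW.
- by move=> [//|i] /= ni; rewrite nthW.
move=> _ e1; apply: (rst_trans _ _ _ _ _ e1).
apply: (rst_trans _ _ _ _ _ (rst_sym _ _ _ _ (loop_cons_l0 (erefl : a.1 = @gunit G b) chb))).
apply: weq_loop; rewrite lastI in chb.
rewrite [a :: _]lastI; apply: (weq_trans (weq_sym (weq_rcons_l0 chb))); rewrite -lastI.
by apply: weq_peqw => //; exact: peqw_sym.
Qed.

Lemma reads_uniq (B : mbundle b) l l' t S t' S' : is_hloop b l -> is_hloop b l' ->
  @reads B l t S -> @reads B l' t' S' -> loop_equiv b l l'.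
Proof.
move=> Hl Hl' /(reads_word Hl)[r [rv e]] /(reads_word Hl')[r' [rv' e']].
apply: (rst_trans _ _ _ _ _ e); apply: rst_sym; apply: (rst_trans _ _ _ _ _ e').
apply: weq_loop.
have := @rword_uniq _ b _ _ _ _ _ _ (@mb_bundle _ _ B) id (@mb_s1 _ _ B) (mb_s1w B) 0
  (@mb_s0 _ _ B) r' r rv' rv (mb_s0w B).
by rewrite mb_s0p mb_s1p.
Qed.

(** The pullback isomorphisms carry the lifts of [B] and [B'] to the bottom and top edges of the
    square without changing their words, since equivariant maps preserve division. *)
Lemma reads_homotopic (B B' : mbundle b) l l' t S t' S' : etale G ->
  is_hloop b l -> is_hloop b l' -> @reads B l t S -> @reads B' l' t' S' ->
  mb_homotopic B B' -> loop_equiv b l l'.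
Proof.
move=> Get Hl Hl' /(reads_word Hl)[r [rv e]] /(reads_word Hl')[r' [rv' e']].
move=> [E [p [w [act [s0 [s1 [pb [cs0 [cs1 [sb [[f [[fc _] [fw [fa [f0 f1]]]]]
  [g [[gc _] [gw [ga [g0 g1]]]]]]]]]]]]]]]].
apply: (rst_trans _ _ _ _ _ e); apply: rst_sym; apply: (rst_trans _ _ _ _ _ e').
apply: rst_sym; apply: weq_loop.
rewrite -(rword_map (@mb_bundle _ _ B) pb (fun x => (fw x).2) fa (mb_s1w B) rv (mb_s0w B)).
rewrite -(rword_map (@mb_bundle _ _ B') pb (fun x => (gw x).2) ga (mb_s1w B') rv' (mb_s0w B')).
rewrite f0 f1 g0 g1; apply: (square_words Get pb cs0 cs1 sb).
  exact: (@rvalid_map _ _ _ _ _ w f (fun x => (x, 0)) fc (fun x => (fw x).1) id 0 r rv).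
exact: (@rvalid_map _ _ _ _ _ w g (fun x => (x, 1)) gc (fun x => (gw x).1) id 0 r' rv').
Qed.

End Reads.

Lemma I01sq_closed : closed I01sq.
Proof.
have -> : I01sq = (fun q : R * R => q.1) @^-1` I01 `&` (fun q : R * R => q.2) @^-1` I01.
  by apply/seteqP; split.
apply: closedI.
  have /continuous_closedP : continuous (fun q : R * R => q.1) by move=> q; exact: cvg_fst.
  by apply; exact: I01_closed.
have /continuous_closedP : continuous (fun q : R * R => q.2) by move=> q; exact: cvg_snd.
by apply; exact: I01_closed.
Qed.

Definition param (r t x : R) : R := (x - r) / (t - r).

Lemma param_I01 (r t x : R) : r < t -> r <= x <= t -> I01 (param r t x).
Proof.
move=> rt /andP[h1 h2]; rewrite /I01 /= /param; apply/andP; split.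
  by apply: divr_ge0; lra.
by rewrite ler_pdivrMr; lra.
Qed.

Lemma param_l (r t : R) : param r t r = 0.
Proof. by rewrite /param subrr mul0r. Qed.

Lemma param_r (r t : R) : r < t -> param r t t = 1.
Proof. by move=> rt; rewrite /param divff// gt_eqF// subr_gt0. Qed.

Lemma paramK (r t u : R) : r < t -> param r t (r + u * (t - r)) = u.
Proof. by move=> rt; rewrite /param addrC addKr mulfK// gt_eqF// subr_gt0. Qed.

Lemma Kparam (r t x : R) : r < t -> r + param r t x * (t - r) = x.
Proof. by move=> rt; rewrite /param divfK ?gt_eqF ?subr_gt0// addrC subrK. Qed.

Lemma within_param (Y : topologicalType) (A : set Y) (r t x : Y -> R) :
  (forall y, A y -> r y < t y) -> {within A, continuous r} -> {within A, continuous t} ->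
  {within A, continuous x} -> {within A, continuous (fun y => param (r y) (t y) (x y))}.
Proof.
move=> rt cr ct cx; apply: within_mulr; first exact: within_subr.
apply: within_invr; last exact: within_subr.
by move=> y Ay; rewrite gt_eqF// subr_gt0; exact: rt.
Qed.

Lemma chain_le (n : nat) (t : nat -> R) i j : (forall i, (i <= n)%N -> t i < t i.+1) ->
  (i <= j <= n.+1)%N -> t i <= t j.
Proof.
move=> tlt /andP[ij jn]; elim: j ij jn => [|j IH]; first by rewrite leqn0 => /eqP->.
rewrite leq_eqVlt => /orP[/eqP->//|ij] jn.
by apply: le_trans (IH ij (ltnW jn)) _; apply/ltW/tlt.
Qed.

(** * Bundles reading a given loop and loops read by a given bundle *)

Section Existence.
Variables (G : topGroupoid) (b : G0 G).

(** Over the chain of intervals [[t i, t i.+1]] the base maps are the paths of [l], rescaled by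
    [param], and the transition at [t i] is the arrow [hl_h l i]. *)
Lemma reads_exist (l : hloop G) (t : nat -> R) : is_hloop b l ->
  t 0%N = 0 -> t (hl_n l).+1 = 1 -> (forall i, (i <= hl_n l)%N -> t i < t i.+1) ->
  exists (B : mbundle b) S, @reads G b B l t S.
Proof.
move=> [cl [lb [le lh]]] t0 t1 tlt; set n := hl_n l in cl le lh t1 tlt.
pose f i x := hl_sig l i (param (t i) (t i.+1) x).
have c1 : continuous (fun x : R => x) by move=> x.
have c2 i : continuous (fun _ : R => t i) by move=> x; exact: cvg_cst.
have [|||||||E [p [w [act [S [pb [cS [wS aS]]]]]]]] :=
  @chain_bundle G R I01 id n (fun i _ => t i) f (fun i _ => hl_h l i)
   I01_closed c1 c2 _ _ _ _ _ _ _ 0 I01_0.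
- by move=> x /andP[x0 x1]; rewrite t0.
- by move=> x /andP[x0 x1]; rewrite t1.
- by move=> i x ni _; exact: tlt.
- move=> i ni.
  apply: (@within_comp R R (G0 G) _ I01 (fun x => param (t i) (t i.+1) x) (hl_sig l i)).
  + by move=> x [_ xi]; apply: param_I01 => //; exact: tlt.
  + apply: within_param; [by move=> x _; exact: tlt|exact: within_cst|exact: within_cst|].
    exact: within_id.
  + exact: cl.
- by move=> i ni; exact: within_cst.
- move=> i x ni _ /= ->; have [-> _] := lh i.+1 ni.
  by rewrite /f param_r// tlt// ltnW.
- move=> i x ni _ /= ->; have [_ ->] := lh i.+1 ni.
  by rewrite /f param_l.
have cellE i : (i <= n)%N -> cell I01 id (fun i _ => t i) i = itv (t i) (t i.+1).
  move=> ni; apply/seteqP; split=> x; first by case.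
  move=> xi; split=> //; move: xi => /andP[x1 x2]; rewrite /I01 /= -t0 -t1.
  apply/andP; split.
    by apply: le_trans x1; apply: (chain_le tlt); rewrite leq0n leqW.
  by apply: le_trans x2 _; apply: (chain_le tlt); rewrite leqnn ltnS ni.
have pS i u : (i <= n)%N -> I01 u -> p (S i (t i + u * (t i.+1 - t i))) = hl_sig l i u.
  move=> ni Iu; have [|_ ->] := wS i (t i + u * (t i.+1 - t i)) ni; last first.
    by rewrite /f paramK// tlt.
  by rewrite cellE//; apply: seg_itv => //; exact/ltW/tlt.
have I0 : cell I01 id (fun i _ => t i) 0%N 0.
  by rewrite cellE// -[X in itv _ _ X]t0; exact/itv_l/ltW/tlt.
have I1 : cell I01 id (fun i _ => t i) n 1.
  by rewrite cellE// -[X in itv _ _ X]t1; exact/itv_r/ltW/tlt.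
have p0 : p (S 0%N 0) = b.
  by rewrite -lb -pS// mul0r addr0 t0.
have p1 : p (S n 1) = b.
  by rewrite -le -pS// mul1r addrC subrK t1.
have [w0 _] := wS _ _ (leq0n n) I0; have [w1 _] := wS _ _ (leqnn n) I1.
exists (MBundle pb w0 w1 p0 p1), S; split=> //; last split=> //=.
  move=> i ni; rewrite -cellE//; split=> /=; first exact: cS.
    by move=> x /(wS _ _ ni)[].
  by move=> u Iu; rewrite /seg pS.
move=> i ni; apply: aS => //.
have : cell I01 id (fun i _ => t i) i (t i.+1) 
  by rewrite (cellE _ (ltnW ni)); exact/itv_r/ltW/tlt/ltnW.
by case.
Qed.

(** Deleting this set from a neighbourhood of [x] removes the end [a] unless [x] is that end. *)
Lemma closed_except (a x : R) : closed [set y : R | y = a /\ y <> x].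
Proof.
have [e|ne] := pselect (a = x).
  have -> : [set y : R | y = a /\ y <> x] = set0.
    by apply/seteqP; split=> y // [-> /(_ e)].
  exact: closed0.
have -> : [set y : R | y = a /\ y <> x] = [set y | y = a]; last exact: closed_eq.
by apply/seteqP; split=> y /=; [case|move=> ->].
Qed.

(** The extreme lifts must meet the marking, but the grid does not tell which local section will
    cover an end. So sections around 0 and 1 are taken through the marked points and all other
    neighbourhoods are shrunk to avoid these ends; any section covering an end then has the right
    value there. *)
Lemma bundle_reads (B : mbundle b) : etale G ->
  exists l t S, is_hloop b l /\ @reads G b B l t S.
Proof.
move=> Get; set pb := @mb_bundle _ _ B.
pose Q (V : set R) := exists s : R -> mb_E B, [/\ {within V `&` I01, continuous s},
  forall x, V x -> I01 x -> @mb_w _ _ B (s x) = x, V 0 -> s 0 = @mb_s0 _ _ B &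
  V 1 -> s 1 = @mb_s1 _ _ B].
have HQ x : I01 x -> exists V, [/\ open V, V x & Q V].
  move=> Ix; have [e [we e0 e1]] : exists e, [/\ @mb_w _ _ B e = x,
      x = 0 -> e = @mb_s0 _ _ B & x = 1 -> e = @mb_s1 _ _ B].
    have [x0|nx0] := eqVneq x 0.
      exists (@mb_s0 _ _ B); split=> //; first by rewrite mb_s0w.
      by rewrite x0 => /eqP; rewrite eq_sym oner_eq0.
    have [x1|nx1] := eqVneq x 1.
      by exists (@mb_s1 _ _ B); split=> //; [rewrite mb_s1w|move=> x0; rewrite x0 eqxx in nx0].
    have [e we] := pb_surj pb Ix; exists e; split=> // xx; move: nx0 nx1; by rewrite xx eqxx.
  have [V [s [oV Ve se cs ws]]] := etale_section Get pb e.
  rewrite we in Ve se.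
  exists (V `&` (~` [set y | y = 0 /\ y <> x] `&` ~` [set y | y = 1 /\ y <> x])); split.
  - by apply: openI => //; apply: openI; apply: closed_openC; exact: closed_except.
  - by split=> //; split=> -[].
  exists s; split.
  - by apply: within_sub cs => y [[Vy _] Iy].
  - by move=> y [Vy _] Iy; exact: ws.
  - move=> [_ [n0 _]]; have x0 : x = 0 by apply: contrapT => nx; apply: n0; split=> // /esym.
    by rewrite -e0// -[X in s X]x0.
  - move=> [_ [_ n1]]; have x1 : x = 1 by apply: contrapT => nx; apply: n1; split=> // /esym.
    by rewrite -e1// -[X in s X]x1.
have [N [N0 HN]] := lebesgue_grid1 HQ.
have NR : 0 < N%:R :> R by rewrite ltr0n.
have frac k : (k <= N)%N -> I01 (k%:R / N%:R).
  by move=> kN; rewrite /I01 /= divr_ge0//= ler_pdivrMr// mul1r ler_nat.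
pose t (i : nat) : R := i%:R / N%:R.
have tlt i : t i < t i.+1 by rewrite /t ltr_pM2r ?invr_gt0// ltr_nat.
have t0 : t 0%N = 0 by rewrite /t mul0r.
have tN : t N = 1 by rewrite /t divff// gt_eqF.
have [S SP] : exists S : nat -> R -> mb_E B, forall i, (i < N)%N ->
    [/\ {within itv (t i) (t i.+1), continuous (S i)},
      forall x, itv (t i) (t i.+1) x -> @mb_w _ _ B (S i x) = x,
      i = 0%N -> S i 0 = @mb_s0 _ _ B & i.+1 = N -> S i 1 = @mb_s1 _ _ B].
  suff /choice[S SP] : forall i : nat, exists s : R -> mb_E B, (i < N)%N ->
    [/\ {within itv (t i) (t i.+1), continuous s},
      forall x, itv (t i) (t i.+1) x -> @mb_w _ _ B (s x) = x,
      i = 0%N -> s 0 = @mb_s0 _ _ B & i.+1 = N -> s 1 = @mb_s1 _ _ B].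
    by exists S.
  move=> i; have [iN|] := boolP (i < N)%N; last by exists (fun=> @mb_s0 _ _ B).
  have [V [[s [cs ws s0 s1]] HV]] := HN i iN; exists s => _.
  have sub : itv (t i) (t i.+1) `<=` V `&` I01.
    move=> x xi; split; first exact: HV.
    have := frac _ (ltnW iN); have := frac _ iN; move: xi; rewrite /itv /I01 /t /=.
    by move=> /andP[? ?] /andP[? ?] /andP[? ?]; apply/andP; split; lra.
  split; first exact: within_sub cs.
  - by move=> x /sub[]; exact: ws.
  - move=> i0; apply: s0; apply: HV; rewrite -/(t i) -/(t i.+1) i0 -t0.
    by rewrite lexx ltW.
  - move=> iN'; apply: s1; apply: HV; rewrite -/(t i) -/(t i.+1) iN' -tN.
    by rewrite lexx -iN' ltW.
have N1 i : (i <= N.-1)%N -> (i < N)%N by rewrite -ltnS prednK.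
pose l := HLoop N.-1 (fun i => seg (fun x => @mb_p _ _ B (S i x)) (t i) (t i.+1))
  (fun i => dv pb (S i (t i)) (S i.-1 (t i))).
have Sl i : (i < N)%N -> @mb_w _ _ B (S i (t i)) = t i.
  by move=> iN; have [_ -> //] := SP i iN; exact/itv_l/ltW/tlt.
have Sr i : (i < N)%N -> @mb_w _ _ B (S i (t i.+1)) = t i.+1.
  by move=> iN; have [_ -> //] := SP i iN; exact/itv_r/ltW/tlt.
have S0 : S 0%N 0 = @mb_s0 _ _ B by have [_ _ ->] := SP 0%N N0.
have S1 : S N.-1 1 = @mb_s1 _ _ B.
  by have [_ _ _ ->//] := SP N.-1 (N1 _ (leqnn _)); rewrite prednK.
exists l, t, S; split.
  split; last split; last split => /=.
  - move=> i /= /N1 iN; have [cs _ _ _] := SP i iN.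
    by apply: seg_cont; [exact/ltW/tlt|exact: (within_p pb cs)].
  - by rewrite /= seg0 t0 S0 mb_s0p.
  - by rewrite seg1 prednK// tN S1 mb_s1p.
  - move=> [//|i] /= /N1 iN; have ww : @mb_w _ _ B (S i.+1 (t i.+1)) = @mb_w _ _ B (S i (t i.+1)).
      by rewrite Sl// Sr// ltnW.
    by rewrite seg0 seg1 dv_dom// dv_cod.
split=> //=; first by rewrite prednK.
  by move=> i /N1 iN; have [cs ws _ _] := SP i iN; split.
split=> // i iN; have iN' : (i.+1 < N)%N by rewrite -[N]prednK// ltnS.
by rewrite dv_act// Sl// Sr// ltnW.
Qed.

End Existence.

(** * Deformations *)

Lemma ord_le n (i : 'I_n.+1) : (i <= n)%N. Proof. by rewrite -ltnS. Qed.

Section SquareEnd.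
Variables (G : topGroupoid) (b : G0 G) (B : mbundle b) (l : hloop G).
Variables (t : nat -> R) (S : nat -> R -> mb_E B).
Hypothesis Hl : is_hloop b l.
Hypothesis rd : reads l t S.
Notation n := (hl_n l).
Variables (E : topologicalType) (p : E -> G0 G) (w : E -> R * R) (act : G1 G -> E -> E).
Hypothesis pb : principal_bundle I01sq p w act.
Variables (tt : nat -> R * R -> R) (f : nat -> R * R -> G0 G) (d : nat -> R * R -> G1 G).
Variables (SS : nat -> R * R -> E) (u : R).
Hypothesis Iu : I01 u.
Notation cell2 := (cell I01sq (fun q => q.1) tt).
Hypothesis ttc : forall i, continuous (tt i).
Hypothesis cS : forall i, (i <= n)%N -> {within cell2 i, continuous (SS i)}.
Hypothesis wS : forall i q, (i <= n)%N -> cell2 i q -> w (SS i q) = q /\ p (SS i q) = f i q.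
Hypothesis aS : forall i q, (i < n)%N -> I01sq q -> q.1 = tt i.+1 q ->
  act (d i.+1 q) (SS i q) = SS i.+1 q.
Hypothesis ttu : forall i x, tt i (x, u) = t i.
Hypothesis fu : forall i x, (i <= n)%N -> itv (t i) (t i.+1) x -> f i (x, u) = @mb_p _ _ B (S i x).
Hypothesis du : forall i x, (i < n)%N -> d i.+1 (x, u) = hl_h l i.+1.

(** On the line of height [u] the sections [SS] have the same base maps and the same transition
    arrows as the lifts [S] of [B], so [bundle_iso] applies with [x |-> (x, u)]. *)
Lemma square_end : pullback_iso B p w act (fun v => SS 0 (0, v)) (fun v => SS n (1, v)) u.
Proof.
have [t0 t1 tlt lift [S0 S1 Sh]] := rd; have [cl [lb [le lh]]] := Hl.
pose C := cell I01 (fun x => x) (fun i (_ : R) => t i).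
pose C' i := cell2 i `&` [set q | q.2 = u].
pose c (x : R) := (x, u).
have CI i x : C i x -> itv (t i) (t i.+1) x by case.
have CC' i x : C i x -> C' i (c x) /\ (c x).1 = x.
  by move=> [Ix xi]; split=> //; split=> //; split=> //=; rewrite !ttu.
have C'C i q : C' i q -> C i q.1 /\ c q.1 = q.
  by case: q => x v [[[/= Ix Iv] xi] /= vu]; rewrite /= vu !ttu in xi *.
have cont_c : continuous c.
  move=> x; apply: (@cvg_pair _ _ _ _ (nbhs x) (nbhs u)); first exact: cvg_id.
  exact: cvg_cst.
have CX x : I01 x -> exists i : 'I_n.+1, C i x.
  move=> Ix; have [||i ni Ci] := @cell_cover R I01 id n (fun i _ => t i) _ _ x Ix.
  - by move=> y /andP[]; rewrite t0.
  - by move=> y /andP[]; rewrite t1.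
  by exists (Ordinal (n:=n.+1) (m:=i) ni).
have Ccl (i : 'I_n.+1) : closed (C i).
  apply: cell_closed => [|x|j x]; [exact: I01_closed| |exact: cvg_cst].
  exact: cvg_id.
have Ccl' (i : 'I_n.+1) : closed (C' i).
  apply: closedI.
    apply: cell_closed => //; first exact: I01sq_closed.
    by move=> q; exact: cvg_fst.
  have /continuous_closedP : continuous (fun q : R * R => q.2) by move=> q; exact: cvg_snd.
  by move=> /(_ [set y : R | y = u]); apply; exact: closed_eq.
have Sc (i : 'I_n.+1) : {within C i, continuous (S i)}.
  by have [cs _ _] := lift i (ord_le i); apply: within_sub cs => x /CI.
have Sc' (i : 'I_n.+1) : {within C' i, continuous (SS i)}.
  by apply: within_sub (cS (ord_le i)) => q [].
have Sw (i : 'I_n.+1) x : C i x -> @mb_w _ _ B (S i x) = x.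
  by move=> /CI; have [_ ws _] := lift i (ord_le i); exact: ws.
have Sw' (i : 'I_n.+1) q : C' i q -> w (SS i q) = q.
  by move=> [Cq _]; have [] := wS (ord_le i) Cq.
have Sp (i : 'I_n.+1) x : C i x -> @mb_p _ _ B (S i x) = p (SS i (c x)).
  move=> Ci; have [[Cq _] _] := CC' _ _ Ci; have [_ ->] := wS (ord_le i) Cq.
  by rewrite fu//; [exact: ord_le|exact: CI].
have SS' (i j : 'I_n.+1) x : C i x -> C j x -> exists k,
  [/\ @gdom G k = @mb_p _ _ B (S i x), @mb_act _ _ B k (S i x) = S j x & act k (SS i (c x)) = SS j (c x)].
  (* Distinct cells meet only if consecutive, and then the arrow of the loop relates the sections;
     the opposite order takes its inverse and equal indices a unit. *)
  have meet (i' j' : 'I_n.+1) : (i' < j')%N -> C i' x -> C j' x -> exists k,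
      [/\ @gdom G k = @mb_p _ _ B (S i' x), @mb_act _ _ B k (S i' x) = S j' x &
          act k (SS i' (c x)) = SS j' (c x)].
    move=> ij Ci Cj.
    have ij' : (i' < j' <= n)%N by rewrite ij ord_le.
    have [je xt] := @cell_meet R I01 id n (fun i _ => t i) (fun i x ni _ => tlt i ni) i' j' x ij' Ci Cj.
    have ni : (i' < n)%N by apply: leq_trans ij (ord_le j').
    move: xt; rewrite je /= => xt; exists (hl_h l i'.+1); split.
    - have [hd _] := lh i'.+1 ni; have [_ _ pi] := lift i' (ord_le i').
      by rewrite hd /= pi// seg1 xt.
    - by rewrite xt; exact: Sh.
    - by rewrite -(du x ni); apply: aS => //; rewrite ?ttu//; split=> //; case: Ci.
  move=> Ci Cj; have [ij|ji|/val_inj <-] := ltngtP i j; first exact: meet.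
    have [k [kd k1 k2]] := meet _ _ ji Cj Ci.
    have kd' : @gdom G k = p (SS j (c x)) by rewrite kd Sp.
    exists (@ginv G k); split.
    - by rewrite gdom_inv -k1 (p_act (@mb_bundle _ _ B)).
    - rewrite -k1 -(actM (@mb_bundle _ _ B)) ?gdom_inv// gcomp_invl kd.
      exact: (act1 (@mb_bundle _ _ B)).
    - by rewrite -k2 -(actM pb) ?gdom_inv// gcomp_invl kd' (act1 pb).
  exists (@gunit G (@mb_p _ _ B (S i x))); rewrite gdom_unit; split=> //.
    exact: (act1 (@mb_bundle _ _ B)).
  by rewrite Sp//; exact: (act1 pb).
have cont_fst : continuous (fun q : R * R => q.1) by move=> q; exact: cvg_fst.
have [phi [[pc [pS [g [g1 [g2 gc]]]]] pw pa psec]] :=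
  @bundle_iso G _ R E (R * R)%type I01 I01sq _ _ _ p w act (@mb_bundle _ _ B) pb 'I_n.+1
    (fun i => C i) (fun i => C' i) c (fun q => q.1) (fun i => S i) (fun i => SS i)
    Ccl Ccl' CX cont_c cont_fst CC' C'C Sc Sc' Sw Sw' Sp SS' (@mb_s0 _ _ B).
have setE : [set e | exists i : 'I_n.+1, C' i (w e)] = [set e | (w e).2 = u].
  apply/seteqP; split=> e /=; first by case=> i [].
  move=> we; have [I1 I2] := pb_X pb e.
  have [i Ci] := CX _ I1; exists i; have [+ _] := CC' _ _ Ci.
  by rewrite /c -we -surjective_pairing.
rewrite setE in pS g2 gc.
exists phi; split; first by split=> //; split=> //; exists g.
split=> //; split=> //.
have C0 : C (ord0 : 'I_n.+1) 0.
  by split=> //; rewrite t0 lexx /= -[X in X <= _]t0; apply/ltW/tlt.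
have C1 : C (ord_max : 'I_n.+1) 1.
  by split=> //=; rewrite t1 lexx andbT -[X in _ <= X]t1; apply/ltW/tlt.
by have := psec _ _ C0; have := psec _ _ C1; rewrite /= S0 S1.
Qed.

End SquareEnd.

Lemma interp_lt (u a c a' c' : R) : 0 <= u -> u <= 1 -> a' < c' -> a < c ->
  (1 - u) * a + u * a' < (1 - u) * c + u * c'.
Proof.
move=> u0 u1 ac' ac; rewrite -subr_gt0.
have -> : (1 - u) * c + u * c' - ((1 - u) * a + u * a') = (1 - u) * (c - a) + u * (c' - a').
  by ring.
have [e|u1'] := eqVneq u 1; first by rewrite e; lra.
apply: ltr_wpDr; first by apply: mulr_ge0; lra.
by apply: mulr_gt0; rewrite subr_gt0// lt_neqAle u1'.
Qed.

Section Deform.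
Variables (G : topGroupoid) (b : G0 G).

(** The two readings may use different subdivisions, so the square is cut along slanted lines that
    interpolate linearly between [t i] and [t' i]. *)
Lemma deform_homotopic (B B' : mbundle b) l l' t S t' S' :
  is_hloop b l -> is_hloop b l' -> @reads G b B l t S -> @reads G b B' l' t' S' ->
  deform b l l' -> mb_homotopic B B'.
Proof.
move=> Hl Hl' rd rd' [nn [D [d [HD [Hd Hb]]]]].
have [t0 t1 tlt lift [S0 S1 Sh]] := rd; have [t0' t1' tlt' lift' [S0' S1' Sh']] := rd'.
set n := hl_n l in nn t1 tlt lift S1 Sh HD Hd Hb; rewrite nn in t1' tlt' lift' S1' Sh'.
pose tt i (q : R * R) := (1 - q.2) * t i + q.2 * t' i.
have ctt i : continuous (tt i).
  apply: within_setT; apply: within_addr; apply: within_mulr; try exact: within_cst.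
    by apply: within_subr; [exact: within_cst|exact: within_snd].
  exact: within_snd.
have ttlt i q : (i <= n)%N -> I01sq q -> tt i q < tt i.+1 q.
  move=> ni [_ /andP[q0 q1]]; have := tlt i ni; have := tlt' i ni; rewrite /tt.
  by move=> h h'; apply: interp_lt.
(* The coordinates change places: [D i] takes the deformation parameter first, while in the base
   square it comes second. *)
pose f i q := D i (q.2, param (tt i q) (tt i.+1 q) q.1).
have cfst : continuous (fun q : R * R => q.1) by move=> q; exact: cvg_fst.
have dd i q : (i < n)%N -> I01sq q -> q.1 = tt i.+1 q ->
    @gdom G (d i.+1 q.2) = f i q /\ @gcod G (d i.+1 q.2) = f i.+1 q.
  move=> ni Iq q1; have [_ [_ [_ H]]] := Hd i.+1 ni; have [_ Iq2] := Iq.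
  have [-> ->] := H _ Iq2.
  by rewrite /f q1 param_l param_r// ttlt// ltnW.
have [|||||||E [p [w [act [SS [pb [cS [wS aS]]]]]]]] :=
  @chain_bundle G (R * R)%type I01sq (fun q => q.1) n tt f (fun i q => d i q.2)
   I01sq_closed cfst ctt _ _ ttlt _ _ _ _ (0, 0).
- by move=> q [/andP[x0 x1] _]; rewrite /tt t0 t0' !mulr0 addr0.
- by move=> q [/andP[x0 x1] _]; rewrite /tt t1 t1' !mulr1 subrK.
- move=> i ni; have [cD _] := HD i ni.
  apply: (@within_comp (R * R)%type (R * R)%type (G0 G) _ I01sq
    (fun q => (q.2, param (tt i q) (tt i.+1 q) q.1)) (D i)) => //.
    by move=> q [Iq qi]; split; [case: Iq|apply: param_I01 => //; exact: ttlt].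
  apply: within_pair; first exact: within_snd.
  apply: within_param; [by move=> q [Iq _]; exact: ttlt| | |exact: within_fst];
    by apply: continuous_subspaceT; exact: ctt.
- move=> i ni; have [cd _] := Hd i.+1 ni.
  apply: (@within_comp (R * R)%type R (G1 G) _ I01 (fun q => q.2) (d i.+1)) => //.
    by move=> q [[]].
  exact: within_snd.
- by move=> i q ni Iq /(dd _ _ ni Iq)[].
- by move=> i q ni Iq /(dd _ _ ni Iq)[].
- by [].
have tt0 q : tt 0%N q = 0 by rewrite /tt t0 t0' !mulr0 addr0.
have tt1 q : tt n.+1 q = 1 by rewrite /tt t1 t1' !mulr1 subrK.
have c0 u : I01 u -> cell I01sq (fun q => q.1) tt 0%N (0, u).
  move=> Iu; split=> //=; apply/andP; split; first by rewrite tt0.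
  by rewrite -[X in X <= _](tt0 (0, u)); apply/ltW/ttlt.
have c1 u : I01 u -> cell I01sq (fun q => q.1) tt n (1, u).
  move=> Iu; split=> //=; apply/andP; split; last by rewrite tt1.
  by rewrite -[X in _ <= X](tt1 (1, u)); apply/ltW/ttlt.
exists E, p, w, act, (fun v => SS 0%N (0, v)), (fun v => SS n (1, v)); split=> //.
split.
  apply: (@within_comp R (R * R)%type E I01 _ (fun v => (0, v)) (SS 0%N) c0).
    by apply: within_pair; [exact: within_cst|exact: within_id].
  exact: cS.
split.
  apply: (@within_comp R (R * R)%type E I01 _ (fun v => (1, v)) (SS n) c1).
    by apply: within_pair; [exact: within_cst|exact: within_id].
  exact: cS.
split.
  move=> u Iu; have [-> ->] := wS _ _ (leq0n n) (c0 u Iu).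
  have [-> ->] := wS _ _ (leqnn n) (c1 u Iu); have [b0 b1] := Hb u Iu.
  have h0 : param (tt 0%N (0, u)) (tt 1%N (0, u)) 0 = 0 by rewrite tt0 param_l.
  have h1 : param (tt n (1, u)) (tt n.+1 (1, u)) 1 = 1.
    by rewrite -[X in param _ _ X](tt1 (1, u)) param_r//; apply: ttlt.
  by rewrite /f /= h0 h1 b0 b1.
split.
  apply: (@square_end G b B l t S Hl rd E p w act pb tt f (fun i q => d i q.2)) => //.
  - by move=> i x; rewrite /tt /= subr0 mul1r mul0r addr0.
  - move=> i x ni xi; have [_ _ pi] := lift i ni.
    have [_ HD0] := HD i ni.
    rewrite /f /tt /= subr0 !mul1r !mul0r !addr0.
    have Ip := param_I01 (tlt i ni) xi.
    by have [-> _] := HD0 _ Ip; rewrite pi// /seg Kparam// tlt.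
  - by move=> i x ni /=; have [_ [-> _]] := Hd i.+1 ni.
rewrite -nn in cS wS aS *.
apply: (@square_end G b B' l' t' S' Hl' rd' E p w act pb tt f (fun i q => d i q.2)) => //; rewrite ?nn //.
- by move=> i x; rewrite /tt /= subrr mul0r mul1r add0r.
- move=> i x ni xi; have [_ _ pi] := lift' i ni.
  have [_ HD0] := HD i ni.
  rewrite /f /tt /= subrr !mul1r !mul0r !add0r.
  have Ip := param_I01 (tlt' i ni) xi.
  by have [_ ->] := HD0 _ Ip; rewrite pi// /seg Kparam// tlt'.
- by move=> i x ni /=; have [_ [_ [-> _]]] := Hd i.+1 ni.
Qed.

Lemma deform_refl l : is_hloop b l -> deform b l l.
Proof.
move=> [cl [lb [le lh]]]; split=> //.
exists (fun i q => hl_sig l i q.2), (fun i _ => hl_h l i); split; last split => //=.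
- move=> i ni; split=> //.
  apply: (@within_comp (R * R)%type R (G0 G) I01sq I01 snd (hl_sig l i)) => //.
  + by move=> q [].
  + exact: within_snd.
  + exact: cl.
- by move=> i ni; split; [exact: within_cst|split=> //; split=> // u _; apply: lh].
Qed.

Lemma reads_Pi_equiv (B B' : mbundle b) l t S t' S' :
  is_hloop b l -> @reads G b B l t S -> @reads G b B' l t' S' -> Pi_equiv B B'.
Proof.
move=> Hl rd rd'; apply: rst_step.
exact: (deform_homotopic Hl Hl rd rd' (deform_refl Hl)).
Qed.

End Deform.

(** * The other moves *)

Lemma itv_closed (u v : R) : closed (itv u v).
Proof.
have -> : itv u v = [set x : R | u <= x] `&` [set x : R | x <= v].
  by apply/seteqP; split=> x /=; rewrite /itv /=; [move=> /andP[]|move=> [? ?]; apply/andP].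
by apply: closedI; [exact: closed_ge|exact: closed_le].
Qed.

Lemma itv_glue (Y : topologicalType) (f g : R -> Y) (u m v : R) : u <= m -> m <= v ->
  {within itv u m, continuous f} -> {within itv m v, continuous g} -> f m = g m ->
  {within itv u v, continuous (fun x => if x <= m then f x else g x)}.
Proof.
move=> um mv cf cg fg.
have -> : itv u v = itv u m `|` itv m v.
  apply/seteqP; split=> x; rewrite /itv /=.
    by move=> /andP[h1 h2]; case: (leP x m) => h; [left|right]; apply/andP; split=> //; exact: ltW.
  by case=> /andP[h1 h2]; apply/andP; split; lra.
apply: withinU_continuous; [exact: itv_closed|exact: itv_closed| |].
  apply: (@within_ext R Y _ f _ _ cf) => x /andP[_ xm]; by rewrite xm.
apply: (@within_ext R Y _ g _ _ cg) => x /andP[mx _]; case: ifP => // xm.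
by have -> : x = m by apply/eqP; rewrite eq_le xm mx.
Qed.

Section Moves.
Variables (G : topGroupoid) (b : G0 G).

(** Both remaining moves merge the pieces [i] and [i.+1], once there is a lift [Sm] over the former
    that continues [S i.+1]. As the two pieces have equal length, the path over their union is
    exactly a [pcat], with no reparametrization. *)
Lemma merge_reads (B : mbundle b) l t S i (Sm : R -> mb_E B) l' :
  @reads G b B l t S -> (i < hl_n l)%N -> t i.+1 - t i = t i.+2 - t i.+1 ->
  {within itv (t i) (t i.+1), continuous Sm} ->
  (forall x, itv (t i) (t i.+1) x -> @mb_w _ _ B (Sm x) = x) ->
  Sm (t i.+1) = S i.+1 (t i.+1) -> (i = 0%N -> Sm 0 = @mb_s0 _ _ B) ->
  hl_n l' = (hl_n l).-1 ->
  (forall j, (j < i)%N -> peq (hl_sig l' j) (hl_sig l j)) ->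
  peq (hl_sig l' i) (pcat (seg (fun x => @mb_p _ _ B (Sm x)) (t i) (t i.+1)) (hl_sig l i.+1)) ->
  (forall j, (i < j <= hl_n l')%N -> peq (hl_sig l' j) (hl_sig l j.+1)) ->
  (forall j, (0 < j < i)%N -> hl_h l' j = hl_h l j) ->
  ((0 < i)%N -> @mb_act _ _ B (hl_h l' i) (S i.-1 (t i)) = Sm (t i)) ->
  (forall j, (i < j <= hl_n l')%N -> hl_h l' j = hl_h l j.+1) ->
  exists t' S', @reads G b B l' t' S'.
Proof.
move=> [t0 t1 tlt lift [S0 S1 Sh]] ni mid cm wm Sm1 Sm0 nn sl si sr hl hi hr.
have n0 : (0 < hl_n l)%N by apply: leq_ltn_trans ni.
set n' := hl_n l' in nn sr hr.
have nE : hl_n l = n'.+1 by rewrite nn prednK.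
rewrite nE in t1 tlt lift S1 Sh ni.
have ti : t i < t i.+1 by apply: tlt; exact: ltnW.
have ti1 : t i.+1 < t i.+2 by exact: tlt.
have [ci1 wi1 pi1] := lift i.+1 ni.
(* The point [t i.+1] is dropped, and all later pieces move down by one index. *)
exists (fun j => if (j <= i)%N then t j else t j.+1).
exists (fun j => if (j < i)%N then S j else
  if j == i then (fun x => if x <= t i.+1 then Sm x else S i.+1 x) else S j.+1).
rewrite /reads -/n'; split.
- by [].
- by rewrite ifN// -ltnNge; apply: leq_trans ni _.
- move=> j nj; have [ji|ij|->] := ltngtP j i.
  + by apply: tlt; exact: leqW.
  + exact: tlt.
  + exact: lt_trans ti ti1.
- move=> j nj; have [ji|ij|->] := ltngtP j i.
  + have [cj wj pj] := lift j (leqW nj); split=> // u Iu; rewrite sl//; exact: pj.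
  + have [cj wj pj] := lift j.+1 nj; split=> // u Iu; rewrite sr ?ij//; exact: pj.
  split.
  + by apply: itv_glue => //; exact: ltW.
  + move=> x /andP[x1 x2]; case: (leP x (t i.+1)) => h; first by apply: wm; apply/andP.
    by apply: wi1; rewrite /itv /= x2 ltW.
  move=> u Iu; rewrite si// /pcat /seg.
  have -> : t i + u * (t i.+2 - t i) = t i + (2 * u) * (t i.+1 - t i).
    by move: mid; set a := t i; set c := t i.+1; set e := t i.+2 => mid; nra.
  have d0 : 0 < t i.+1 - t i by rewrite subr_gt0.
  have -> : (t i + 2 * u * (t i.+1 - t i) <= t i.+1) = (u <= 1 / 2).
    by rewrite -lerBrDl -[X in _ <= X]mul1r ler_pM2r//; apply/idP/idP; lra.
  case: ifPn => // /negbTE uh; have Iu' : I01 (2 * u - 1).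
    by move/negbT: uh; rewrite -ltNge; move: Iu; rewrite /I01 /= => /andP[? ?] ?; apply/andP; split; lra.
  rewrite pi1// /seg -mid; congr (mb_p (S i.+1 _)); ring.
- split.
  + by case: (i) Sm0 ti => [|k] Sm0 ti //=; rewrite Sm0// -t0 ltW.
  + have [h|h] := ltnP n' i; first by move: ni; rewrite ltnS leqNgt h.
    rewrite eq_sym; move: h; rewrite leq_eqVlt => /orP[/eqP e|h]; last first.
      by rewrite [i == _]ltn_eqF//; exact: S1.
    rewrite -e eqxx ifN; first by rewrite e.
    by rewrite -ltNge -[X in _ < X]t1 -e.
  move=> j nj; have [ji|ij] := ltnP j.+1 i.
    by rewrite (ltnW ji) hl//; apply: Sh; exact: leqW.
  move: ij; rewrite leq_eqVlt => /orP[/eqP e|ij].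
    by subst i; rewrite leqnn eqxx (ltW ti); apply: hi.
  have ij' : (i <= j)%N by [].
  rewrite [(j < i)%N]ltnNge ij' /= [(j.+1 == i)%N]gtn_eqF// hr ?ij//.
  move: ij'; rewrite leq_eqVlt => /orP[/eqP e|ij']; last by rewrite [(j == i)%N]gtn_eqF//; exact: Sh.
  by subst j; rewrite eqxx ifF; [apply: Sh|apply/negbTE; rewrite -ltNge].
Qed.

Definition unif (n i : nat) : R := i%:R / n.+1%:R.

Lemma unif_lt n i : unif n i < unif n i.+1.
Proof. by rewrite /unif ltr_pM2r ?invr_gt0 ?ltr0n// ltr_nat. Qed.

Lemma unif0 n : unif n 0 = 0. Proof. by rewrite /unif mul0r. Qed.
Lemma unif1 n : unif n n.+1 = 1. Proof. by rewrite /unif divff// pnatr_eq0. Qed.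

Lemma unif_mid n i : unif n i.+1 - unif n i = unif n i.+2 - unif n i.+1.
Proof. by rewrite /unif -!mulrBl -!natr1; congr (_ / _); ring. Qed.

(** An identity arrow means that the two lifts already agree at the subdivision point, so the merged
    lift uses [S i] itself. *)
Lemma move_id_reads l l' : is_hloop b l -> move_id l l' ->
  exists (B : mbundle b) t S t' S', @reads G b B l t S /\ @reads G b B l' t' S'.
Proof.
move=> Hl [i [/andP[i0 ni] [e1 [eh [nn [sl [si [sr [hl hr]]]]]]]]].
case: i i0 ni e1 eh sl si sr hl hr => // i _ ni /= e1 eh sl si sr hl hr.
have [B [S rd]] := reads_exist Hl (unif0 _) (unif1 _) (fun i _ => unif_lt _ i).
have [t0 t1 tlt lift [S0 S1 Sh]] := rd.
have [ci wi pi] := lift i (ltnW ni).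
have [t' [S' rd']] : exists t' S', @reads G b B l' t' S'.
  apply: (merge_reads (i := i) (Sm := S i) rd ni (unif_mid _ _) ci wi) => //.
  - rewrite -(Sh i ni) eh pi// seg1; exact/esym/(act1 (@mb_bundle _ _ B)).
  - by move=> ->; rewrite -[X in S _ X](unif0 (hl_n l)) unif0.
  - move=> u Iu; rewrite si// /pcat; case: ifP => // uh; rewrite pi//.
    by move: Iu uh; rewrite /I01 /= => /andP[? ?] ?; apply/andP; split; lra.
  - by move=> j /andP[j0 ji]; apply: hl; rewrite j0 ltnW.
  - move=> i0; rewrite hl ?i0 ?ltnSn//.
    by have := Sh i.-1; rewrite prednK//; apply; exact: ltnW.
by exists B, (unif (hl_n l)), S, t', S'.
Qed.

(** Over the constant path the single arrow [hl_h l i.+1] acts on the whole lift [S i], and the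
    result continues [S i.+1]; at the start of the piece this composes the two arrows as the move
    demands. The merged path pauses during its first half, so the loop read is [l''], which deforms
    to [l']. *)
Lemma move_const_reads l l' : is_hloop b l -> is_hloop b l' -> move_const l l' ->
  exists (B : mbundle b) t S l'' t' S', [/\ @reads G b B l t S, @reads G b B l'' t' S',
    is_hloop b l'' & deform b l'' l'].
Proof.
move=> Hl Hl' [i [/andP[i0 ni] [ac [nn [sl [sr [hl [hi hr]]]]]]]].
have [k ik] : exists k, i = k.+1 by exists i.-1; rewrite prednK.
have [B [S rd]] := reads_exist Hl (unif0 _) (unif1 _) (fun i _ => unif_lt _ i).
have [t0 t1 tlt lift [S0 S1 Sh]] := rd.
have [ci wi pi] := lift i (ltnW ni).
have [cl [lb [le lh]]] := Hl; have [cl' [lb' [le' lh']]] := Hl'.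
set pb := @mb_bundle _ _ B.
set t := unif (hl_n l) in rd t0 t1 tlt lift S0 S1 Sh ci wi pi.
have hdom x : itv (t i) (t i.+1) x -> @gdom G (hl_h l i.+1) = @mb_p _ _ B (S i x).
  move=> Ix; have ti : t i < t i.+1 by exact: unif_lt.
  have := pi _ (param_I01 ti Ix); rewrite /seg Kparam// => <-.
  have [-> _] := lh i.+1 ni; rewrite /= ac// [RHS]ac//; exact: param_I01.
have ti : t i < t i.+1 by exact: unif_lt.
pose Sm x := @mb_act _ _ B (hl_h l i.+1) (S i x).
have pSm x : itv (t i) (t i.+1) x -> @mb_p _ _ B (Sm x) = hl_sig l i.+1 0.
  by move=> Ix; rewrite /Sm (p_act pb) ?(hdom x Ix)//; have [_ ->] := lh i.+1 ni.
pose sg := hl_sig l i.+1.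
pose s2 := pcat (fun=> sg 0) sg.
have csg : {within I01, continuous sg} by exact: cl.
have cs2 : {within I01, continuous s2}.
  by apply: pcat_cont => //; exact: within_cst.
pose l'' := HLoop (hl_n l') (fun j => if j == i then s2 else hl_sig l' j) (hl_h l').
have s20 : s2 0 = sg 0 by rewrite /s2 /pcat ifT//; lra.
have s21 : s2 1 = sg 1.
  by rewrite /s2 /pcat ifN; [congr sg; lra|rewrite -ltNge; lra].
have ni' : (i <= hl_n l')%N by rewrite nn -ltnS prednK//; exact: leq_ltn_trans ni.
have sgi : peq (hl_sig l' i) sg by apply: sr; rewrite leqnn.
have e0 j : hl_sig l'' j 0 = hl_sig l' j 0.
  by rewrite /=; case: eqP => // ->; rewrite s20 sgi.
have e1 j : hl_sig l'' j 1 = hl_sig l' j 1.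
  by rewrite /=; case: eqP => // ->; rewrite s21 sgi.
have Hl'' : is_hloop b l''.
  split; first by move=> j /= jn; case: ifP => // _; exact: cl'.
  split; first by rewrite e0.
  split; first by rewrite e1.
  by move=> j jn; rewrite e0 e1; exact: lh'.
have [t' [S' rd'']] : exists t' S', @reads G b B l'' t' S'.
  apply: (merge_reads (i := i) (Sm := Sm) rd ni (unif_mid _ _)) => //=.
  - apply: (within_act pb); [by move=> x /hdom|exact: within_cst|exact: ci].
  - by move=> x Ix; rewrite /Sm (w_act pb) ?(hdom x Ix)// wi.
  - exact: Sh.
  - by move=> i00; rewrite i00 in i0.
  - by move=> j ji; rewrite ltn_eqF//; exact: sl.
  - rewrite eqxx => u Iu; rewrite /s2 /pcat; case: ifP => // uh; rewrite /seg pSm//.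
    apply: seg_itv; first exact: ltW.
    by move: Iu; rewrite /I01 /= => /andP[? ?]; apply/andP; split; lra.
  - by move=> j /andP[ij jn]; rewrite gtn_eqF//; apply: sr; rewrite jn ltnW.
  - move=> _; rewrite hi /Sm; rewrite ik in ni ac *.
    have ShE := Sh k (ltnW ni); have [hd hc] := lh k.+1 (ltnW ni).
    have [_ _ p1] := lift k (ltnW (ltnW ni)).
    have [hd2 _] := lh k.+2 ni.
    rewrite (actM pb) ?ShE//; first by rewrite hc hd2 /= ac.
    by rewrite hd /= p1// seg1.
exists B, t, S, l'', t', S'; split=> //; split=> //.
(* The change of time with this pause; its straight-line homotopy to the identity is the deformation
   from [l''] to [l']. *)
pose rho := pcat (fun=> 0 : R) id.
have crho : {within I01, continuous rho}.
  by apply: pcat_cont => //; [exact: within_cst|exact: within_id].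
have Irho v : I01 v -> I01 (rho v).
  by rewrite /rho /pcat /I01 /= => /andP[? ?]; case: (leP v (1 / 2)) => ?; apply/andP; split; lra.
have s2rho v : s2 v = sg (rho v) by rewrite /s2 /rho /pcat; case: ifP.
have rho0 : rho 0 = 0 by rewrite /rho /pcat ifT//; lra.
have rho1 : rho 1 = 1 by rewrite /rho /pcat ifN; [lra|rewrite -ltNge; lra].
exists (fun j q => if j == i then sg ((1 - q.1) * rho q.2 + q.1 * q.2) else hl_sig l' j q.2),
  (fun j _ => hl_h l' j); split; last split => //=.
- move=> j /= jn; case: eqP => [ji|_]; last first.
    split=> //; apply: (@within_comp (R * R)%type R (G0 G) I01sq I01 snd (hl_sig l' j)) => //.
    + by move=> q [].
    + exact: within_snd.
    + exact: cl'.
  split; last first.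
    move=> v Iv /=; rewrite subr0 mul1r mul0r addr0 s2rho subrr mul0r mul1r add0r.
    by rewrite ji sgi.
  apply: (@within_comp (R * R)%type R (G0 G) I01sq I01
    (fun q => (1 - q.1) * rho q.2 + q.1 * q.2) sg) => //.
    move=> q [q1 /[dup] q2 /Irho]; move: q1 q2; rewrite /I01 /=.
    by move=> /andP[? ?] /andP[? ?] /andP[? ?]; apply/andP; split; nra.
  apply: within_addr; apply: within_mulr.
  + by apply: within_subr; [exact: within_cst|exact: within_fst].
  + apply: (@within_comp (R * R)%type R R I01sq I01 snd rho) => //; first by move=> q [].
    exact: within_snd.
  + exact: within_fst.
  + exact: within_snd.
- move=> j jn; split; first exact: within_cst.
  split=> //; split=> // u Iu; have [hd hc] := lh' j jn.
  split.
    rewrite hd; case: eqP => [->|//]; rewrite rho1 !mulr1 subrK; exact: sgi.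
  rewrite hc; case: eqP => [->|//]; rewrite rho0 !mulr0 addr0; exact: sgi.
- move=> u Iu; split; first by rewrite eq_sym gtn_eqF.
  case: eqP => [e|//]; rewrite rho1 !mulr1 subrK.
  by rewrite -sgi// -e.
Qed.

End Moves.

(** * Concatenation *)

Section Concat.
Variables (G : topGroupoid) (b : G0 G).

Lemma hloop_cat_loop l l' : is_hloop b l -> is_hloop b l' -> is_hloop b (hloop_cat b l l').
Proof.
move=> [cl [lb [le lh]]] [cl' [lb' [le' lh']]].
set n := hl_n l in cl le lh; set n' := hl_n l' in cl' le' lh'.
have sub k : (n.+1 + k - n.+1 = k)%N by rewrite addKn.
have gt k : (n.+1 + k <= n)%N = false by apply/negbTE; rewrite -ltnNge leq_addr.
have cases j : (j <= n + n' + 1)%N -> (j <= n)%N \/ exists2 k, (k <= n')%N & j = (n.+1 + k)%N.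
  move=> jn; have [h|h] := leqP j n; [by left|right; exists (j - n.+1)%N; last by rewrite subnKC].
  by rewrite leq_subLR; apply: leq_trans jn _; rewrite addn1 addSn.
split; first by move=> j /cases[jn|[k kn ->]] /=; rewrite ?gt ?sub ?jn; [exact: cl|exact: cl'].
split; first by [].
split; first by rewrite /= -/n -/n' addn1 -addSn gt sub.
move=> [//|j] /andP[_ /cases[jn|[k kn jE]]]; rewrite /= -/n.
  by rewrite jn (ltnW jn); exact: lh.
rewrite jE gt sub; have {}jE : j = (n + k)%N by move: jE; rewrite addSn => -[].
rewrite jE; case: k kn {jE} => [|k] kn.
  by rewrite !addn0 leqnn eqxx gdom_unit gcod_unit le lb'.
rewrite -[(n + k.+1)%N]addSnnS gt sub gtn_eqF; last by rewrite addnS ltnS leq_addr.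
exact: lh' k.+1 kn.
Qed.

(** The lifts are carried into [C] by [j1] and [j2]. At the gluing time [1 / 2] both equal the
    common marked point, which matches the unit arrow that [hloop_cat] inserts at index [n.+1]. *)
Lemma concat_reads (B1 B2 C : mbundle b) l l' t S t' S' : is_hloop b l -> is_hloop b l' ->
  @reads G b B1 l t S -> @reads G b B2 l' t' S' -> mb_concat B1 B2 C ->
  exists t'' S'', @reads G b C (hloop_cat b l l') t'' S''.
Proof.
move=> Hl Hl' [t0 t1 tlt lift [S0 S1 Sh]] [t0' t1' tlt' lift' [S0' S1' Sh']].
move=> [j1 [j2 [[c1 _] [[c2 _] [w1 [w2 [a1 [a2 [mid [m0 m1]]]]]]]]]].
have [cl [lb [le lh]]] := Hl; have [cl' [lb' [le' lh']]] := Hl'.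
set n := hl_n l in t1 tlt lift S1 Sh cl le lh.
set n' := hl_n l' in t1' tlt' lift' S1' Sh' cl' le' lh'.
have sub k : (n.+1 + k - n.+1 = k)%N by rewrite addKn.
have gt k : (n.+1 + k <= n)%N = false by apply/negbTE; rewrite -ltnNge leq_addr.
pose t'' j := if (j <= n)%N then t j / 2 else (1 + t' (j - n.+1)%N) / 2.
pose S'' j x := if (j <= n)%N then j1 (S j (2 * x)) else j2 (S' (j - n.+1)%N (2 * x - 1)).
(* The first formula is valid one index further, since [t n.+1 / 2] and [(1 + t' 0) / 2] are both
   [1 / 2]. *)
have tE j : (j <= n.+1)%N -> t'' j = t j / 2.
  rewrite leq_eqVlt => /orP[/eqP->|jn]; last by rewrite /t'' -ltnS jn.
  by rewrite /t'' ltnn subnn t0' t1 addr0.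
have tE' k : t'' (n.+1 + k)%N = (1 + t' k) / 2 by rewrite /t'' gt sub.
have SE j : (j <= n)%N -> S'' j = (fun x => j1 (S j (2 * x))) by move=> jn; rewrite /S'' jn.
have SE' k : S'' (n.+1 + k)%N = (fun x => j2 (S' k (2 * x - 1))) by rewrite /S'' gt sub.
have cases j : (j <= n + n' + 1)%N -> (j <= n)%N \/ exists2 k, (k <= n')%N & j = (n.+1 + k)%N.
  move=> jn; have [h|h] := leqP j n; [by left|right; exists (j - n.+1)%N; last by rewrite subnKC].
  by rewrite leq_subLR; apply: leq_trans jn _; rewrite addn1 addSn.
have two x : 2 * (x / 2) = x :> R by field.
have two' x : 2 * ((1 + x) / 2) - 1 = x :> R by field.
have itvE r s x : itv (r / 2) (s / 2) x -> itv r s (2 * x).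
  by rewrite /itv /= => /andP[? ?]; apply/andP; split; lra.
have itvE' r s x : itv ((1 + r) / 2) ((1 + s) / 2) x -> itv r s (2 * x - 1).
  by rewrite /itv /= => /andP[? ?]; apply/andP; split; lra.
exists t'', S''; rewrite /reads /= -/n -/n'; split.
- by rewrite tE// t0 mul0r.
- have -> : (n + n' + 1).+1 = (n.+1 + n'.+1)%N by rewrite addn1 addSn addnS.
  by rewrite tE' t1'; lra.
- move=> j /cases[jn|[k kn ->]].
    rewrite !tE ?ltnS//; last exact: leqW.
    by rewrite ltr_pM2r ?invr_gt0//; exact: tlt.
  rewrite -addnS !tE' ltr_pM2r ?invr_gt0// ltrD2l; exact: tlt'.
- move=> j /cases[jn|[k kn ->]].
    have [cS wS pS] := lift j jn; rewrite SE// !tE ?ltnS//; last exact: leqW.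
    rewrite jn; split.
    + apply: (@within_compT R (mb_E B1) (mb_E C) _ (fun x => S j (2 * x)) j1) => //.
      apply: (@within_comp R R (mb_E B1) _ (itv (t j) (t j.+1)) (fun x => 2 * x) (S j)) => //.
        by move=> x /itvE.
      by apply: within_mulr; [exact: within_cst|exact: within_id].
    + by move=> x /itvE xi; have [-> _] := w1 (S j (2 * x)); rewrite wS// mulrC mulKf// pnatr_eq0.
    + move=> u Iu; rewrite pS// /seg; have [_ ->] := w1 (S j (2 * (t j / 2 + u * (t j.+1 / 2 - t j / 2)))).
      by congr (mb_p (S j _)); field.
  have [cS wS pS] := lift' k kn; rewrite SE' -addnS !tE' gt sub; split.
  + apply: (@within_compT R (mb_E B2) (mb_E C) _ (fun x => S' k (2 * x - 1)) j2) => //.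
    apply: (@within_comp R R (mb_E B2) _ (itv (t' k) (t' k.+1)) (fun x => 2 * x - 1) (S' k)) => //.
      by move=> x /itvE'.
    apply: within_subr; last exact: within_cst.
    by apply: within_mulr; [exact: within_cst|exact: within_id].
  + move=> x /itvE' xi; have [-> _] := w2 (S' k (2 * x - 1)); rewrite wS//.
    by field.
  + move=> u Iu; rewrite pS// /seg.
    have [_ ->] := w2 (S' k (2 * ((1 + t' k) / 2 + u * ((1 + t' k.+1) / 2 - (1 + t' k) / 2)) - 1)).
    by congr (mb_p (S' k _)); field.
- split.
  + by rewrite SE// mulr0 S0 m0.
  + have -> : (n + n' + 1)%N = (n.+1 + n')%N by rewrite addn1 addSn.
    by rewrite SE' (_ : 2 * 1 - 1 = 1 :> R) ?S1' ?m1//; lra.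
  move=> j jn; have [jn'|nj] : (j < n)%N \/ (n <= j)%N by case: ltnP => ?; [left|right].
    rewrite !SE//; last exact: ltnW.
    rewrite jn' tE; last exact: ltnW.
    rewrite two -a1 ?Sh//.
    have [-> _] := lh j.+1 jn'; have [_ _ pS] := lift j (ltnW jn').
    by rewrite /= pS// seg1.
  move: nj; rewrite leq_eqVlt => /orP[/eqP<-|nj].
    rewrite ltnn eqxx SE// tE// two t1 S1.
    have -> : S'' n.+1 = S'' (n.+1 + 0)%N by rewrite addn0.
    rewrite SE' (_ : 2 * (1 / 2) - 1 = 0 :> R); last by lra.
    rewrite S0' -mid; have := act1 (@mb_bundle _ _ C) (j1 (@mb_s1 _ _ B1)).
    by rewrite (w1 _).2 mb_s1p.
  have [k kj] : exists k, j = (n.+1 + k)%N by exists (j - n.+1)%N; rewrite subnKC.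
  rewrite kj in jn *.
  have kn : (k < n')%N.
    by move: jn; rewrite -addnA addn1 -[(n + n'.+1)%N]addSnnS ltn_add2l.
  rewrite -addnS gt [(_ == n.+1)]gtn_eqF; last by rewrite addnS ltnS leq_addr.
  rewrite sub !SE' tE' two' -a2 ?Sh'//.
  have [-> _] := lh' k.+1 kn; have [_ _ pS] := lift' k (ltnW kn).
  by rewrite /= pS// seg1.
Qed.

End Concat.

(* A group isomorphism Phi : pi_1(H,b) -> Pi_1(H,b), given on representatives:
   it is well defined and injective on classes, surjective on classes, and
   multiplicative (concatenation of loops goes to concatenation of bundles). *)
Theorem theorem5p6 (G : topGroupoid) (b : G0 G) :
  etale G -> locally_path_connected (G0 G) ->
  exists Phi : hloop G -> mbundle b,
    (forall l l', is_hloop b l -> is_hloop b l' ->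
       (loop_equiv b l l' <-> Pi_equiv (Phi l) (Phi l'))) /\
    (forall B : mbundle b, exists l, is_hloop b l /\ Pi_equiv B (Phi l)) /\
    (forall l l', is_hloop b l -> is_hloop b l' ->
       forall C : mbundle b, mb_concat (Phi l) (Phi l') C ->
         Pi_equiv C (Phi (hloop_cat b l l'))).
Proof.
move=> Get _.
have ex l : is_hloop b l -> exists B : mbundle b, exists t S, @reads G b B l t S.
  move=> Hl; have [B [S rd]] := reads_exist Hl (unif0 _) (unif1 _) (fun i _ => unif_lt _ i).
  by exists B, (unif (hl_n l)), S.
(* The trivial loop yields a bundle [B0], the value of [Phi] on data that are not loops. *)
have H0 : is_hloop b (HLoop 0 (fun _ _ => b) (fun=> @gunit G b)).
  split; first by move=> i _; exact: within_cst.
  by split=> //; split=> // -[].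
have [B0 _] := ex _ H0.
have [Phi PhiP] : exists Phi : hloop G -> mbundle b, forall l, is_hloop b l ->
    exists t S, @reads G b (Phi l) l t S.
  suff /choice[Phi PhiP] : forall l, exists B : mbundle b, is_hloop b l ->
      exists t S, @reads G b B l t S by exists Phi.
  move=> l; have [/ex[B rd]|nl] := pselect (is_hloop b l); first by exists B.
  by exists B0.
have Phi_reads (B : mbundle b) l t S : is_hloop b l -> @reads G b B l t S -> Pi_equiv B (Phi l).
  by move=> Hl rd; have [t' [S' rd']] := PhiP l Hl; exact: reads_Pi_equiv rd rd'.
have Phi_deform (B : mbundle b) l l' t S : is_hloop b l -> is_hloop b l' ->
    @reads G b B l t S -> deform b l l' -> Pi_equiv B (Phi l').
  move=> Hl Hl' rd dl; have [t' [S' rd']] := PhiP l' Hl'.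
  by apply: rst_step; exact: deform_homotopic rd rd' dl.
exists Phi; split; last split.
- move=> l l' Hl Hl'; split=> [e|e].
    (* The closure is taken on all of [hloop G], so being a loop is carried along the induction, in
       both directions because of symmetry. *)
    suff H x y : loop_equiv b x y -> (is_hloop b x <-> is_hloop b y) /\
        (is_hloop b x -> Pi_equiv (Phi x) (Phi y)) by exact: (H _ _ e).2.
    elim=> {x y} [x y|x|x y _ [xy IH]|x y z _ [xy IH] _ [yz IH']].
    + move=> [Hx [Hy st]]; split=> // _; case: st => [mc|[mi|md]].
      * have [B [t [S [x' [t' [S' [rd rd' Hx' dx]]]]]]] := move_const_reads Hx Hy mc.
        apply: (rst_trans _ _ _ B); first by apply: rst_sym; exact: Phi_reads rd.
        exact: Phi_deform Hx' Hy rd' dx.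
      * have [B [t [S [t' [S' [rd rd']]]]]] := move_id_reads Hx mi.
        apply: (rst_trans _ _ _ B); first by apply: rst_sym; exact: Phi_reads rd.
        exact: Phi_reads rd'.
      * by have [t [S rd]] := PhiP x Hx; exact: Phi_deform rd md.
    + by split=> // _; exact: rst_refl.
    + by split; [symmetry|move=> /xy Hx; apply: rst_sym; exact: IH].
    + split; first by rewrite xy.
      by move=> Hx; apply: rst_trans (IH Hx) _; apply: IH'; exact/xy.
  (* The bundles between two values of [Phi] need not be values of [Phi], hence the generalization
     to arbitrary readings; a middle bundle reads some loop by [bundle_reads]. *)
  suff H (B B' : mbundle b) : Pi_equiv B B' -> forall x y, is_hloop b x -> is_hloop b y ->
      (exists t S, @reads G b B x t S) -> (exists t S, @reads G b B' y t S) -> loop_equiv b x y.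
    by apply: (H _ _ e) => //; exact: PhiP.
  elim=> {B B'} [B B' hB|B|B B' _ IH|B B' B'' _ IH _ IH'] x y Hx Hy.
  + by move=> [t [S rd]] [t' [S' rd']]; exact: reads_homotopic Hx Hy rd rd' hB.
  + by move=> [t [S rd]] [t' [S' rd']]; exact: reads_uniq Hx Hy rd rd'.
  + by move=> rd rd'; apply: rst_sym; exact: IH.
  + move=> rd rd'; have [z [t [S [Hz rdz]]]] := bundle_reads B' Get.
    apply: (rst_trans _ _ _ z); first by apply: IH => //; exists t, S.
    by apply: IH' => //; exists t, S.
- move=> B; have [l [t [S [Hl rd]]]] := bundle_reads B Get.
  by exists l; split=> //; exact: Phi_reads rd.
- move=> l l' Hl Hl' C cC.
  have [t [S rd]] := PhiP l Hl; have [t' [S' rd']] := PhiP l' Hl'.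
  have [t'' [S'' rd'']] := concat_reads Hl Hl' rd rd' cC.
  by apply: Phi_reads rd''; exact: hloop_cat_loop.
Qed.
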